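(* Fix $\delta>0$ and let $u^\dagger$ be a sample from the Gaussian process $\mathcal N(0,(-\Delta)^{-s})$ on $\mathbb T^d$. Define $$s^{\mathrm{EB}}(q)=\operatorname*{argmin}_{t\in[d/2+\delta,1/\delta]}\Big(\|u(\cdot,t,q)\|_t^2+\log\det K(t,q)\Big),\qquad s^{\mathrm{KF}}(q)=\operatorname*{argmin}_{t\in[d/2+\delta,1/\delta]}\frac{\|u(\cdot,t,q)-u(\cdot,t,q-1)\|_t^2}{\|u(\cdot,t,q)\|_t^2}.$$ (i) If $s\in[d/2+\delta,1/\delta]$, then $s^{\mathrm{EB}}(q)\to s$ in probability as $q\to\infty$. (ii) If $\frac{s-d/2}{2}\in[d/2+\delta,1/\delta]$, then $s^{\mathrm{KF}}(q)\to\frac{s-d/2}{2}$ in probability as $q\to\infty$. Here the probability is with respect to the random draw of $u^\dagger$.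
   Context: Let $d\ge1$ and $\mathbb T^d=[0,1]^d$ with periodic identification. For $m\in\mathbb Z^d$ let $\phi_m(x)=e^{2\pi i\langle m,x\rangle}$; for a mean-zero function $v$ on $\mathbb T^d$ write $\hat v(m)=\int_{\mathbb T^d}v\,\overline{\phi_m}$ (so $\hat v(0)=0$) and, for $t>0$, $\|v\|_t^2=\sum_{m\in\mathbb Z^d}(4\pi^2|m|^2)^t|\hat v(m)|^2$. For $t>d/2$ let $K_t(x,y)=\sum_{m\in\mathbb Z^d\setminus\{0\}}(4\pi^2|m|^2)^{-t}\phi_m(x)\overline{\phi_m(y)}$ (the kernel of $(-\Delta)^{-t}$ on mean-zero periodic functions; its RKHS is $\{v:\|v\|_t<\infty\}$ with norm $\|\cdot\|_t$). For $q\in\mathbb N$ let $J_q=\{0,1,\dots,2^q-1\}^d$, $x_j=j2^{-q}$ for $j\in J_q$, and $\mathcal X_q=\{x_j:j\in J_q\}$ (so $\mathcal X_{q-1}\subset\mathcal X_q$). $K(t,q)$ is the $2^{qd}\times2^{qd}$ Gram matrix $(K_t(x_i,x_j))_{i,j\in J_q}$. Given $u^\dagger$, $u(\cdot,t,q)=K_t(\cdot,\mathcal X_q)K(t,q)^{-1}u^\dagger(\mathcal X_q)$ is the Gaussian process regression (kernel interpolation) estimate, equivalently the element of minimal $\|\cdot\|_t$ norm interpolating $u^\dagger$ on $\mathcal X_q$. The Gaussian process $\mathcal N(0,(-\Delta)^{-s})$, $s>d/2$, is the random field $u^\dagger=\sum_{m\ne0}(4\pi^2|m|^2)^{-s/2}\xi_m\phi_m$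 with $\xi_m$ i.i.d. standard normal; following the paper, its Fourier coefficients $\hat u(m)$, $m\neq0$, are independent centred Gaussians with variance $(4\pi^2)^{-s}|m|^{-2s}$. *)

(* Defs.v *)
From HB Require Import structures.
From mathcomp Require Import all_boot all_order all_algebra.
From mathcomp Require Import all_classical all_reals all_analysis.
From mathcomp Require Import complex.
Set Implicit Arguments.
Unset Strict Implicit.
Unset Printing Implicit Defensive.
Import Order.TTheory GRing.Theory Num.Theory.
Import numFieldTopology.Exports numFieldNormedType.Exports.
Local Open Scope ring_scope.

Definition lattice (d : nat) := {ffun 'I_d -> int}.

Section Defs.
Variables (R : realType) (d : nat).
Local Open Scope complex_scope.

Definition lam (m : lattice d) : R :=
  4 * pi ^+ 2 * \sum_(i < d) ((m i)%:~R) ^+ 2.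

(* points of R^d (representatives of points of T^d) *)
Definition pt := 'I_d -> R.

(* 2 pi <m, x>  ( so  phi_m(x) = cos(phase) + i sin(phase) ) *)
Definition phase (m : lattice d) (x : pt) : R :=
  2 * pi * \sum_(i < d) (m i)%:~R * x i.

Definition cexp (th : R) : R[i] := cos th +i* sin th.

Definition boxsum (N : nat) (F : lattice d -> R) : R :=
  \sum_(k : {ffun 'I_d -> 'I_(N.*2.+1)}) F [ffun i => (k i)%:Z - N%:Z].
Definition latsum (F : lattice d -> R) : R := limn (fun N => boxsum N F).

(* Kernel K_t(x,y) = sum_{m<>0} (4pi^2|m|^2)^{-t} phi_m(x) conj(phi_m(y));
   it is real (terms m and -m pair up), equal to the cosine series below. *)
Definition Kt (t : R) (x y : pt) : R :=
  latsum (fun m => if m == 0 then 0 else lam m `^ (- t) * cos (phase m x - phase m y)).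

Definition Jq (q : nat) := {ffun 'I_d -> 'I_(2 ^ q)}.
Definition npts (q : nat) := #|{: Jq q}|.
Definition node (q : nat) (j : Jq q) : pt := fun i => (j i)%:R / (2 ^ q)%:R.
Definition gridpt (q : nat) (k : 'I_(npts q)) : pt := node (enum_val k).

Definition Gram (t : R) (q : nat) : 'M[R]_(npts q) :=
  \matrix_(i, k) Kt t (gridpt i) (gridpt k).

(* Fourier coefficients (m <> 0) of the GPR estimate
   u(.,t,q) = K_t(., X_q) K(t,q)^{-1} y, with data y = u^dagger(X_q):
   hat u(m) = (4pi^2|m|^2)^{-t} sum_j alpha_j conj(phi_m(x_j)),
   alpha = K(t,q)^{-1} y. *)
Definition gpr_coef (t : R) (q : nat) (y : 'cV[R[i]]_(npts q)) (m : lattice d) : R[i] :=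
  let alpha := invmx (map_mx (fun r => r%:C) (Gram t q)) *m y in
  if m == 0 then 0
  else (lam m `^ (- t))%:C * \sum_(k < npts q) alpha k 0 * cexp (- phase m (gridpt k)).

(* ||v||_t^2 = sum_m (4pi^2|m|^2)^t |hat v(m)|^2 for a mean-zero v given by its
   Fourier coefficients *)
Definition sob2 (t : R) (c : lattice d -> R[i]) : R :=
  latsum (fun m => if m == 0 then 0
                   else lam m `^ t * (complex.Re (c m) ^+ 2 + complex.Im (c m) ^+ 2)).

(* The random field u^dagger = sum_{m<>0} (4pi^2|m|^2)^{-s/2} xi_m phi_m,
   real and imaginary parts, evaluated at x, for a realisation xi of the
   coefficients. *)
Definition udag (s : R) (xi : lattice d -> R) (x : pt) : R[i] :=
  latsum (fun m => if m == 0 then 0 else lam m `^ (- s / 2) * xi m * cos (phase m x))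
  +i* latsum (fun m => if m == 0 then 0 else lam m `^ (- s / 2) * xi m * sin (phase m x)).

Definition data (s : R) (xi : lattice d -> R) (q : nat) : 'cV[R[i]]_(npts q) :=
  \col_k udag s xi (gridpt k).

Definition EB_obj (s : R) (xi : lattice d -> R) (q : nat) (t : R) : R :=
  sob2 t (gpr_coef t (data s xi q)) + ln (\det (Gram t q)).

Definition KF_obj (s : R) (xi : lattice d -> R) (q : nat) (t : R) : R :=
  sob2 t (fun m => gpr_coef t (data s xi q) m - gpr_coef t (data s xi q.-1) m)
  / sob2 t (gpr_coef t (data s xi q)).

End Defs.

Definition is_argmin {R : realType} (F : R -> R) (a b t : R) : Prop :=
  a <= t <= b /\ forall t', a <= t' <= b -> F t <= F t'.

(* Convergence in probability (outer probability, uniformly over all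
   selections of the argmin) of argmin_{t in [a,b]} F q w t to target. *)
Definition argmin_cvg_in_prob {R : realType} {dom : measure_display}
  {Omega : measurableType dom} (P : probability Omega R)
  (F : nat -> Omega -> R -> R) (a b target : R) : Prop :=
  forall eps eta : R, 0 < eps -> 0 < eta ->
  exists Q : nat, forall q : nat, (Q <= q)%N ->
  exists A : set Omega, measurable A /\ (P A < eta%:E)%E /\
    forall w, ~ A w -> forall t, is_argmin (F q w) a b t -> `|t - target| <= eps.

(* Main.v *)
Require Import Defs.
From HB Require Import structures.
From mathcomp Require Import all_boot all_order all_algebra.
From mathcomp Require Import all_classical all_reals all_analysis.
From mathcomp Require Import measurable_realfun complex.
From mathcomp Require Import ring lra zify.
Import Order.TTheory GRing.Theory Num.Theory.
Import numFieldTopology.Exports numFieldNormedType.Exports.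
Local Open Scope classical_set_scope.
Local Open Scope ring_scope.
Set Implicit Arguments.
Unset Strict Implicit.
Unset Printing Implicit Defensive.

(**
  Frequencies congruent modulo [N = 2^q] have the same character on the grid of
  step [1 / N], so the discrete Fourier transform diagonalises [K(t,q)].  Its
  eigenvalues are [N^d A_t(r)], where [A_t(r)] is the sum of [lam^(-t)] over the
  class [r] and has order [H^(-2t)], [H] being the size of the smallest nonzero
  frequency of [r].  If [U_r] is the sum of the Fourier coefficients of the field
  over [r], then [||u(.,t,q)||_t^2] is the sum of [U_r^2 / A_t(r)], and
  [||u(.,t,q+1) - u(.,t,q)||_t^2] is the sum over the fine classes [r], contained
  in the coarse classes [r'], of [(U_r - A_t(r) U_r' / A_t(r'))^2 / A_t(r)].

  Empirical Bayes: at [t = s] the data term is [O(N^d)] by Markov's inequality.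
  For [t > s + eps] the frequencies of order [N] push it above [c N^(d + 2 eps)],
  which beats the gain [O(N^d ln N)] of the determinant; for [t < s - eps] the
  determinant loses [2 eps N^d ln N].

  Kernel flow, with [tau = (s - d/2) / 2]: at [t = tau] the numerator is at most
  [N^(-2 tau + e)] by Markov's inequality.  The denominator is bounded below by the
  first frequency and above by [C max (1, N^(2t - 4 tau + e))].  For
  [t < tau - eps], the fine class aliased to the first frequency contributes
  [c N^(-2t)] to the numerator.  For [t > tau + eps], the frequencies [m] of order
  [N] contribute [c N^(2t - 4 tau)]: the sign of [xi_m] is independent of
  [U_r] for a fine class [r] aliased to [m] on the coarse grid only, so that [U_r]
  and [U_r'] have opposite signs, and cannot compensate, for a positive
  proportion of [m].
*)

(** * The standard normal law *)

(** For empirical Bayes, s is only known to exceed d / 2: the coefficients of the field are square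
    summable but need not be absolutely summable, so the class sums [U_r] need not converge for
    every sample. Their convergence along boxes is obtained almost surely by dyadic chaining, and
    second moments pass to the limit by Fatou's lemma. The minimiser depends on the sample, so the
    estimates must hold for all t at once. The exceptional events are therefore fixed before t:
    Markov's inequality is applied only to quantities free of t, and t enters through deterministic
    bounds on [A_t(r)] that are uniform over the interval. The lower bounds use frequencies of size
    about 2^k, with q = k + l. Aliasing there has relative variance of order 2^(-2 l s), so l is
    fixed first and then k tends to infinity. A positive proportion of these frequencies is good by
    Chebyshev's inequality, for which pairwise independence of the sign events is enough. The loss e
    in the kernel flow exponents pays for the divergence of the sum of |m|^(-d). *)

Section standard_normal.
Variable R : realType.
Local Notation N01 := (@normal_prob R 0 1).
Local Notation mu := (@lebesgue_measure R).

Lemma normal01_pdfN (x : R) : normal_pdf 0 1 (- x) = normal_pdf 0 1 x.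
Proof.
by rewrite /normal_pdf oner_eq0 /normal_fun !subr0 sqrrN.
Qed.

Lemma measurable_normal_pdfE (A : set R) (m s : R) :
  measurable_fun A (fun x => (normal_pdf m s x)%:E).
Proof. apply/measurable_EFinP; apply: measurable_funTS; exact: measurable_normal_pdf. Qed.

Lemma normal01_probN (A : set R) : measurable A -> N01 (-%R @^-1` A) = N01 A.
Proof.
move=> mA; rewrite /normal_prob.
have -> : (\int[mu]_(x in -%R @^-1` A) (normal_pdf 0 1 x)%:E =
  \int[mu]_(x in (-%R : _ -> measurableTypeR R) @^-1` A)
    (((fun y => (normal_pdf 0 1 y)%:E) \o (-%R : _ -> measurableTypeR R)) x))%E.
  by apply: eq_integral => x _ /=; rewrite normal01_pdfN.
rewrite -ge0_integral_pushforward//=.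
- by apply: eq_measure_integral => //= B mB BA; rewrite lebesgue_measureN.
- exact: measurable_normal_pdfE.
- by move=> y _; rewrite lee_fin normal_pdf_ge0.
Qed.

(** Change of variables holds for the Radon-Nikodym derivative, which agrees almost everywhere with
    [normal_pdf] because both have the same integral over every measurable set. *)
Lemma ge0_integral_normal_prob (f : R -> \bar R) :
  measurable_fun setT f -> (forall x, (0 <= f x)%E) ->
  (\int[N01]_x f x = \int[mu]_x (f x * (normal_pdf 0 1 x)%:E))%E.
Proof.
move=> mf f0.
have dom := @normal_prob_dominates R 0 1.
rewrite -(Radon_Nikodym_SigmaFinite.change_of_variables dom)//.
apply: ae_eq_integral => //.
- apply: emeasurable_funM => //.
  exact: measurable_int (Radon_Nikodym_SigmaFinite.f_integrable dom).
- apply: emeasurable_funM => //.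
  exact: measurable_normal_pdfE.
- apply: ae_eqe_mul2l; apply: integral_ae_eq => //.
  + exact: Radon_Nikodym_SigmaFinite.f_integrable dom.
  + exact: measurable_normal_pdfE.
  + by move=> E _ mE; rewrite -Radon_Nikodym_SigmaFinite.f_integral.
Qed.

(** Since x^2 / 4 <= exp (x^2 / 4), the integrand is at most [c] times the normal density of
    variance 2, whose integral is 1. *)
Lemma normal01_second_moment :
  exists v : R, 0 < v /\ (\int[N01]_x (x ^+ 2)%:E <= v%:E)%E.
Proof.
pose c : R := 4 * normal_peak 1 * (normal_peak (Num.sqrt 2))^-1.
have s2 : Num.sqrt 2 != 0 :> R by rewrite gt_eqF// sqrtr_gt0.
have p1 : 0 < normal_peak (1 : R) by rewrite normal_peak_gt0 ?oner_eq0.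
have p2 : 0 < normal_peak (Num.sqrt 2 : R) by rewrite normal_peak_gt0.
have c0 : 0 < c by rewrite /c !mulr_gt0// invr_gt0.
exists c; split => //.
rewrite ge0_integral_normal_prob//; last 2 first.
- by apply/measurable_EFinP; exact: exprn_measurable.
- by move=> x; rewrite lee_fin sqr_ge0.
apply: (@le_trans _ _ (\int[mu]_x (c%:E * (normal_pdf 0 (Num.sqrt 2) x)%:E))%E).
  apply: ge0_le_integral => //.
  - by move=> x _; rewrite -EFinM lee_fin mulr_ge0 ?sqr_ge0// normal_pdf_ge0.
  - apply: emeasurable_funM; last exact: measurable_normal_pdfE.
    by apply/measurable_EFinP; exact: exprn_measurable.
  - apply: emeasurable_funM => //; exact: measurable_normal_pdfE.
  - move=> x _; rewrite -!EFinM lee_fin !normal_pdfE ?oner_eq0//.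
    rewrite /normal_fun !subr0 sqr_sqrtr// expr1n.
    have -> : c * (normal_peak (Num.sqrt 2) * expR (- x ^+ 2 / (2 *+ 2))) =
      normal_peak 1 * (4 * expR (- x ^+ 2 / (2 *+ 2))).
      by rewrite /c; field; rewrite gt_eqF.
    rewrite mulrCA ler_pM2l//.
    have -> : expR (- x ^+ 2 / (1 *+ 2)) = expR (- x ^+ 2 / (2 *+ 2)) * expR (- x ^+ 2 / (2 *+ 2)).
      by rewrite -expRD; congr expR; field.
    rewrite mulrA ler_pM2r ?expR_gt0//.
    have -> : - x ^+ 2 / (2 *+ 2) = - (x ^+ 2 / 4) by rewrite mulNr; congr (- (_ / _)); ring.
    rewrite expRN ler_pdivrMr ?expR_gt0//.
    have := expR_ge1Dx (x ^+ 2 / 4); lra.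
rewrite ge0_integralZl//=.
- by rewrite integral_normal_pdf mule1.
- exact: measurable_normal_pdfE.
- by move=> x _; rewrite lee_fin normal_pdf_ge0.
- by rewrite lee_fin ltW.
Qed.

Lemma norm_le_1Dsqr (x : R) : `|x| <= 1 + x ^+ 2.
Proof.
have -> : x ^+ 2 = `|x| ^+ 2 by rewrite real_normK ?num_real.
by have := sqr_ge0 (`|x| - 2^-1); nra.
Qed.

Lemma normal01_integrable : N01.-integrable setT (EFin : R -> \bar R).
Proof.
have mE : measurable_fun [set: R] (EFin : R -> \bar R) by exact/measurable_EFinP.
apply/integrableP; split => //.
have [v [v0 hv]] := normal01_second_moment.
apply: (@le_lt_trans _ _ (\int[N01]_x (1 + (x ^+ 2)%:E))%E).
  apply: ge0_le_integral => //.
  - exact: measurableT_comp.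
  - by apply: emeasurable_funD => //; apply/measurable_EFinP; exact: exprn_measurable.
  - by move=> x _; rewrite -EFinD lee_fin; exact: norm_le_1Dsqr.
rewrite ge0_integralD//; last 2 first.
  by move=> x _; rewrite lee_fin sqr_ge0.
  by apply/measurable_EFinP; exact: exprn_measurable.
rewrite lte_add_pinfty//; last exact: le_lt_trans hv (ltry _).
rewrite (_ : (\int[N01]__ 1)%E = 1%E) ?ltry//.
by rewrite (integral_cst N01 measurableT 1%E) mul1e; exact: probability_setT.
Qed.

(** By symmetry the integral is its own opposite, and integrability makes it finite. *)
Lemma normal01_mean : (\int[N01]_x x%:E = 0)%E.
Proof.
have mN : measurable_fun setT (-%R : R -> measurableTypeR R) by [].
have mE : measurable_fun [set: R] (EFin : R -> \bar R) by exact/measurable_EFinP.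
have E1 : (\int[N01]_x x%:E = \int[pushforward N01 (-%R : R -> measurableTypeR R)]_x x%:E)%E.
  apply: eq_measure_integral => A mA _. exact/esym/normal01_probN.
have intE := normal01_integrable.
have := E1; rewrite integral_pushforward//=; last first.
  apply/integrableP; split; first by apply/measurable_EFinP.
  case/integrableP : intE => _.
  by under [X in _ -> (X < _)%E]eq_integral do rewrite /= normrN.
rewrite preimage_setT.
have -> : (\int[N01]_x (EFin \o -%R) x = - \int[N01]_x x%:E)%E.
  under eq_integral do rewrite /= EFinN.
  by rewrite integralN//; apply: integrable_add_def.
have := integrable_fin_num measurableT intE.
by case: (\int[_]_x _)%E => // r _ [] /eqP; rewrite -addr_eq0 -mulr2n mulrn_eq0 /= => /eqP ->.
Qed.

Lemma normal01_tail_gt0 : (0 < N01 `[1%R, +oo[%classic)%E.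
Proof.
rewrite /normal_prob.
pose e : R := normal_pdf 0 1 2.
have e0 : 0 < e by rewrite /e normal_pdfE ?oner_eq0// mulr_gt0 ?normal_peak_gt0 ?oner_eq0 ?expR_gt0.
apply: (@lt_le_trans _ _ (\int[mu]_(x in `[1%R, 2%R]) e%:E)%E).
  by rewrite integral_cst//= lebesgue_measure_itv/= lte_fin ltr1n -EFinD -EFinM lte_fin mulr_gt0//; lra.
apply: (@le_trans _ _ (\int[mu]_(x in `[1%R, 2%R]) (normal_pdf 0 1 x)%:E)%E).
  apply: ge0_le_integral => //.
  - by move=> x _; rewrite lee_fin ltW.
  - exact: measurable_normal_pdfE.
  - move=> x /=; rewrite in_itv/= => /andP[x1 x2]; rewrite lee_fin /e !normal_pdfE ?oner_eq0//.
    rewrite ler_pM2l ?normal_peak_gt0 ?oner_eq0// ler_expR !subr0 ler_pM2r; last first.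
      by rewrite invr_gt0 mulrn_wgt0.
    by rewrite lerN2; nra.
apply: ge0_subset_integral => //.
- exact: measurable_normal_pdfE.
- by move=> x _; rewrite lee_fin normal_pdf_ge0.
- by move=> x /=; rewrite !in_itv/= andbT => /andP[].
Qed.

(** The density is at most its peak, itself at most 1 / 2, and the interval has length 2 k. *)
Lemma normal01_small_ball (k : R) : 0 < k -> (N01 `[(- k)%R, k]%classic <= k%:E)%E.
Proof.
move=> k0; rewrite /normal_prob.
have o1 : 1 != 0 :> R by rewrite oner_eq0.
have pk : normal_peak 1 <= 2^-1 :> R.
  rewrite /normal_peak lef_pV2 ?posrE ?ltr0n//; last first.
    by rewrite sqrtr_gt0 expr1n mul1r mulrn_wgt0// pi_gt0.
  have {1}-> : 2 = Num.sqrt (2 ^+ 2) :> R by rewrite sqrtr_sqr ger0_norm.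
  rewrite ler_sqrt ?expr1n ?mul1r; last first.
    by rewrite mulrn_wge0// pi_ge0.
  by have := @pi_ge2 R; rewrite expr2 mulr2n; lra.
apply: (@le_trans _ _ (\int[mu]_(x in `[(-k)%R, k]) (2^-1)%:E)%E).
  apply: ge0_le_integral => //.
  - by move=> x _; rewrite lee_fin normal_pdf_ge0.
  - exact: measurable_normal_pdfE.
  - by move=> x _; rewrite lee_fin (le_trans _ pk)// normal_pdf_ub.
rewrite integral_cst//= lebesgue_measure_itv/= lte_fin; case: ifPn => _.
  by rewrite -EFinB -EFinM lee_fin; lra.
by rewrite mule0 lee_fin ltW.
Qed.

End standard_normal.

(** * Orthogonality of independent normal variables *)

Section orthogonal.
Context {R : realType} {dom : measure_display} {Omega : measurableType dom}
  (P : probability Omega R).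

Lemma integral_sqr_sum_orthogonal (I : eqType) (Y : I -> Omega -> R) (v : I -> R) :
  (forall i j, P.-integrable setT (fun w => (Y i w * Y j w)%:E)) ->
  (forall i j, i != j -> (\int[P]_w (Y i w * Y j w)%:E = 0)%E) ->
  (forall i, (\int[P]_w ((Y i w) ^+ 2)%:E <= (v i)%:E)%E) ->
  forall s : seq I, uniq s ->
  (\int[P]_w ((\sum_(i <- s) Y i w) ^+ 2)%:E <= (\sum_(i <- s) v i)%:E)%E.
Proof.
move=> iY oY vY s us.
under eq_integral => w _.
  have -> : ((\sum_(i <- s) Y i w) ^+ 2)%:E =
      (\sum_(i <- s) \sum_(j <- s) (Y i w * Y j w)%:E)%E.
    rewrite expr2 mulr_suml -sumEFin; apply: eq_bigr => i _.
    by rewrite mulr_sumr sumEFin.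
  over.
rewrite integral_sum//; last by move=> i; apply: integrable_sum => // j _; exact: iY.
rewrite -sumEFin big_seq [leRHS]big_seq; apply: lee_sum => i si.
rewrite integral_sum// (bigD1_seq i)//= big1_seq ?adde0; last first.
  by move=> j /andP[ji _]; rewrite oY// eq_sym.
by under eq_integral do rewrite -expr2; exact: vY.
Qed.

Lemma markov_ge0 (f : Omega -> \bar R) (v K : R) :
  measurable_fun setT f -> (forall w, (0 <= f w)%E) -> 0 < K ->
  (\int[P]_w f w <= v%:E)%E -> (P [set w | (K%:E <= f w)%E] <= (v / K)%:E)%E.
Proof.
move=> mf f0 K0 fv.
have mid : measurable_fun [set: \bar R] id by [].
have H := @le_integral_comp_abse _ _ R P setT measurableT f K id mid.
rewrite EFinM lee_pdivlMr//.
apply: le_trans fv; rewrite muleC.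
under [leRHS]eq_integral => w _ do rewrite -(gee0_abs (f0 w)).
have {H} := H (fun r r0 => r0) (fun x y _ _ xy => xy) mf K0.
rewrite setTI; congr (_ <= _)%E; congr (_ * P _)%E.
by apply/seteqP; split => w /=; rewrite gee0_abs.
Qed.
End orthogonal.

Section independent_normals.
Context {R : realType} {dom : measure_display} {Omega : measurableType dom}
  (P : probability Omega R) (I : choiceType) (S : pred I) (X : I -> {RV P >-> R}).
Hypothesis X_normal : forall m, S m -> forall A : set R, measurable A ->
     distribution P (X m) A = normal_prob 0 1 A.
Hypothesis X_indep : forall (F : seq I) (B : I -> set R),
     uniq F -> (forall m, m \in F -> S m) -> (forall m, measurable (B m)) ->
     P [set w | forall m, m \in F -> B m (X m w)]
     = \big[*%E/1%E]_(m <- F) P (X m @^-1` B m).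

Local Notation mR := (measurableTypeR R).

Lemma X_measurable m : measurable_fun setT (X m : Omega -> mR).
Proof.
have h : measurable_fun setT (X m) by [].
by move=> mD A mA; exact: (h mD A mA).
Qed.

Lemma X_pushforward m (A : set mR) : S m -> measurable A ->
  pushforward P (X m : Omega -> mR) A = normal_prob 0 1 A.
Proof. by move=> Sm mA; exact: X_normal. Qed.

Lemma X_second_moment : exists v : R, 0 < v /\
  forall m, S m -> (\int[P]_w ((X m w) ^+ 2)%:E <= v%:E)%E.
Proof.
have [v [v0 hv]] := @normal01_second_moment R.
exists v; split => // m Sm; apply: le_trans hv.
have mX := X_measurable m.
have := @ge0_integral_pushforward _ _ Omega mR R _ mX P setT (fun x => (x ^+ 2)%:E).
rewrite preimage_setT => <-//.
- rewrite le_eqVlt; apply/orP; left; apply/eqP.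
  by apply: eq_measure_integral => A mA _; apply/X_normal.
- by apply/measurable_EFinP; exact: exprn_measurable.
- by move=> y _; rewrite lee_fin sqr_ge0.
Qed.

Lemma X_integrable_prod i j : S i -> S j ->
  P.-integrable setT (fun w => (X i w * X j w)%:E).
Proof.
move=> Si Sj; have [v [v0 hv]] := X_second_moment.
have m2 k : measurable_fun setT (fun w => ((X k w) ^+ 2)%:E).
  by apply/measurable_EFinP/measurable_funX.
have m1 : measurable_fun setT (fun w => (X i w * X j w)%:E).
  by apply/measurable_EFinP/measurable_funM.
apply/integrableP; split => //.
apply: (@le_lt_trans _ _ (\int[P]_w (((X i w) ^+ 2)%:E + ((X j w) ^+ 2)%:E))%E).
  apply: ge0_le_integral => //.
  - exact: measurableT_comp.
  - exact: emeasurable_funD.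
  - move=> w _; rewrite -EFinD abse_EFin lee_fin normrM.
    rewrite -(real_normK (num_real (X i w))) -(real_normK (num_real (X j w))).
    have := sqr_ge0 (`|X i w| - `|X j w|).
    by have := normr_ge0 (X i w); have := normr_ge0 (X j w); nra.
rewrite ge0_integralD//; try by move=> w _; rewrite lee_fin sqr_ge0.
rewrite lte_add_pinfty//; [exact: le_lt_trans (hv _ Si) (ltry _)|].
exact: le_lt_trans (hv _ Sj) (ltry _).
Qed.

Lemma X_rect2 i j (A B : set R) : S i -> S j -> i != j -> measurable A -> measurable B ->
  P (X i @^-1` A `&` X j @^-1` B) = (P (X i @^-1` A) * P (X j @^-1` B))%E.
Proof.
move=> Si Sj ij mA mB.
have := X_indep (F := [:: i; j]) (B := fun m => if m == i then A else B).
rewrite !big_cons big_nil mule1 eqxx eq_sym (negbTE ij) => <-.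
- congr (P _); apply/seteqP; split => w /=.
    by move=> [Aw Bw] m; rewrite !inE => /orP[] /eqP ->; rewrite ?eqxx// eq_sym (negbTE ij).
  move=> H; have := H i; have := H j; rewrite !inE !eqxx orbT eq_sym (negbTE ij).
  by move=> /(_ isT) ? /(_ isT).
- by rewrite /= inE ij.
- by move=> m; rewrite !inE => /orP[] /eqP ->.
- by move=> m; case: ifP.
Qed.

(** The law of the pair agrees with the product of two normal laws on rectangles, hence everywhere;
    Fubini's theorem then brings out the vanishing mean. *)
Lemma X_orthogonal i j : S i -> S j -> i != j -> (\int[P]_w (X i w * X j w)%:E = 0)%E.
Proof.
move=> Si Sj ij.
pose Z w : mR * mR := (X i w, X j w).
have mXm := X_measurable.
have mZ : measurable_fun setT Z by exact: measurable_fun_pair.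
pose f (z : mR * mR) := (z.1 * z.2)%:E.
have mf : measurable_fun setT f.
  by apply/measurable_EFinP/measurable_funM; [exact: measurable_fst|exact: measurable_snd].
have iZ : P.-integrable setT (f \o Z) by exact: X_integrable_prod.
pose D := @normal_prob R 0 1.
have pE (C : set (mR * mR)) : measurable C -> (D \x D)%E C = pushforward P Z C.
  move=> mC; apply: (product_measure_unique (m' := pushforward P Z)) => // A B mA mB.
  rewrite [LHS](X_rect2 Si Sj ij mA mB).
  by congr (_ * _)%E; exact: X_pushforward.
transitivity (\int[pushforward P Z]_z f z)%E.
  by rewrite integral_pushforward.
transitivity (\int[(D \x D)%E]_z f z)%E.
  by apply: eq_measure_integral => C mC _; exact/esym/pE.
have i12 : (D \x D)%E.-integrable setT f.
  apply/integrableP; split => //.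
  have /integrableP[_] : (pushforward P Z).-integrable setT f by exact: integrable_pushforward.
  congr (_ < _)%E.
  by apply: eq_measure_integral => C mC _; exact/esym/pE.
rewrite -integral12_prod_meas1//.
transitivity (\int[D]_x (cst 0 x))%E; last exact: integral0.
apply: eq_integral => x _; transitivity (\int[D]_y (x * y)%:E)%E => //.
under eq_integral do rewrite EFinM.
rewrite integralZl//; last exact: normal01_integrable.
by rewrite normal01_mean mule0.
Qed.

End independent_normals.

(** * Convergence of orthogonal series *)

Section dyadic_chaining.
Variable R : realType.
Implicit Types u : nat -> R.

(* Dominates [(u n - u i) ^+ 2] for all [i <= n <= i + 2 ^ k]; the weights come
   from [(x + y)^2 <= (k + 2) x^2 + (k + 2) / (k + 1) y^2]. *)
Fixpoint chain u (k i : nat) : R :=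
  if k is k'.+1 then
    k'.+2%:R * (u (i + 2 ^ k')%N - u i) ^+ 2
    + (k'.+2%:R / k'.+1%:R) * chain u k' (i + 2 ^ k')%N + chain u k' i
  else (u i.+1 - u i) ^+ 2.

Lemma chain_ge0 u k i : 0 <= chain u k i.
Proof.
elim: k i => [|k IH] i /=; first exact: sqr_ge0.
by rewrite !addr_ge0// mulr_ge0// ?sqr_ge0// divr_ge0.
Qed.

Lemma sqr_diff_le_chain u k i n : (i <= n <= i + 2 ^ k)%N ->
  (u n - u i) ^+ 2 <= chain u k i.
Proof.
elim: k i n => [|k IH] i n /=.
  rewrite expn0 addn1 => /andP[ni]; rewrite leq_eqVlt => /orP[/eqP->//|ni1].
  have -> : n = i by apply/eqP; rewrite eqn_leq ni andbT -ltnS.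
  by rewrite subrr expr0n sqr_ge0.
move=> /andP[ni nk]; have c1 := chain_ge0 u k (i + 2 ^ k)%N.
have c2 := chain_ge0 u k i.
have k1 : 0 < k.+1%:R :> R by rewrite ltr0n.
have x0 := sqr_ge0 (u (i + 2 ^ k)%N - u i).
have k2 : k.+2%:R = k.+1%:R + 1 :> R by rewrite -[k.+2]addn1 natrD.
have [le|lt] := leqP n (i + 2 ^ k)%N.
  apply: (le_trans (IH i n _)); first by rewrite ni le.
  by rewrite lerDr addr_ge0// mulr_ge0// divr_ge0.
have := IH (i + 2 ^ k)%N n; rewrite (ltnW lt) -addnA addnn -mul2n -expnS => /(_ nk) H.
have -> : u n - u i = (u (i + 2 ^ k)%N - u i) + (u n - u (i + 2 ^ k)%N) by ring.
set x := u (i + 2 ^ k)%N - u i in x0 *; set y := u n - _ in H *.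
apply: (@le_trans _ _ (k.+2%:R * x ^+ 2 + k.+2%:R / k.+1%:R * y ^+ 2)).
  rewrite k2; set K := k.+1%:R in k1 *.
  have -> : (K + 1) * x ^+ 2 + (K + 1) / K * y ^+ 2 = (x + y) ^+ 2 + K^-1 * (K * x - y) ^+ 2.
    by field; rewrite gt_eqF.
  by rewrite lerDl mulr_ge0 ?sqr_ge0// invr_ge0 ltW.
rewrite -addrA lerD2l; apply: (@le_trans _ _ (k.+2%:R / k.+1%:R * chain u k (i + 2 ^ k)%N)).
  by rewrite ler_wpM2l// divr_ge0.
by rewrite lerDl.
Qed.

(** Increments between consecutive powers of two are summed as a geometric series, and any other
    index is compared with the power of two just below it. *)
Lemma cvg_dyadic_geometric u (Z t : R) : 0 <= Z -> 0 <= t -> t < 1 ->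
  (forall k n, (2 ^ k <= n <= 2 ^ k.+1)%N -> `|u n - u (2 ^ k)%N| <= Z * t ^+ k) ->
  cvgn u.
Proof.
move=> Z0 t0 t1 H.
have t1' : 0 < 1 - t by rewrite subr_gt0.
have step k j : `|u (2 ^ (k + j))%N - u (2 ^ k)%N| <= Z / (1 - t) * (t ^+ k - t ^+ (k + j)).
  elim: j => [|j IH]; first by rewrite addn0 !subrr normr0 mulr0.
  rewrite (le_trans (ler_distD (u (2 ^ (k + j))%N) _ _))//.
  apply: (@le_trans _ _ (Z * t ^+ (k + j) + Z / (1 - t) * (t ^+ k - t ^+ (k + j)))).
    apply: lerD => //; apply: H.
    by rewrite !leq_exp2l// addnS leqnSn leqnn.
  rewrite addnS exprS le_eqVlt; apply/orP; left; apply/eqP.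
  by field; rewrite gt_eqF.
have bnd k n : (2 ^ k <= n)%N -> `|u n - u (2 ^ k)%N| <= 2 * (Z / (1 - t)) * t ^+ k.
  move=> kn; have n0 : (0 < n)%N by apply: leq_trans kn; rewrite expn_gt0.
  pose j := trunc_log 2 n.
  have /andP[j1 j2] : (2 ^ j <= n < 2 ^ j.+1)%N by exact: trunc_log_bounds.
  have kj : (k <= j)%N by exact: trunc_log_max.
  rewrite (le_trans (ler_distD (u (2 ^ j)%N) _ _))//.
  have Hn : `|u n - u (2 ^ j)%N| <= Z * t ^+ j by apply: H; rewrite j1 ltnW.
  have := step k (j - k)%N; rewrite subnKC// => Hs.
  have tk : 0 <= t ^+ k by exact: exprn_ge0.
  have tj : 0 <= t ^+ j by exact: exprn_ge0.
  have tjk : t ^+ j <= t ^+ k by apply: ler_wiXn2l => //; exact: ltW.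
  have ZZ : Z <= Z / (1 - t) by rewrite ler_pdivlMr//; nra.
  have Zt : 0 <= Z / (1 - t) by rewrite divr_ge0// ltW.
  by nra.
apply/cauchy_cvgP/cauchy_exP => e e0.
have : (fun k => 2 * (Z / (1 - t)) * t ^+ k) @ \oo --> (0 : R).
  by apply: cvg_geometric; rewrite ger0_norm.
move=> /cvgrPdist_lt /(_ (e / 2)).
rewrite divr_gt0// => /(_ isT) [K _ HK].
have {HK} := HK K (leqnn K); rewrite /= sub0r normrN => HK.
have HK' : 2 * (Z / (1 - t)) * t ^+ K < e / 2 by exact: le_lt_trans (ler_norm _) HK.
exists (u (2 ^ K)%N); exists (2 ^ K)%N => // n /= Kn; rewrite /ball/= distrC.
by have := bnd _ _ Kn; lra.
Qed.

End dyadic_chaining.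

(** * Almost sure convergence from second moments *)

Section random_sequences.
Context {R : realType} {dom : measure_display} {Omega : measurableType dom}
  (P : probability Omega R).
Variables (T : nat -> Omega -> R).
Hypothesis mT : forall n, measurable_fun setT (T n).

Lemma measurable_chain k i : measurable_fun setT (fun w => chain (T ^~ w) k i).
Proof.
elim: k i => [|k IH] i /=; first by apply: measurable_funX; exact: measurable_funB.
apply: measurable_funD; last exact: IH.
apply: measurable_funD; apply: measurable_funM => //.
by apply: measurable_funX; exact: measurable_funB.
Qed.

(** The factor [k.+1 ^+ 2] is the squared logarithm of the Rademacher-Menshov inequality: the
    maximum over a block of length 2^k costs only this much over a single increment. *)
Lemma integral_chain_le (B : nat -> R) :
  (forall i j, (i <= j)%N -> (\int[P]_w ((T j w - T i w) ^+ 2)%:E <= (B j - B i)%:E)%E) ->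
  forall k i,
  (\int[P]_w (chain (T ^~ w) k i)%:E <= (k.+1%:R ^+ 2 * (B (i + 2 ^ k)%N - B i))%:E)%E.
Proof.
move=> HB; have B0 i j : (i <= j)%N -> 0 <= B j - B i.
  move=> ij; rewrite -lee_fin; apply: le_trans (HB _ _ ij).
  by apply: integral_ge0 => w _; rewrite lee_fin sqr_ge0.
elim=> [|k IH] i /=.
  by rewrite expr1n mul1r expn0 addn1; exact: HB.
have m1 : measurable_fun setT (fun w => (k.+2%:R * (T (i + 2 ^ k)%N w - T i w) ^+ 2)%:E).
  apply/measurable_EFinP/measurable_funM => //.
  by apply: measurable_funX; exact: measurable_funB.
have m2 j : measurable_fun setT (fun w => (chain (T ^~ w) k j)%:E).
  by apply/measurable_EFinP; exact: measurable_chain.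
have m3 : measurable_fun setT (fun w => (k.+2%:R / k.+1%:R * chain (T ^~ w) k (i + 2 ^ k)%N)%:E).
  by apply/measurable_EFinP/measurable_funM => //; exact: measurable_chain.
have k1 : 0 < k.+1%:R :> R by rewrite ltr0n.
have k2 : k.+2%:R = k.+1%:R + 1 :> R by rewrite -[k.+2]addn1 natrD.
under eq_integral do rewrite !EFinD.
rewrite ge0_integralD//; last 3 first.
- move=> w _; rewrite -EFinD lee_fin addr_ge0// mulr_ge0// ?sqr_ge0// ?chain_ge0//.
- exact: emeasurable_funD.
- by move=> w _; rewrite lee_fin chain_ge0.
rewrite ge0_integralD//; last 2 first.
- by move=> w _; rewrite lee_fin mulr_ge0// sqr_ge0.
- by move=> w _; rewrite lee_fin mulr_ge0// ?chain_ge0// divr_ge0.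
under eq_integral do rewrite EFinM.
rewrite ge0_integralZl//; last 2 first.
- by apply/measurable_EFinP/measurable_funX; exact: measurable_funB.
- by move=> w _; rewrite lee_fin sqr_ge0.
under [X in (_ + X + _)%E]eq_integral do rewrite EFinM.
rewrite ge0_integralZl//; last by move=> w _; rewrite lee_fin chain_ge0.
set b1 := B (i + 2 ^ k)%N - B i.
set b2 := B (i + 2 ^ k.+1)%N - B (i + 2 ^ k)%N.
have ee : (i + 2 ^ k + 2 ^ k = i + 2 ^ k.+1)%N by rewrite -addnA addnn -mul2n -expnS.
have b10 : 0 <= b1 by apply: B0; rewrite leq_addr.
have b20 : 0 <= b2 by apply: B0; rewrite leq_add2l leq_exp2l.
apply: (@le_trans _ _ (k.+2%:R%:E * b1%:E + (k.+2%:R / k.+1%:R)%:E * (k.+1%:R ^+ 2 * b2)%:E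
   + (k.+1%:R ^+ 2 * b1)%:E)%E).
  apply: leeD; last exact: IH.
  apply: leeD; apply: lee_wpmul2l => //.
  - by apply: HB; rewrite leq_addr.
  - by have := IH (i + 2 ^ k)%N; rewrite ee.
rewrite -!EFinM -!EFinD lee_fin.
have -> : B (i + 2 ^ k.+1)%N - B i = b1 + b2 by rewrite /b1 /b2; ring.
have -> : k.+2%:R / k.+1%:R * (k.+1%:R ^+ 2 * b2) = k.+2%:R * (k.+1%:R * b2).
  by field; rewrite gt_eqF.
rewrite k2; set K := k.+1%:R in k1 *.
have : 0 <= K * b1 by rewrite mulr_ge0// ltW.
have : 0 <= K * b2 by rewrite mulr_ge0// ltW.
by nra.
Qed.

(* Rademacher-Menshov, in the easy case of geometrically decaying dyadic blocks. *)
Lemma ae_cvg_orthogonal (B : nat -> R) (C r : R) :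
  (forall i j, (i <= j)%N -> (\int[P]_w ((T j w - T i w) ^+ 2)%:E <= (B j - B i)%:E)%E) ->
  1 < r -> (forall k, B (2 ^ k.+1)%N - B (2 ^ k)%N <= C * r^-1 ^+ (8 * k)) ->
  exists N, [/\ measurable N, P N = 0 & forall w, ~ N w -> cvgn (T ^~ w)].
Proof.
move=> HB r1 HC.
have r0 : 0 < r by apply: lt_trans r1.
have ri0 : 0 < r^-1 by rewrite invr_gt0.
have ri1 : r^-1 < 1 by rewrite invf_lt1.
have C0 : 0 <= C.
  have := HC 0%N; rewrite muln0 expr0 mulr1; apply: le_trans.
  rewrite -lee_fin; apply: le_trans (HB _ _ _) => //.
  by apply: integral_ge0 => w _; rewrite lee_fin sqr_ge0.
(* Bernoulli's inequality for powers of [r ^+ 2] gives k + 1 <= D r^(2k), which absorbs the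
   polynomial factor of the chaining bound. *)
pose D := 1 + (r ^+ 2 - 1)^-1.
have r2 : 0 < r ^+ 2 - 1 by nra.
have D0 : 0 <= D by rewrite /D addr_ge0// invr_ge0 ltW.
have kD k : k.+1%:R <= D * r ^+ (2 * k).
  rewrite exprM; set x := r ^+ 2 in D r2 D0 *.
  have bern : 1 + k%:R * (x - 1) <= x ^+ k.
    elim: k => [|k IH]; first by rewrite mul0r addr0 expr0.
    rewrite exprS; apply: (@le_trans _ _ (x * (1 + k%:R * (x - 1)))).
      have k0 : 0 <= k%:R :> R by [].
      rewrite -[k.+1]addn1 natrD; have : 0 <= k%:R * (x - 1) ^+ 2 by rewrite mulr_ge0// sqr_ge0.
      by nra.
    by rewrite ler_wpM2l//; lra.
  have k0 : 0 <= k%:R :> R by [].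
  apply: (@le_trans _ _ (D * (1 + k%:R * (x - 1)))); last by rewrite ler_wpM2l.
  have -> : D * (1 + k%:R * (x - 1)) = 1 + k%:R + (x - 1)^-1 + k%:R * (x - 1).
    by rewrite /D; field; rewrite gt_eqF.
  rewrite -[k.+1]addn1 natrD; have : 0 <= (x - 1)^-1 by rewrite invr_ge0 ltW.
  have : 0 <= k%:R * (x - 1) by rewrite mulr_ge0// ltW.
  by lra.
(* Of the available decay r^(-8k), the chaining factor uses up r^(4k) and the weight in [g] r^(2k);
   the remaining r^(-2k) is summable. Finiteness of the sum then bounds [chain] by Z r^(-2k). *)
pose g k w := (r ^+ (2 * k) * chain (T ^~ w) k (2 ^ k)%N)%:E.
have mg k : measurable_fun setT (g k).
  by apply/measurable_EFinP/measurable_funM => //; exact: measurable_chain.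
have g0 k w : (0 <= g k w)%E by rewrite lee_fin mulr_ge0// ?chain_ge0// exprn_ge0// ltW.
have ig k : (\int[P]_w g k w <= (geometric (C * D ^+ 2) (r^-1 ^+ 2) k)%:E)%E.
  rewrite /g; under eq_integral do rewrite EFinM.
  rewrite ge0_integralZl//; last 3 first.
  - by apply/measurable_EFinP; exact: measurable_chain.
  - by move=> w _; rewrite lee_fin chain_ge0.
  - by rewrite lee_fin exprn_ge0// ltW.
  apply: (@le_trans _ _ ((r ^+ (2 * k))%:E * (k.+1%:R ^+ 2 * (C * r^-1 ^+ (8 * k)))%:E)%E).
    apply: lee_wpmul2l; first by rewrite lee_fin exprn_ge0// ltW.
    apply: le_trans (integral_chain_le HB _ _) _; rewrite lee_fin ler_wpM2l ?sqr_ge0//.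
    by rewrite addnn -mul2n -expnS.
  rewrite -EFinM lee_fin /geometric/=.
  apply: (@le_trans _ _ (r ^+ (2 * k) * ((D * r ^+ (2 * k)) ^+ 2 * (C * r^-1 ^+ (8 * k))))).
    have rk : 0 <= r ^+ (2 * k) by rewrite exprn_ge0// ltW.
    have rik : 0 <= r^-1 ^+ (8 * k) by rewrite exprn_ge0// ltW.
    rewrite ler_wpM2l// ler_wpM2r ?mulr_ge0//.
    by rewrite lerXn2r ?nnegrE ?mulr_ge0.
  rewrite le_eqVlt; apply/orP; left; apply/eqP.
  pose y := r ^+ k.
  have y0 : y != 0 by rewrite /y gt_eqF// exprn_gt0.
  have -> : r ^+ (2 * k) = y ^+ 2 by rewrite -exprM mulnC.
  have -> : r^-1 ^+ (8 * k) = y^-1 ^+ 8 by rewrite mulnC exprM exprVn.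
  have -> : r^-1 ^+ 2 ^+ k = y^-1 ^+ 2 by rewrite -exprM mulnC exprM exprVn.
  by field.
pose f w := (\sum_(k <oo) g k w)%E.
have intf : P.-integrable setT f.
  apply/integrableP; split.
    by apply: ge0_emeasurable_sum => // k w _ _; exact: g0.
  under eq_integral => w _ do rewrite gee0_abs ?nneseries_ge0//.
  rewrite integral_nneseries//.
  apply: (@le_lt_trans _ _ (\sum_(k <oo) (geometric (C * D ^+ 2) (r^-1 ^+ 2) k)%:E)%E).
    by apply: lee_nneseries => // k _ _; apply: integral_ge0.
  have cg : cvgn (series (geometric (C * D ^+ 2) (r^-1 ^+ 2))).
    apply: is_cvg_geometric_series; rewrite ger0_norm ?exprn_ge0 ?ltW//.
    by rewrite exprn_ilt1// ltW.
  rewrite (_ : (fun n => _) = EFin \o series (geometric (C * D ^+ 2) (r^-1 ^+ 2))); last first.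
    by apply/funext => n /=; rewrite sumEFin.
  by rewrite EFin_lim// ltry.
have [N [mN PN HN]] := integrable_ae measurableT intf.
exists N; split => // w Nw.
have fw : f w \is a fin_num by apply: contrapT => H; apply: Nw; apply: HN => /= /(_ I).
pose Z := fine (f w).
have Z0 : 0 <= Z by rewrite fine_ge0// nneseries_ge0.
have gZ k : r ^+ (2 * k) * chain (T ^~ w) k (2 ^ k)%N <= Z.
  rewrite -lee_fin fineK//.
  apply: (@le_trans _ _ (\sum_(0 <= j < k.+1) g j w)%E); last exact: nneseries_lim_ge.
  rewrite big_nat_recr//= leeDr//; exact: sume_ge0.
apply: (@cvg_dyadic_geometric _ _ (Num.sqrt Z) r^-1) => //.
- exact: ltW.
- move=> k n kn.
  have h0 : 0 <= Num.sqrt Z * r^-1 ^+ k by rewrite mulr_ge0 ?sqrtr_ge0// exprn_ge0// ltW.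
  rewrite -(@ler_pXn2r _ 2)// ?nnegrE//.
  rewrite real_normK ?num_real// exprMn sqr_sqrtr//.
  apply: (@le_trans _ _ (chain (T ^~ w) k (2 ^ k)%N)).
    by apply: sqr_diff_le_chain; rewrite addnn -mul2n -expnS.
  rewrite -exprM mulnC exprVn ler_pdivlMr ?exprn_gt0// mulrC; exact: gZ.
Qed.

Lemma integral_liminf_sqr (v : R) :
  (forall n, (\int[P]_w ((T n w) ^+ 2)%:E <= v%:E)%E) ->
  (\int[P]_w (limn_einf (fun n => ((T n w) ^+ 2)%:E)) <= v%:E)%E.
Proof.
move=> Hv; apply: (@le_trans _ _ (limn_einf (fun n => \int[P]_w ((T n w) ^+ 2)%:E)%E)).
  apply: fatou => //.
  - by move=> n; apply/measurable_EFinP/measurable_funX.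
  - by move=> n w _; rewrite lee_fin sqr_ge0.
rewrite limn_einf_lim; apply: lime_le; first exact: is_cvg_einfs.
apply: nearW => n; apply: le_trans (Hv n).
by apply: ereal_inf_lbound; exists n => /=.
Qed.

End random_sequences.

(** * Sign changes independent of the other coefficients *)

Section independence_outside.
Context {R : realType} {dom : measure_display} {Omega : measurableType dom}
  (P : probability Omega R) (I : choiceType) (S : pred I) (X : I -> {RV P >-> R}).
Hypothesis X_normal : forall m, S m -> forall A : set R, measurable A ->
     distribution P (X m) A = normal_prob 0 1 A.
Hypothesis X_indep : forall (F : seq I) (B : I -> set R),
     uniq F -> (forall m, m \in F -> S m) -> (forall m, measurable (B m)) ->
     P [set w | forall m, m \in F -> B m (X m w)]
     = \big[*%E/1%E]_(m <- F) P (X m @^-1` B m).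

Definition rect (F : seq I) (B : I -> set R) : set Omega :=
  [set w | forall m, m \in F -> B m (X m w)].

(* A pi-system generating the sigma-algebra of the [X m], [m] outside [J]. *)
Definition outside (J : pred I) : set_system Omega :=
  [set G | exists F B, [/\ uniq F, forall m, m \in F -> S m && ~~ J m,
     forall m, measurable (B m) & G = rect F B]].

Lemma measurable_rect F B : (forall m, measurable (B m)) -> measurable (rect F B).
Proof.
move=> mB.
have -> : rect F B = \big[setI/setT]_(m <- F) (X m @^-1` B m).
  elim: F => [|a F IH]; first by rewrite big_nil; apply/seteqP; split.
  rewrite big_cons -IH; apply/seteqP; split => w /=.
    by move=> H; split => [|m mF]; apply: H; rewrite inE ?eqxx// mF orbT.
  by move=> [Ba H] m; rewrite inE => /orP[/eqP ->//|]; exact: H.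
apply: bigsetI_measurable => m _.
by rewrite -[_ @^-1` _]setTI; exact: measurable_funPT.
Qed.

Lemma P_rect F B : uniq F -> (forall m, m \in F -> S m) -> (forall m, measurable (B m)) ->
  P (rect F B) = (\prod_(m <- F) P (X m @^-1` B m))%E.
Proof. exact: X_indep. Qed.

Lemma outside_setI_closed J : setI_closed (outside J).
Proof.
move=> _ _ [F1 [B1 [u1 h1 m1 ->]]] [F2 [B2 [u2 h2 m2 ->]]].
exists (undup (F1 ++ F2)), (fun m => (if m \in F1 then B1 m else setT) `&`
  (if m \in F2 then B2 m else setT)); split.
- exact: undup_uniq.
- by move=> m; rewrite mem_undup mem_cat => /orP[/h1|/h2].
- by move=> m; apply: measurableI; case: ifP.
- apply/seteqP; split => w; rewrite /rect /=.
    by move=> [H1 H2] m _; split; case: ifP => // mF; [exact: H1|exact: H2].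
  move=> H; split => m mF.
    by have := H m; rewrite mem_undup mem_cat mF => /(_ isT) [].
  by have := H m; rewrite mem_undup mem_cat mF orbT => /(_ isT) [].
Qed.

Lemma outside_measurable J G : <<s outside J >> G -> measurable G.
Proof.
apply: smallest_sub; first by split => //; [move=> A mA; rewrite setTD; exact: measurableC
  |move=> F mF; exact: bigcupT_measurable].
by move=> _ [F [B [_ _ mB ->]]]; exact: measurable_rect.
Qed.

Lemma rect_indep_outside J F B G : uniq F -> (forall m, m \in F -> S m && J m) ->
  (forall m, measurable (B m)) -> <<s outside J >> G ->
  P (rect F B `&` G) = (P (rect F B) * P G)%E.
Proof.
move=> uF hF mB; set E := rect F B; have mE : measurable E by exact: measurable_rect.
have finE A : measurable A -> P A \is a fin_num by move=> mA; exact: fin_num_measure.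
pose H : set_system Omega := [set G | measurable G /\ P (E `&` G) = (P E * P G)%E].
suff /(_ G) : <<s outside J >> `<=` H by move=> h /h [].
apply: lambda_system_subset => //.
- exact: outside_setI_closed.
- apply/dynkin_lambda_system; split.
  + by split => //; rewrite setIT probability_setT mule1.
  + move=> A [mA hA]; split; first exact: measurableC.
    have -> : P (E `&` ~` A) = (P E - P (E `&` A))%E.
      by rewrite -setDE; apply: measureD => //; rewrite -ge0_fin_numE// finE.
    rewrite hA probability_setC//.
    by rewrite muleBr ?finE// mule1.
  + move=> A tA hA; have mA n : measurable (A n) by have [] := hA n.
    split; first exact: bigcupT_measurable.
    rewrite setI_bigcupr measure_bigcup//; last 2 first.
      by move=> n _; exact: measurableI.
      apply/trivIsetP => i j _ _ ij; rewrite setIACA setIid.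
      by move/trivIsetP : tA => /(_ i j Logic.I Logic.I ij) ->; rewrite setI0.
    have -> : P (\bigcup_k A k) = (\sum_(0 <= i <oo | i \in [set: nat]) P (A i))%E.
      exact: measure_bigcup.
    rewrite -(fineK (finE _ mE)) -nneseriesZl//.
    by apply: eq_eseriesr => n _; rewrite (fineK (finE _ mE)); exact: (hA n).2.
- move=> _ [F2 [B2 [u2 h2 m2 ->]]]; split; first exact: measurable_rect.
  pose B3 m := if m \in F then B m else B2 m.
  have u3 : uniq (F ++ F2).
    rewrite cat_uniq uF u2 andbT; apply/hasPn => m /h2 /andP[_]; apply: contra.
    by move=> /hF /andP[].
  have hm : forall m, m \in F2 -> (m \in F) = false.
    move=> m /h2 /andP[_ Jm]; apply/negP => /hF /andP[_]; exact/negP.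
  have -> : E `&` rect F2 B2 = rect (F ++ F2) B3.
    apply/seteqP; split => w; rewrite /E /rect /B3/=.
      by move=> [H1 H2] m; rewrite mem_cat; case: ifP => [mF _|_ /= mF]; [exact: H1|exact: H2].
    move=> H3; split => m mF; have := H3 m; rewrite mem_cat mF ?orbT => /(_ isT) //.
    by rewrite hm.
  rewrite /E !P_rect//.
  + rewrite big_cat/=; congr (_ * _)%E; apply: eq_big_seq => m mF; rewrite /B3 ?mF//.
    by rewrite hm.
  + by move=> m /h2 /andP[].
  + by move=> m /hF /andP[].
  + by move=> m; rewrite mem_cat => /orP[/hF /andP[]|/h2 /andP[]].
  + by move=> m; rewrite /B3; case: ifP.
Qed.

Local Notation outsideType J := (g_sigma_algebraType (outside J)).

Lemma measurable_outside (J : pred I) m : S m -> ~~ J m ->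
  measurable_fun (setT : set (outsideType J)) (X m : outsideType J -> R).
Proof.
move=> Sm Jm _ A mA; rewrite setTI; apply: sub_sigma_algebra.
exists [:: m], (fun=> A); split => //.
  by move=> k; rewrite inE => /eqP ->; rewrite Sm.
by apply/seteqP; split => w /=; [move=> H k; rewrite inE => /eqP ->|apply; rewrite inE].
Qed.

(** Only variables outside [J] have a nonzero coefficient, so the partial sums, and with them their
    limsup, are measurable for the smaller sigma-algebra. *)
Lemma limsup_ge0_outside (J : pred I) (s : nat -> seq I) (c : I -> R) :
  (forall m, c m != 0 -> S m && ~~ J m) ->
  <<s outside J >>
    [set w | (0 <= limn_esup (fun n => (\sum_(m <- s n) c m * X m w)%:E))%E].
Proof.
move=> hc.
have mT n : measurable_fun (setT : set (outsideType J))
    (fun w => (\sum_(m <- s n) c m * X m w)%:E).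
  apply/measurable_EFinP; apply: measurable_sum => m.
  have [->|cm] := eqVneq (c m) 0.
    by under eq_fun do rewrite mul0r; exact: measurable_cst.
  have /andP[Sm Jm] := hc _ cm.
  by apply: measurable_funM; [exact: measurable_cst|exact: measurable_outside].
have := measurable_fun_limn_esup mT; set f := fun x => limn_esup _ => mf.
have : measurable ([set: outsideType J] `&` [set x | (0%:E <= f x)%E]).
  exact: emeasurable_fun_c_infty.
by rewrite setTI.
Qed.

Let Ep m := X m @^-1` `[1, +oo[%classic.
Let En m := X m @^-1` `]-oo, -1]%classic.

(* By the symmetry of [X m], this event has probability [tail_prob] whatever the
   event [G m] independent of [X m]. *)
Definition opposite (G : I -> set Omega) m : set Omega :=
  (Ep m `&` ~` G m) `|` (En m `&` G m).

Definition tail_prob : R := fine (@normal_prob R 0 1 `[1%R, +oo[%classic).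

Lemma tail_prob_gt0 : 0 < tail_prob.
Proof.
rewrite /tail_prob fine_gt0// normal01_tail_gt0/=.
by rewrite -ge0_fin_numE ?fin_num_measure.
Qed.

Lemma P_Ep m : S m -> P (Ep m) = tail_prob%:E.
Proof.
move=> Sm; rewrite /Ep /tail_prob fineK; last exact: fin_num_measure.
by rewrite -(X_normal Sm)//.
Qed.

Lemma P_En m : S m -> P (En m) = tail_prob%:E.
Proof.
move=> Sm; rewrite /En /tail_prob fineK; last exact: fin_num_measure.
rewrite -normal01_probN// opp_preimage_itvbndy.
by rewrite -(X_normal Sm)//.
Qed.

Lemma measurable_Ep m : measurable (Ep m).
Proof. by rewrite /Ep -[_ @^-1` _]setTI; exact: measurable_funPT. Qed.

Lemma measurable_En m : measurable (En m).
Proof. by rewrite /En -[_ @^-1` _]setTI; exact: measurable_funPT. Qed.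

Section opposite_pair.
Variables (J : pred I) (G : I -> set Omega).
Hypothesis GJ : forall m, <<s outside J >> (G m).

Let mG m : measurable (G m) := outside_measurable (GJ m).

(** The Boolean selects one of the two disjoint halves of [opposite], so that one computation serves
    both. *)
Let sgn (b : bool) m := if b then Ep m else En m.
Let gen (b : bool) m := if b then ~` G m else G m.
Let sB (b : bool) : set R := if b then `[1, +oo[%classic else `]-oo, -1]%classic.

Let sgnE b m w : sgn b m w <-> sB b (X m w).
Proof. by case: b. Qed.

Let msB b : measurable (sB b).
Proof. by case: b; exact: measurable_itv. Qed.

Let P_sB b m : S m -> P (X m @^-1` sB b) = tail_prob%:E.
Proof. by case: b => Sm; [exact: P_Ep|exact: P_En]. Qed.

Let GJC m : <<s outside J >> (~` G m).
Proof.
have [_ + _] := @smallest_sigma_algebra Omega setT (outside J).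
by rewrite -setTD; apply.
Qed.

Let genJ b m : <<s outside J >> (gen b m).
Proof. by case: b; [exact: GJC|exact: GJ]. Qed.

Let mgen b m : measurable (gen b m).
Proof. exact: outside_measurable (genJ b m). Qed.

Let msgn b m : measurable (sgn b m).
Proof. by case: b; [exact: measurable_Ep|exact: measurable_En]. Qed.

Let genI b b' m n : <<s outside J >> (gen b m `&` gen b' n).
Proof. exact: (@measurableI _ (outsideType J) _ _ (genJ b m) (genJ b' n)). Qed.

Lemma measurable_opposite m : measurable (opposite G m).
Proof.
apply: measurableU; apply: measurableI => //; [exact: measurable_Ep| |exact: measurable_En].
exact: measurableC.
Qed.

(** Each half factors by independence with the same probability for the sign, and the probabilities
    of [G m] and its complement add up to 1. *)
Lemma P_opposite m : S m -> J m -> P (opposite G m) = tail_prob%:E.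
Proof.
move=> Sm Jm; rewrite /opposite measureU.
- have H b : P (sgn b m `&` gen b m) = (tail_prob%:E * P (gen b m))%E.
    have -> : sgn b m = rect [:: m] (fun=> sB b).
      apply/seteqP; split => w; rewrite sgnE /rect/=.
        by move=> h k; rewrite inE => /eqP ->.
      by move=> /(_ m (mem_head _ _)).
    rewrite (rect_indep_outside (J := J))//.
    + congr (_ * _)%E; rewrite P_rect//.
      * by rewrite big_seq1 P_sB.
      * by move=> k; rewrite inE => /eqP ->.
    + by move=> k; rewrite inE => /eqP ->; rewrite Sm.
  transitivity (tail_prob%:E * P (~` G m) + tail_prob%:E * P (G m))%E.
    by congr (_ + _)%E; [exact: (H true)|exact: (H false)].
  have -> : P (~` G m) = (1 - P (G m))%E by exact: probability_setC.
  have : P (G m) \is a fin_num by exact: fin_num_measure.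
  case: (P (G m)) => // r _; rewrite -EFinB -!EFinM -EFinD; congr EFin; ring.
- by apply: measurableI; [exact: measurable_Ep|exact: measurableC].
- by apply: measurableI; [exact: measurable_En|].
- by apply/seteqP; split => w //= -[[_ ?] [_ ?]].
Qed.

(** [G m] and [G n] may depend on each other, but the pair of signs is independent of both. The four
    cases carry the same factor, and the four intersections of [G m], [G n] and their complements
    partition the space. *)
Lemma P_opposite2 m n : S m -> S n -> J m -> J n -> m != n ->
  P (opposite G m `&` opposite G n) = (tail_prob ^+ 2)%:E.
Proof.
move=> Sm Sn Jm Jn mn.
have H b b' : P ((sgn b m `&` gen b m) `&` (sgn b' n `&` gen b' n)) =
    ((tail_prob ^+ 2)%:E * P (gen b m `&` gen b' n))%E.
  pose B k := if k == m then sB b else sB b'.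
  have nm : (n == m) = false by rewrite eq_sym (negbTE mn).
  rewrite setIACA.
  have -> : sgn b m `&` sgn b' n = rect [:: m; n] B.
    apply/seteqP; split => w; rewrite /setI/= !sgnE /rect /B/=.
      by move=> [h1 h2] k; rewrite !inE => /orP[] /eqP ->; rewrite ?eqxx ?nm.
    move=> h; have := h m; have := h n; rewrite !inE !eqxx orbT nm => /(_ isT) h2 /(_ isT) h1.
    by split.
  have mB k : measurable (B k) by rewrite /B; case: ifP.
  rewrite (rect_indep_outside (J := J))//; last 2 first.
  - by rewrite /= inE mn.
  - by move=> k; rewrite !inE => /orP[] /eqP ->; rewrite ?Sm ?Sn.
  congr (_ * _)%E; rewrite P_rect//; last 2 first.
  - by rewrite /= inE mn.
  - by move=> k; rewrite !inE => /orP[] /eqP ->.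
  rewrite !big_cons big_nil mule1 /B eqxx nm expr2 EFinM; by rewrite !P_sB.
have mI b b' : measurable ((sgn b m `&` gen b m) `&` (sgn b' n `&` gen b' n)).
  by apply: measurableI; apply: measurableI.
have -> : opposite G m `&` opposite G n =
  (((sgn true m `&` gen true m) `&` (sgn true n `&` gen true n)) `|`
   ((sgn true m `&` gen true m) `&` (sgn false n `&` gen false n))) `|`
  (((sgn false m `&` gen false m) `&` (sgn true n `&` gen true n)) `|`
   ((sgn false m `&` gen false m) `&` (sgn false n `&` gen false n))).
  by rewrite /opposite setIUl !setIUr.
rewrite measureU; last 3 first.
- by apply: measurableU.
- by apply: measurableU.
- by rewrite -!setIUr; apply/seteqP; split => w //= -[[[_ ?] _] [[_ ?] _]].
rewrite measureU//; last by apply/seteqP; split => w //= -[[_ [_ ?]] [_ [_ ?]]].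
rewrite measureU//; last by apply/seteqP; split => w //= -[[_ [_ ?]] [_ [_ ?]]].
pose f b b' := P (gen b m `&` gen b' n).
have f0 b b' : (0 <= f b b')%E by exact: measure_ge0.
transitivity ((tail_prob ^+ 2)%:E * f true true + (tail_prob ^+ 2)%:E * f true false +
  ((tail_prob ^+ 2)%:E * f false true + (tail_prob ^+ 2)%:E * f false false))%E.
  by congr ((_ + _) + (_ + _))%E; exact: H.
have part b : (f b true + f b false = P (gen b m))%E.
  rewrite /f -measureU; [|exact: measurableI|exact: measurableI|].
    by rewrite -setIUr /gen setvU setIT.
  by apply/seteqP; split => w //= -[[_ ?] [_ ?]].
rewrite -!ge0_muleDr ?adde_ge0// !part /gen.
have -> : P (~` G m) = (1 - P (G m))%E by exact: probability_setC.
by rewrite subeK ?mule1//; exact: fin_num_measure.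
Qed.

(** Chebyshev's inequality: the centred indicators are orthogonal and bounded by 1, so their sum has
    second moment at most [size s], and it is compared with half the mean. *)
Lemma opposite_count (s : seq I) : uniq s -> (0 < size s)%N ->
  (forall m, (m \in s) = J m) -> (forall m, m \in s -> S m) ->
  exists A : set Omega, [/\ measurable A,
    (P A <= (4 / (tail_prob ^+ 2 * (size s)%:R))%:E)%E &
    forall w, ~ A w -> tail_prob * (size s)%:R / 2 <= \sum_(m <- s) \1_(opposite G m) w :> R].
Proof.
move=> us s0 sJ sS; set p := tail_prob; have p0 : 0 < p := tail_prob_gt0.
have p1 : p <= 1.
  case: s s0 us sJ sS => // m s _ _ _ sS.
  have Sm := sS m (mem_head _ _).
  by rewrite -lee_fin /p -(P_Ep Sm); exact: probability_le1 (measurable_Ep m).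
pose W := opposite G; have mW := measurable_opposite.
(* The value 0 outside [s] makes orthogonality hold for all pairs of indices, as
   [integral_sqr_sum_orthogonal] asks. *)
pose Y m w : R := if m \in s then \1_(W m) w - p else 0.
have mY m : measurable_fun setT (Y m).
  rewrite /Y; have [ms|ms] := boolP (m \in s); last exact: measurable_cst.
  by apply: measurable_funB => //; exact: measurable_indic.
have Y1 m w : `|Y m w| <= 1.
  rewrite /Y; case: ifP => _; last by rewrite normr0.
  by rewrite indicE ler_norml; case: (_ \in _); rewrite /= ?mulr1n ?mulr0n; apply/andP; split; lra.
have bY (f : Omega -> R) : measurable_fun setT f -> (forall w, `|f w| <= 1) ->
    P.-integrable setT (fun w => (f w)%:E).
  move=> mf f1; apply: measurable_bounded_integrable => //.
    by rewrite -ge0_fin_numE//; exact: fin_num_measure.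
  by exists 1; split => // x x1 w _; apply: (le_trans (f1 w)); exact: ltW.
have ic (r : R) : (\int[P]_w (cst r%:E w) = r%:E)%E.
  rewrite (integral_cst P measurableT r%:E); transitivity (r%:E * 1)%E; last by rewrite mule1.
  by congr (_ * _)%E; exact: probability_setT.
have iYY m n : P.-integrable setT (fun w => (Y m w * Y n w)%:E).
  apply: bY; first exact: measurable_funM.
  by move=> w; rewrite normrM -[1]mulr1 ler_pM.
have i1 (A : set Omega) : measurable A -> P.-integrable setT (fun w => (\1_A w : R)%:E).
  move=> mA; apply: bY; first exact: measurable_indic.
  by move=> w; rewrite indicE; case: (_ \in _); rewrite ?normr1 ?normr0.
have oYY m n : m != n -> (\int[P]_w (Y m w * Y n w)%:E = 0)%E.
  move=> mn; rewrite /Y; have [ms|ms] := boolP (m \in s); last first.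
    by under eq_integral do rewrite mul0r; exact: integral0.
  have [ns|ns] := boolP (n \in s); last first.
    by under eq_integral do rewrite mulr0; exact: integral0.
  have e w : ((\1_(W m) w - p) * (\1_(W n) w - p))%:E =
      ((\1_(W m `&` W n) w : R)%:E + (p ^+ 2)%:E - (p%:E * (\1_(W m) w : R)%:E + p%:E * (\1_(W n) w : R)%:E))%E.
    transitivity (\1_(W m `&` W n) w + p ^+ 2 - (p * \1_(W m) w + p * \1_(W n) w))%:E => //.
    by congr EFin; rewrite indicI/=; ring.
  under eq_integral do rewrite e.
  have ip : P.-integrable setT (fun=> (p ^+ 2)%:E).
    by apply: bY => // w; rewrite ger0_norm ?sqr_ge0// expr_le1// ltW.
  have iz k : P.-integrable setT (fun w => (p%:E * (\1_(W k) w : R)%:E)%E).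
    by apply: integrableZl => //; exact: i1.
  have imn : P.-integrable setT (fun w => (\1_(W m `&` W n) w : R)%:E).
    by apply: i1; exact: measurableI.
  rewrite integralB//; [|exact: integrableD|exact: integrableD].
  rewrite integralD// integralD// !integralZl//; [|exact: i1|exact: i1].
  rewrite !integral_indic//; [|exact: measurableI].
  rewrite !setIT (ic (p ^+ 2)).
  have pW k : k \in s -> P (W k) = p%:E by move=> ks; apply: P_opposite; rewrite ?sS -?sJ.
  transitivity ((p ^+ 2)%:E + (p ^+ 2)%:E - (p%:E * p%:E + p%:E * p%:E))%E.
    congr (_ + _ - (_ * _ + _ * _))%E; [|exact: pW|exact: pW].
    by apply: P_opposite2 => //; rewrite ?sS -?sJ.
  transitivity ((p ^+ 2 + p ^+ 2 - (p * p + p * p))%:E) => //; congr EFin; ring.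
have vY m : (\int[P]_w ((Y m w) ^+ 2)%:E <= 1%:E)%E.
  apply: (@le_trans _ _ (\int[P]_w (cst 1%:E w))%E); last first.
    by rewrite ic.
  apply: ge0_le_integral => //.
  - by move=> w _; rewrite lee_fin sqr_ge0.
  - by apply/measurable_EFinP/measurable_funX.
  - by move=> w _; rewrite lee_fin -real_normK ?num_real// expr_le1.
have := integral_sqr_sum_orthogonal iYY oYY vY us.
set N := (size s)%:R in vY *.
rewrite big_const_seq count_predT iter_addr addr0 -/N => HN.
have N0 : 0 < N :> R by rewrite ltr0n.
pose A := [set w | (((p * N / 2) ^+ 2)%:E <= ((\sum_(m <- s) Y m w) ^+ 2)%:E)%E].
have mf : measurable_fun setT (fun w => ((\sum_(m <- s) Y m w) ^+ 2)%:E).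
  by apply/measurable_EFinP/measurable_funX/measurable_sum.
exists A; split.
- rewrite /A -[X in measurable X]setTI; apply: emeasurable_fun_c_infty => //.
- apply: le_trans (markov_ge0 mf _ _ HN) _.
  + by move=> w; rewrite lee_fin sqr_ge0.
  + by rewrite exprn_gt0// divr_gt0// mulr_gt0.
  + by rewrite lee_fin le_eqVlt; apply/orP; left; apply/eqP; field; rewrite !gt_eqF.
- move=> w; rewrite /A/= lee_fin => /negP; rewrite -ltNge => hw.
  have : \sum_(m <- s) Y m w = \sum_(m <- s) \1_(W m) w - p * N.
    rewrite big_seq (eq_bigr (fun m => \1_(W m) w - p)); last by move=> m; rewrite /Y => ->.
    rewrite -big_seq sumrB; congr (_ - _).
    by rewrite big_const_seq count_predT iter_addr addr0 mulr_natr.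
  move: hw => /[swap] ->; set c := \sum_(m <- s) _ => hw.
  have pN : 0 < p * N by rewrite mulr_gt0.
  rewrite leNgt; apply/negP => hc.
  by move: hw; rewrite ltNge => /negP; apply; nra.
Qed.

End opposite_pair.

End independence_outside.

(** * Sums over the lattice *)

Section seq_sums.
Variable R : realType.

Lemma sum_subset_le (I : eqType) (s t : seq I) (g : I -> R) :
  uniq s -> uniq t -> {subset s <= t} -> (forall i, 0 <= g i) ->
  \sum_(i <- s) g i <= \sum_(i <- t) g i.
Proof.
move=> us ut st g0; rewrite [leRHS](bigID (mem s))/=.
have pe : perm_eq [seq x <- t | x \in s] s.
  apply: uniq_perm => //; first exact: filter_uniq.
  by move=> x; rewrite mem_filter; case: (boolP (x \in s)) => //= /st.
by rewrite -[X in _ <= X + _]big_filter (perm_big _ pe)/= lerDl sumr_ge0.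
Qed.

(** The conditions bear only on the support of [f], because the reindexings used below, such as the
    quotient by the grid size, are injective only on a residue class. *)
Lemma sum_inj_le (I J : eqType) (s : seq I) (t : seq J) (h : I -> J) (f : I -> R) (g : J -> R) :
  uniq s -> uniq t -> (forall j, 0 <= g j) ->
  (forall i, i \in s -> f i != 0 -> h i \in t /\ f i <= g (h i)) ->
  (forall i j, i \in s -> j \in s -> f i != 0 -> f j != 0 -> h i = h j -> i = j) ->
  \sum_(i <- s) f i <= \sum_(j <- t) g j.
Proof.
move=> us ut g0 H inj.
rewrite (bigID (fun i => f i != 0))/= addrC big1 ?add0r; last by move=> i /negPn/eqP.
rewrite -big_filter; set s' := seq.filter _ s.
have s's i : i \in s' -> i \in s /\ f i != 0 by rewrite mem_filter => /andP[].
apply: (@le_trans _ _ (\sum_(i <- s') g (h i))).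
  by rewrite big_seq [leRHS]big_seq; apply: ler_sum => i /s's[si fi]; have [] := H i si fi.
rewrite -(big_map h xpredT g); apply: sum_subset_le => //.
  rewrite map_inj_in_uniq ?filter_uniq// => i j /s's[si fi] /s's[sj fj]; exact: inj.
by move=> j /mapP[i /s's[si fi] ->]; have [] := H i si fi.
Qed.

Lemma sum_powR_le (b : R) (n : nat) : 0 < b ->
  \sum_(j < n) (j.+1%:R : R) `^ (- (1 + b)) <= 1 + b^-1.
Proof.
move=> b0; case: n => [|n]; first by rewrite big_ord0 addr_ge0// invr_ge0 ltW.
(* Stronger form suited to induction: the fraction is the integral of x^(-1-b) from 1 to n + 1. *)
suff H : \sum_(j < n.+1) (j.+1%:R : R) `^ (- (1 + b)) <= 1 + (1 - n.+1%:R `^ (- b)) / b.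
  apply: le_trans H _; rewrite lerD2l -[leRHS]mul1r ler_wpM2r ?invr_ge0 ?(ltW b0)//.
elim: n => [|n IH].
  by rewrite big_ord_recr big_ord0/= add0r !powR1 subrr mul0r addr0.
rewrite big_ord_recr/=; apply: le_trans (lerD IH (lexx _)) _.
rewrite -addrA lerD2l -ler_pdivrMr ?invr_gt0// invrK mulrDl divfK ?gt_eqF//.
rewrite -addrA lerD2l.
set x : R := n.+2%:R; set y : R := n.+1%:R.
have x0 : 0 < x by rewrite ltr0n.
have y0 : 0 < y by rewrite ltr0n.
have xy : x = y + 1 by rewrite /x /y -[n.+2]addn1 natrD.
have -> : x `^ (- (1 + b)) = x `^ (- b) / x.
  have -> : - (1 + b) = - b + -1 by ring.
  by rewrite powRD ?powR_inv1 ?(ltW x0)// (gt_eqF x0) implybT.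
have e : y `^ (- b) = x `^ (- b) * expR (- b * ln (y / x)).
  rewrite /powR !gt_eqF// -expRD ln_div ?posrE//; congr expR; ring.
have l1 : ln (y / x) <= - x^-1.
  have /le_ln1Dx : -1 < y / x - 1 by rewrite ltrBDl subrr divr_gt0.
  rewrite addrCA subrr addr0 => /le_trans; apply.
  rewrite le_eqVlt; apply/orP; left; apply/eqP.
  have -> : y = x - 1 by rewrite xy addrK.
  by field; rewrite gt_eqF.
have l2 : 1 + b / x <= expR (- b * ln (y / x)).
  apply: le_trans (expR_ge1Dx _); rewrite lerD2l mulNr -mulrN ler_wpM2l ?(ltW b0)//.
  by rewrite lerNr.
have : x `^ (- b) * (1 + b / x) <= y `^ (- b) by rewrite e ler_wpM2l// powR_ge0.
rewrite mulrDr mulr1; set A := x `^ _; set B := y `^ _ => h.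
have -> : A / x * b = A * (b / x) by ring.
by set W := A * (b / x) in h *; lra.
Qed.

End seq_sums.

Section lattice_boxes.
Variable d : nat.
Implicit Types m : lattice d.

Definition supn m : nat := \max_(i < d) `|m i|%N.

Lemma supn_leP m n : reflect (forall i, (`|m i| <= n)%N) (supn m <= n)%N.
Proof.
apply: (iffP idP) => [h i|h]; first exact: leq_trans (leq_bigmax i) h.
by apply/bigmax_leqP => i _; exact: h.
Qed.

Lemma leq_supn m i : (`|m i| <= supn m)%N.
Proof. exact: (elimT (supn_leP m _)). Qed.

Lemma supn_eq0 m : (supn m == 0)%N = (m == 0).
Proof.
apply/eqP/eqP => [h|->].
  apply/ffunP => i; rewrite ffunE; apply/eqP; rewrite -absz_eq0 -leqn0 -h; exact: leq_supn.
by apply/eqP; rewrite -leqn0; apply/supn_leP => i; rewrite ffunE.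
Qed.

Lemma supn_gt0 m : (0 < supn m)%N = (m != 0).
Proof. by rewrite lt0n supn_eq0. Qed.

Lemma supnN m : supn (- m) = supn m.
Proof. by apply: eq_bigr => i _; rewrite ffunE abszN. Qed.

Definition boxseq (N : nat) : seq (lattice d) :=
  [seq [ffun i => (k i)%:Z - N%:Z] | k : {ffun 'I_d -> 'I_(N.*2.+1)}].

Lemma boxsumE (R : realType) N (F : lattice d -> R) :
  boxsum N F = \sum_(m <- boxseq N) F m.
Proof. by rewrite /boxsum /boxseq big_map big_enum. Qed.

Lemma uniq_boxseq N : uniq (boxseq N).
Proof.
rewrite map_inj_uniq ?enum_uniq// => k l /ffunP h; apply/ffunP => i.
by have := h i; rewrite !ffunE => /addIr [] /val_inj.
Qed.

Lemma mem_boxseq N m : (m \in boxseq N) = (supn m <= N)%N.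
Proof.
apply/mapP/supn_leP => [[k _ ->] i|h].
  rewrite ffunE; have := ltn_ord (k i); rewrite -[X in (_ < X.+1)%N]addnn; move: (nat_of_ord (k i)) => n. lia.
have hb i : (absz (m i + N%:Z)%R < N.*2.+1)%N by have := h i; rewrite -addnn; lia.
exists [ffun i => Ordinal (hb i)]; first by rewrite mem_enum.
by apply/ffunP => i; rewrite !ffunE/=; have := h i; lia.
Qed.

Lemma boxseq_sub N M : (N <= M)%N -> {subset boxseq N <= boxseq M}.
Proof. by move=> NM m; rewrite !mem_boxseq => /leq_trans; apply. Qed.

End lattice_boxes.

Section lattice_sums.
Variables (R : realType) (d : nat).
Hypothesis d0 : (0 < d)%N.
Implicit Types (m : lattice d) (F G : lattice d -> R).

Definition supR m : R := (supn m)%:R.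

Lemma supR_ge1 m : m != 0 -> 1 <= supR m.
Proof. by rewrite /supR ler1n supn_gt0. Qed.

Definition pnorm (p : R) m : R := if m == 0 then 0 else supR m `^ (- p).

Lemma pnorm_ge0 p m : 0 <= pnorm p m.
Proof. by rewrite /pnorm; case: ifP => // _; exact: powR_ge0. Qed.

(** Each |m_i| + 1 is at most twice the size of m, so [pnorm p m] is at most 2^p times the product
    of the (|m_i| + 1)^(-p/d). The box sum of the product factors into d one-dimensional sums of
    exponent p / d = 1 + b > 1, each bounded by [c], one half of which is for either sign. *)
Lemma pnorm_sum_bounded (p : R) : d%:R < p ->
  exists Z, 0 < Z /\ forall N, boxsum N (pnorm p) <= Z.
Proof.
move=> dp; have dR : 0 < d%:R :> R by rewrite ltr0n.
have p0 : 0 < p by apply: lt_trans dp.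
pose b := p / d%:R - 1.
have b0 : 0 < b by rewrite subr_gt0 ltr_pdivlMr// mul1r.
pose g (n : nat) : R := n.+1%:R `^ (- (1 + b)).
pose c : R := 2 * (1 + b^-1).
have c0 : 0 < c by rewrite mulr_gt0// addr_gt0// invr_gt0.
have g0 n : 0 <= g n by exact: powR_ge0.
have sg N : \sum_(k < N.*2.+1) g `|(k%:Z - N%:Z)|%N <= c.
  rewrite -(big_mkord xpredT (fun k => g `|(k%:Z - N%:Z)|%N)).
  rewrite (@big_cat_nat _ _ _ N)//=; last by rewrite -addnn -addnS leq_addr.
  rewrite /c mulr2n mulrDl mul1r; apply: lerD.
    rewrite big_nat_rev/= add0n big_nat.
    rewrite (eq_bigr (fun k => g k.+1)); last first.
      by move=> k /= kN; congr g; lia.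
    rewrite -big_nat big_mkord.
    apply: le_trans (sum_powR_le N.+1 b0).
    by rewrite big_ord_recl/= lerDr; exact: g0.
  rewrite -{1}[N]add0n big_addn.
  have -> : (N.*2.+1 - N = N.+1)%N by lia.
  rewrite big_nat (eq_bigr g); last by move=> k /= kN; congr g; lia.
  by rewrite -big_nat big_mkord; exact: sum_powR_le.
exists (2 `^ p * c ^+ d); split; first by rewrite mulr_gt0 ?powR_gt0 ?exprn_gt0.
move=> N.
apply: (@le_trans _ _ (boxsum N (fun m => 2 `^ p * \prod_(i < d) g `|m i|%N))).
  rewrite !boxsumE; apply: ler_sum => m _; rewrite /pnorm; case: ifP => [_|/negbT m0].
    by rewrite mulr_ge0 ?powR_ge0// prodr_ge0.
  have s1 := supR_ge1 m0; have s0 : 0 < supR m by apply: lt_le_trans s1.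
  apply: (@le_trans _ _ (2 `^ p * \prod_(i < d) (2 * supR m) `^ (- (1 + b)))).
    rewrite prodr_const card_ord -powR_mulrn ?powR_ge0// -powRrM.
    have -> : - (1 + b) * d%:R = - p by rewrite /b; field; rewrite gt_eqF.
    rewrite powRM ?(ltW s0)// mulrA -powRD ?subrr ?powRr0 ?mul1r//.
    by rewrite pnatr_eq0 implybT.
  rewrite ler_wpM2l ?powR_ge0//; apply: ler_prod => i _; rewrite powR_ge0/= /g.
  rewrite !powRN lef_pV2 ?posrE ?powR_gt0 ?mulr_gt0//.
  apply: ge0_ler_powR; rewrite ?nnegrE//.
  - by rewrite addr_ge0// ltW.
  - by rewrite mulr_ge0// ltW.
  rewrite -natrM ler_nat mul2n -addnn -addn1 leq_add ?leq_supn// supn_gt0//.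
rewrite boxsumE -mulr_sumr ler_wpM2l ?powR_ge0// -boxsumE /boxsum.
under eq_bigr do under eq_bigr do rewrite ffunE.
rewrite -(bigA_distr_bigA (fun _ (k : 'I_(N.*2.+1)) => g `|(k%:Z - N%:Z)|%N))/=.
rewrite -[X in c ^+ X]card_ord -prodr_const; apply: ler_prod => i _.
by rewrite sg sumr_ge0.
Qed.

Lemma boxsum_le F G N : (forall m, F m <= G m) -> boxsum N F <= boxsum N G.
Proof. by move=> FG; rewrite !boxsumE; apply: ler_sum => m _. Qed.

Lemma boxsum_nondecreasing F : (forall m, 0 <= F m) ->
  nondecreasing_seq (fun N => boxsum N F).
Proof.
move=> F0 N M NM; rewrite !boxsumE; apply: sum_subset_le; rewrite ?uniq_boxseq//.
exact: boxseq_sub.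
Qed.

Lemma cvg_boxsum_ge0 F C : (forall m, 0 <= F m) -> (forall N, boxsum N F <= C) ->
  cvgn (fun N => boxsum N F).
Proof.
move=> F0 FC; apply: nondecreasing_is_cvgn; first exact: boxsum_nondecreasing.
by exists C => _ [N _ <-].
Qed.

Lemma boxsumD F G N : boxsum N (fun m => F m + G m) = boxsum N F + boxsum N G.
Proof. by rewrite /boxsum big_split. Qed.

Lemma boxsumZ F (c : R) N : boxsum N (fun m => c * F m) = c * boxsum N F.
Proof. by rewrite /boxsum mulr_sumr. Qed.

Lemma boxsum_le_latsum F N : (forall m, 0 <= F m) -> cvgn (fun N => boxsum N F) ->
  boxsum N F <= latsum F.
Proof. by move=> F0 cF; apply: nondecreasing_cvgn_le => //; exact: boxsum_nondecreasing. Qed.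

Lemma term_le_latsum F m : (forall m, 0 <= F m) -> cvgn (fun N => boxsum N F) -> F m <= latsum F.
Proof.
move=> F0 cF; apply: le_trans (boxsum_le_latsum (supn m) F0 cF).
rewrite boxsumE; suff : \sum_(k <- [:: m]) F k <= \sum_(k <- boxseq d (supn m)) F k.
  by rewrite big_seq1.
apply: sum_subset_le => //; first exact: uniq_boxseq.
by move=> k; rewrite inE => /eqP ->; rewrite mem_boxseq.
Qed.

Lemma latsum_le_bound F C : cvgn (fun N => boxsum N F) ->
  (forall N, boxsum N F <= C) -> latsum F <= C.
Proof. by move=> cF FC; apply: limr_le => //; exact: nearW. Qed.

End lattice_sums.

(** * Residue classes of frequencies *)

Lemma powRDp (R : realType) (x r s : R) : 0 < x -> x `^ (r + s) = x `^ r * x `^ s.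
Proof. by move=> x0; rewrite powRD// (gt_eqF x0) implybT. Qed.

Lemma ler_powRN (R : realType) (x y r : R) : 0 <= r -> 0 < x -> x <= y ->
  y `^ (- r) <= x `^ (- r).
Proof.
move=> r0 x0 xy; have y0 : 0 < y by exact: lt_le_trans xy.
rewrite !powRN lef_pV2 ?posrE ?powR_gt0//.
by apply: ge0_ler_powR => //; rewrite nnegrE ltW.
Qed.

Section residue_classes.
Variables (d : nat).
Implicit Types (m : lattice d) (q : nat).

Lemma cls_subproof q (z : int) : (`|(z %% (2 ^ q)%:Z)%Z| < 2 ^ q)%N.
Proof.
have q0 : (0 < 2 ^ q)%N by rewrite expn_gt0.
have := @modz_ge0 z (2 ^ q)%:Z; have := @ltz_pmod z (2 ^ q)%:Z.
by move: (z %% _)%Z => y; lia.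
Qed.

(* On the grid of level [q], the character of frequency [m] only depends on [cls q m]. *)
Definition cls q m : Jq d q := [ffun i => Ordinal (cls_subproof q (m i))].

Definition rep q (r : Jq d q) : lattice d := [ffun i => (r i : nat)%:Z].

Lemma clsP q m m' :
  reflect (forall i, ((2 ^ q)%:Z %| m i - m' i)%Z) (cls q m == cls q m').
Proof.
have q0 : (0 < 2 ^ q)%N by rewrite expn_gt0.
apply: (iffP eqP) => [/ffunP h i|h].
  have := h i; rewrite !ffunE => -[]/= e; rewrite -eqz_mod_dvd; apply/eqP.
  have := @modz_ge0 (m i) (2 ^ q)%:Z; have := @modz_ge0 (m' i) (2 ^ q)%:Z.
  by move: e; move: (m i %% _)%Z (m' i %% _)%Z => y y'; lia.
apply/ffunP => i; rewrite !ffunE; apply: val_inj => /=.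
by have := h i; rewrite -eqz_mod_dvd => /eqP ->.
Qed.

Lemma cls_rep q (r : Jq d q) : cls q (rep r) = r.
Proof.
apply/ffunP => i; rewrite !ffunE; apply: val_inj => /=.
by rewrite modz_small ?absz_nat// lez_nat ltz_nat/= ltn_ord.
Qed.

(** The member of the class with coordinates in (- 2^q / 2, 2^q / 2], hence of smallest size. *)
Definition cent q (r : Jq d q) : lattice d :=
  [ffun i => if ((r i).*2 <= 2 ^ q)%N then (r i : nat)%:Z else (r i : nat)%:Z - (2 ^ q)%:Z].

Lemma cls_cent q (r : Jq d q) : cls q (cent r) = r.
Proof.
rewrite -[RHS]cls_rep; apply/eqP/clsP => i; rewrite !ffunE; case: ifP => _.
  by rewrite subrr dvdz0.
by rewrite addrAC subrr sub0r; apply/dvdzP; exists (-1); rewrite mulN1r.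
Qed.

Lemma cent_inj q : injective (@cent q).
Proof. by move=> r s h; rewrite -[r]cls_cent -[s]cls_cent h. Qed.

Lemma supn_cent q (r : Jq d q) : ((supn (cent r)).*2 <= 2 ^ q)%N.
Proof.
suff : (supn (cent r) <= (2 ^ q)./2)%N by rewrite leq_half_double || (move=> h; lia).
apply/supn_leP => i; rewrite ffunE; have := ltn_ord (r i).
by case: ifP; lia.
Qed.

(** The coarse class that contains the fine class [r]. *)
Definition bar q (r : Jq d q.+1) : Jq d q := cls q (rep r).

Lemma bar_cls q m : bar (cls q.+1 m) = cls q m.
Proof.
apply/eqP/clsP => i.
have : cls q.+1 (rep (cls q.+1 m)) == cls q.+1 m by rewrite cls_rep.
move/clsP => /(_ i); apply: dvdz_trans.
by rewrite expnS PoszM dvdz_mull.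
Qed.

End residue_classes.

Section latsum_classes.
Variables (R : realType) (d : nat).
Implicit Types (m : lattice d) (F : lattice d -> R).

Definition restr (D : pred (lattice d)) F m : R := if D m then F m else 0.

Definition clsum q F (r : Jq d q) : R := latsum (restr (fun m => cls q m == r) F).

Lemma boxsum_classes q F (h : Jq d q -> R) N :
  boxsum N (fun m => F m * h (cls q m)) =
  \sum_r h r * boxsum N (restr (fun m => cls q m == r) F).
Proof.
rewrite /boxsum; under [RHS]eq_bigr do rewrite mulr_sumr.
rewrite exchange_big/=; apply: eq_bigr => k _.
set m := [ffun i => _]; rewrite (bigD1 (cls q m))//= big1 ?addr0.
  by rewrite /restr eqxx mulrC.
by move=> r rm; rewrite /restr eq_sym (negbTE rm) mulr0.
Qed.

(** A finite combination of limits. Convergence is asked class by class, along boxes, because the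
    random series need not converge absolutely. *)
Lemma cvg_latsum_classes q F (h : Jq d q -> R) :
  (forall r, cvgn (fun N => boxsum N (restr (fun m => cls q m == r) F))) ->
  (fun N => boxsum N (fun m => F m * h (cls q m))) @ \oo --> \sum_r h r * clsum F r.
Proof.
move=> cF.
have -> : (fun N => boxsum N (fun m => F m * h (cls q m))) =
    (fun N => \sum_r h r * boxsum N (restr (fun m => cls q m == r) F)).
  by apply/funext => N; exact: boxsum_classes.
apply: cvg_big => [|r _]; first exact: add_continuous.
by apply: cvgM; [exact: cvg_cst|exact: cF].
Qed.

Lemma latsum_classes q F (h : Jq d q -> R) :
  (forall r, cvgn (fun N => boxsum N (restr (fun m => cls q m == r) F))) ->
  latsum (fun m => F m * h (cls q m)) = \sum_r h r * clsum F r.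
Proof. by move=> cF; apply/cvg_lim => //; exact: cvg_latsum_classes. Qed.

End latsum_classes.

(** * Two-sided bounds on the class sums, uniform in the regularity *)

Section class_bounds.
Variables (R : realType) (d : nat).
Hypothesis d0 : (0 < d)%N.
Implicit Types (m : lattice d) (F : lattice d -> R) (t p : R).

Definition wt t m : R := if m == 0 then 0 else lam R m `^ (- t).

Definition lamC : R := 4 * pi ^+ 2 * d%:R.

Lemma four_pi2_ge1 : 1 <= 4 * pi ^+ 2 :> R.
Proof. by have := @pi_ge2 R; nra. Qed.

Lemma four_pi2_ge0 : 0 <= 4 * pi ^+ 2 :> R.
Proof. exact: le_trans ler01 four_pi2_ge1. Qed.

Lemma lamC_ge1 : 1 <= lamC.
Proof.
have d1 : 1 <= d%:R :> R by rewrite ler1n.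
by have := four_pi2_ge1; rewrite /lamC; nra.
Qed.

Lemma supR_sqr_le_lam m : supR R m ^+ 2 <= lam R m.
Proof.
have [->|m0] := eqVneq m 0.
  rewrite /supR; have -> : supn (0 : lattice d) = 0%N by apply/eqP; rewrite supn_eq0.
  rewrite expr0n mulr_ge0 ?four_pi2_ge0 ?sumr_ge0// => i _; exact: sqr_ge0.
have [i _ hi] : {i : 'I_d | i \in 'I_d & supn m = `|m i|%N}.
  by apply: eq_bigmax_cond; rewrite card_ord.
have e : supR R m ^+ 2 = ((m i)%:~R : R) ^+ 2.
  rewrite /supR hi -[in RHS]real_normK ?num_real//; congr (_ ^+ 2).
  by rewrite -intr_norm -abszE.
rewrite /lam; apply: (@le_trans _ _ (1 * \sum_(j < d) (m j)%:~R ^+ 2)).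
  rewrite mul1r (bigD1 i)//= e lerDl sumr_ge0// => j _; exact: sqr_ge0.
rewrite ler_wpM2r ?four_pi2_ge1// sumr_ge0// => j _; exact: sqr_ge0.
Qed.

Lemma lam_le_supR_sqr m : lam R m <= lamC * supR R m ^+ 2.
Proof.
rewrite /lam /lamC -[leRHS]mulrA ler_wpM2l ?four_pi2_ge0//.
have -> : d%:R * supR R m ^+ 2 = \sum_(i < d) supR R m ^+ 2.
  by rewrite sumr_const card_ord mulr_natl.
apply: ler_sum => i _.
rewrite -[leLHS]real_normK ?num_real// lerXn2r ?nnegrE// -intr_norm -abszE /supR.
by rewrite -[leLHS]/((`|m i|%N)%:R) ler_nat leq_supn.
Qed.

Lemma lam_gt0 m : m != 0 -> 0 < lam R m.
Proof.
move=> m0; apply: lt_le_trans (supR_sqr_le_lam m).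
by rewrite exprn_gt0//; apply: lt_le_trans (supR_ge1 R m0).
Qed.

Lemma wt_ge0 t m : 0 <= wt t m.
Proof. by rewrite /wt; case: ifP => // _; exact: powR_ge0. Qed.

Lemma powR_sqr (x t : R) : 0 <= x -> (x ^+ 2) `^ t = x `^ (2 * t).
Proof. by move=> x0; rewrite powRrM powR_mulrn. Qed.

Lemma wt_le_pnorm t m : 0 <= t -> wt t m <= pnorm (2 * t) m.
Proof.
move=> t0; rewrite /wt /pnorm; case: eqVneq => // m0.
have s0 : 0 < supR R m by apply: lt_le_trans (supR_ge1 R m0).
apply: (@le_trans _ _ ((supR R m ^+ 2) `^ (- t))).
  by apply: ler_powRN; rewrite ?exprn_gt0 ?supR_sqr_le_lam.
by rewrite powR_sqr ?(ltW s0)// mulrN.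
Qed.

Lemma pnorm_le_wt t m : 0 <= t -> lamC `^ (- t) * pnorm (2 * t) m <= wt t m.
Proof.
move=> t0; rewrite /wt /pnorm; case: eqVneq => [_|m0]; first by rewrite mulr0.
have s0 : 0 < supR R m by apply: lt_le_trans (supR_ge1 R m0).
have l0 : 0 < lamC by apply: lt_le_trans lamC_ge1.
have -> : lamC `^ (- t) * supR R m `^ (- (2 * t)) = (lamC * supR R m ^+ 2) `^ (- t).
  by rewrite powRM ?(ltW l0) ?sqr_ge0// powR_sqr ?(ltW s0)// mulrN.
by apply: ler_powRN; rewrite ?lam_gt0 ?lam_le_supR_sqr.
Qed.

Lemma pnorm_le_antitone p p' m : p <= p' -> pnorm p' m <= pnorm p m :> R.
Proof.
move=> pp'; rewrite /pnorm; case: eqVneq => // m0.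
by apply: ler_powR; [exact: supR_ge1|rewrite lerN2].
Qed.

Definition Nq q : R := (2 ^ q)%:R.

Lemma Nq_ge1 q : 1 <= Nq q.
Proof. by rewrite /Nq ler1n expn_gt0. Qed.

Lemma Nq_gt0 q : 0 < Nq q.
Proof. by apply: lt_le_trans (Nq_ge1 q). Qed.

Lemma NqS q : Nq q.+1 = 2 * Nq q.
Proof. by rewrite /Nq expnS natrM. Qed.

(* The members of a residue class mod [2 ^ q] other than a representative [m0]
   of size at most [2 ^ q / 2] have size at least [(2 ^ q / 2) k], [k] being the
   size of the (nonzero) quotient. *)
Lemma tail_sum_le p Z q m0 N : 0 <= p -> (forall N, boxsum N (pnorm p : lattice d -> R) <= Z) ->
  ((supn m0).*2 <= 2 ^ q)%N ->
  boxsum N (restr (fun m => (cls q m == cls q m0) && (m != m0)) (pnorm p))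
  <= (Nq q / 2) `^ (- p) * Z.
Proof.
move=> p0 HZ hm0; have q0 : (0 < 2 ^ q)%N by rewrite expn_gt0.
pose h m : lattice d := [ffun i => ((m i - m0 i) %/ (2 ^ q)%:Z)%Z].
have hN m : cls q m == cls q m0 -> forall i, m i = m0 i + h m i * (2 ^ q)%:Z.
  by move=> /clsP c i; rewrite ffunE divzK// addrC subrK.
have h_neq0 m : cls q m == cls q m0 -> m != m0 -> h m != 0.
  move=> c; apply: contra => /eqP h0; apply/eqP/ffunP => i.
  by rewrite hN// h0 ffunE mul0r addr0.
have hsup m : cls q m == cls q m0 -> m != m0 -> (2 ^ q * supn (h m) <= (supn m).*2)%N.
  move=> c n.
  have h1 : (0 < supn (h m))%N by rewrite supn_gt0 h_neq0.
  have [i _ hi] : {i : 'I_d | i \in 'I_d & supn (h m) = `|h m i|%N}.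
    by apply: eq_bigmax_cond; rewrite card_ord.
  have e := hN _ c i; have l1 := leq_supn m i; have l2 := leq_supn m0 i.
  have l3 : (2 ^ q * supn (h m) <= supn m + supn m0)%N.
    have -> : (2 ^ q * supn (h m) = `|(h m i * (2 ^ q)%:Z)%R|)%N.
      by rewrite abszM absz_nat hi mulnC.
    have -> : h m i * (2 ^ q)%:Z = m i - m0 i by rewrite e addrC addKr.
    by lia.
  by move: l3 hm0 h1; set A := (2 ^ q)%N; nia.
have Nq2 : 0 < Nq q / 2 by rewrite divr_gt0 ?Nq_gt0.
pose g (k : lattice d) : R := (Nq q / 2) `^ (- p) * pnorm p k.
apply: (@le_trans _ _ (\sum_(k <- boxseq d N.*2) g k)); last first.
  by rewrite -mulr_sumr ler_wpM2l ?powR_ge0// -boxsumE.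
rewrite boxsumE; apply: (@sum_inj_le _ _ _ _ _ h); rewrite ?uniq_boxseq//.
- by move=> k; rewrite mulr_ge0 ?powR_ge0 ?pnorm_ge0.
- move=> m mN; rewrite /restr; case: ifP => [/andP[c n] fm|]; last by rewrite eqxx.
  have hs := hsup _ c n; split.
    rewrite mem_boxseq; move: mN; rewrite mem_boxseq => mN.
    by move: hs q0; set A := (2 ^ q)%N; nia.
  have m_neq0 : m != 0 by apply: contra fm => /eqP ->; rewrite /pnorm eqxx.
  rewrite /g /pnorm (negbTE m_neq0) (negbTE (h_neq0 _ c n)).
  have sh : 0 < supR R (h m) by apply: lt_le_trans (supR_ge1 R (h_neq0 _ c n)).
  rewrite -powRM ?(ltW Nq2) ?(ltW sh)//; apply: ler_powRN => //; first by rewrite mulr_gt0.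
  rewrite mulrAC ler_pdivrMr// /supR /Nq -natrM -[2]/(2%:R) -natrM ler_nat.
  by rewrite muln2.
- move=> m m' _ _; rewrite /restr; case: ifP => [/andP[c _] _|]; last by rewrite eqxx.
  case: ifP => [/andP[c' _] _|]; last by rewrite eqxx.
  by move=> hh; apply/ffunP => i; rewrite (hN _ c) (hN _ c') hh.
Qed.

Lemma boxsum_restr_le (D : pred (lattice d)) F C : (forall m, 0 <= F m) ->
  (forall N, boxsum N F <= C) -> forall N, boxsum N (restr D F) <= C.
Proof.
move=> F0 HF N; apply: le_trans (HF N); apply: boxsum_le => m.
by rewrite /restr; case: ifP.
Qed.

Lemma restr_ge0 (D : pred (lattice d)) F : (forall m, 0 <= F m) -> forall m, 0 <= restr D F m.
Proof. by move=> F0 m; rewrite /restr; case: ifP. Qed.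

Definition i0 : 'I_d := Ordinal d0.

Definition unitv (k : int) : lattice d := [ffun i => if i == i0 then k else 0].

Lemma supn_unitv k : supn (unitv k) = `|k|%N.
Proof.
apply/eqP; rewrite eqn_leq; apply/andP; split.
  by apply/supn_leP => i; rewrite ffunE; case: ifP.
by have := leq_supn (unitv k) i0; rewrite ffunE eqxx.
Qed.

(* The least [supn m] over the nonzero frequencies [m] of the class [r]. *)
Definition Hq q (r : Jq d q) : R := if cent r == 0 then Nq q else supR R (cent r).

Lemma Hq_ge1 q (r : Jq d q) : 1 <= Hq r.
Proof. by rewrite /Hq; case: eqVneq => [_|/supR_ge1//]; exact: Nq_ge1. Qed.

Lemma Hq_gt0 q (r : Jq d q) : 0 < Hq r.
Proof. by apply: lt_le_trans (Hq_ge1 r). Qed.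

Lemma Hq_le q (r : Jq d q) : Hq r <= Nq q.
Proof.
rewrite /Hq; case: eqVneq => // _; rewrite /supR /Nq ler_nat.
by have := supn_cent r; lia.
Qed.

(* The eigenvalues of the Gram matrix, up to the factor [2 ^ (q d)]. *)
Definition At q t (r : Jq d q) : R := clsum (wt t) r.

Section uniform.
Variables (a T Z : R).
Hypotheses (a0 : 0 <= a) (HZ : forall N, boxsum N (pnorm (2 * a) : lattice d -> R) <= Z).

Lemma wt_sum_le t : a <= t -> forall N, boxsum N (wt t) <= Z.
Proof.
move=> at_ N; apply: le_trans (HZ N); apply: boxsum_le => m.
apply: le_trans (wt_le_pnorm _ _) _; first exact: le_trans at_.
by apply: pnorm_le_antitone; rewrite ler_wpM2l.
Qed.

Lemma Z_ge0 : 0 <= Z.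
Proof. by apply: le_trans (HZ 0); rewrite boxsumE sumr_ge0// => m _; exact: pnorm_ge0. Qed.

Lemma cvg_wt_restr t (D : pred (lattice d)) : a <= t ->
  cvgn (fun N => boxsum N (restr D (wt t))).
Proof.
move=> at_; apply: (@cvg_boxsum_ge0 _ _ _ Z).
  by apply: restr_ge0 => m; exact: wt_ge0.
by apply: boxsum_restr_le; [move=> m; exact: wt_ge0|exact: wt_sum_le].
Qed.

Lemma wt_tail_le t q m0 N : a <= t -> t <= T -> ((supn m0).*2 <= 2 ^ q)%N ->
  boxsum N (restr (fun m => (cls q m == cls q m0) && (m != m0)) (wt t))
  <= 4 `^ T * Z * Nq q `^ (- (2 * t)).
Proof.
move=> at_ tT hm0; have t0 : 0 <= t by exact: le_trans at_.
apply: (@le_trans _ _ (boxsum N (restr (fun m => (cls q m == cls q m0) && (m != m0)) (pnorm (2 * t))))).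
  by apply: boxsum_le => m; rewrite /restr; case: ifP => // _; exact: wt_le_pnorm.
apply: le_trans (@tail_sum_le (2 * t) Z q m0 N _ _ hm0) _.
- by rewrite mulr_ge0.
- move=> M; apply: le_trans (HZ M); apply: boxsum_le => m.
  by apply: pnorm_le_antitone; rewrite ler_wpM2l.
rewrite powRM ?(ltW (Nq_gt0 q)) ?invr_ge0//.
set y := 2^-1 `^ _; set n := Nq q `^ _.
have -> : 4 `^ T * Z * n = n * (4 `^ T) * Z by ring.
rewrite ler_wpM2r ?Z_ge0// ler_wpM2l ?powR_ge0// /y.
have -> : (2^-1 : R) `^ (- (2 * t)) = 4 `^ t.
  rewrite -powR_inv1// -powRrM mulN1r opprK powRrM powR_mulrn//; congr (_ `^ _).
  by ring.
by apply: ler_powR => //; lra.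
Qed.

(** The 1 accounts for the smallest member of a class and the other term for all the rest; 4^T
    bounds the factor (1/2)^(-2t) of [tail_sum_le]. *)
Definition Cup : R := 1 + 4 `^ T * Z.
Definition clo : R := lamC `^ (- T).

Lemma Cup_ge1 : 1 <= Cup.
Proof. by rewrite lerDl mulr_ge0 ?powR_ge0 ?Z_ge0. Qed.

Lemma clo_gt0 : 0 < clo.
Proof. by rewrite powR_gt0//; apply: lt_le_trans lamC_ge1. Qed.

Lemma latsum_wt_tail_le t q m0 : a <= t -> t <= T -> ((supn m0).*2 <= 2 ^ q)%N ->
  latsum (restr (fun m => (cls q m == cls q m0) && (m != m0)) (wt t))
  <= Cup * Nq q `^ (- (2 * t)).
Proof.
move=> at_ tT hm0; apply: latsum_le_bound; first exact: cvg_wt_restr.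
move=> N; apply: le_trans (wt_tail_le N at_ tT hm0) _.
by rewrite ler_wpM2r ?powR_ge0// lerDr.
Qed.

Lemma clo_le_wt t m : a <= t -> t <= T -> m != 0 -> clo * supR R m `^ (- (2 * t)) <= wt t m.
Proof.
move=> at_ tT m0; apply: le_trans (pnorm_le_wt _ _); last exact: le_trans at_.
rewrite /pnorm (negbTE m0) ler_wpM2r ?powR_ge0//.
by apply: ler_powR; [exact: lamC_ge1|rewrite lerN2].
Qed.

Lemma wt_le_At t q m : a <= t -> wt t m <= At t (cls q m).
Proof.
move=> at_; apply: le_trans (@term_le_latsum _ _ _ m _ _).
- by rewrite /restr eqxx.
- by apply: restr_ge0 => k; exact: wt_ge0.
- exact: cvg_wt_restr.
Qed.

Lemma At_upper t q (r : Jq d q) : a <= t -> t <= T -> At t r <= Cup * Hq r `^ (- (2 * t)).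
Proof.
move=> at_ tT; have t0 : 0 <= t by exact: le_trans at_.
apply: latsum_le_bound; first exact: cvg_wt_restr.
move=> N.
apply: (@le_trans _ _ (boxsum N (fun m => restr (fun m => m == cent r) (wt t) m +
   restr (fun m => (cls q m == cls q (cent r)) && (m != cent r)) (wt t) m))).
  apply: boxsum_le => m; rewrite /restr cls_cent; case: (eqVneq m (cent r)) => [->|].
    by rewrite cls_cent eqxx /= addr0.
  by rewrite andbT add0r.
rewrite boxsumD.
have tl := wt_tail_le N at_ tT (supn_cent r).
have h1 : boxsum N (restr (fun m => m == cent r) (wt t)) <= wt t (cent r).
  rewrite boxsumE; suff : \sum_(m <- boxseq d N) restr (fun m => m == cent r) (wt t) m <=
      \sum_(m <- [:: cent r]) wt t m by rewrite big_seq1.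
  apply: (@sum_inj_le _ _ _ _ _ id); rewrite ?uniq_boxseq//.
  - by move=> m; exact: wt_ge0.
  - by move=> m _; rewrite /restr inE; case: ifP => // _; rewrite eqxx.
have hN : Nq q `^ (- (2 * t)) <= Hq r `^ (- (2 * t)).
  by apply: ler_powRN; rewrite ?mulr_ge0 ?Hq_gt0 ?Hq_le.
rewrite /Cup mulrDl mul1r; apply: lerD.
  apply: le_trans h1 _; apply: le_trans (wt_le_pnorm _ t0) _.
  by rewrite /pnorm /Hq; case: eqVneq => // _; exact: powR_ge0.
by apply: le_trans tl _; rewrite ler_wpM2l// mulr_ge0 ?powR_ge0 ?Z_ge0.
Qed.

(** One member suffices: [cent r], or, for the class of 0, the frequency 2^q along one axis. *)
Lemma At_lower t q (r : Jq d q) : a <= t -> t <= T -> clo * Hq r `^ (- (2 * t)) <= At t r.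
Proof.
move=> at_ tT; rewrite /Hq; case: eqVneq => [r0|r0].
  pose m := unitv (2 ^ q)%:Z.
  have sm : supn m = (2 ^ q)%N by rewrite supn_unitv absz_nat.
  have m0 : m != 0 by rewrite -supn_gt0 sm expn_gt0.
  have cm : cls q m = r.
    rewrite -[RHS]cls_cent r0; apply/eqP/clsP => i; rewrite !ffunE subr0.
    by case: ifP => _; rewrite ?dvdzz ?dvdz0.
  rewrite -[in leRHS]cm; apply: le_trans (wt_le_At q m at_).
  by have := clo_le_wt at_ tT m0; rewrite /supR sm.
rewrite -{2}[r]cls_cent; apply: le_trans (wt_le_At q _ at_).
exact: clo_le_wt.
Qed.

Lemma At_gt0 t q (r : Jq d q) : a <= t -> t <= T -> 0 < At t r.
Proof.
move=> at_ tT; apply: lt_le_trans (At_lower r at_ tT).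
by rewrite mulr_gt0 ?clo_gt0 ?powR_gt0 ?Hq_gt0.
Qed.

End uniform.

(** The map [cent] embeds the classes other than that of 0 into the nonzero lattice points; the
    class of 0 accounts for the 1. *)
Lemma sum_Hq_le p Z q : 0 <= p -> (forall N, boxsum N (pnorm p : lattice d -> R) <= Z) ->
  \sum_(r : Jq d q) Hq r `^ (- p) <= Z + 1.
Proof.
move=> p0 HZ.
rewrite (bigID (fun r : Jq d q => cent r == 0))/= addrC; apply: lerD.
  apply: le_trans (HZ (2 ^ q)%N); rewrite boxsumE.
  rewrite -big_filter; apply: (@sum_inj_le _ _ _ _ _ (@cent d q)).
  - by rewrite filter_uniq// index_enum_uniq.
  - exact: uniq_boxseq.
  - by move=> m; exact: pnorm_ge0.
  - move=> r; rewrite mem_filter => /andP[r0 _] _; split.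
      by rewrite mem_boxseq; have := supn_cent r; lia.
    by rewrite /pnorm /Hq (negbTE r0).
  - by move=> r s _ _ _ _; exact: cent_inj.
pose r0 : Jq d q := cls q 0.
have rr (r : Jq d q) : cent r == 0 -> r = r0 by move=> /eqP h; rewrite -[r]cls_cent h.
rewrite (eq_bigr (fun r => Hq r `^ (- p))); last by [].
case: (boolP (cent r0 == 0)) => h.
  rewrite (bigD1 r0)//= big1 ?addr0; last by move=> r /andP[/rr -> ]; rewrite eqxx.
  by rewrite powRN invf_le1 ?powR_gt0 ?Hq_gt0// -[leLHS](powRr0 (Hq r0)); apply: ler_powR => //; exact: Hq_ge1.
rewrite big1//; move=> r hr; case/negP : h; by rewrite -(rr _ hr).
Qed.

End class_bounds.

(** * Fourier diagonalisation of the Gram matrix *)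

Section complex_exponential.
Variable R : realType.
Local Open Scope complex_scope.

Lemma cexpD (x y : R) : cexp (x + y) = cexp x * cexp y.
Proof. by rewrite /cexp cosD sinD; apply/eqP; rewrite eq_complex/= eqxx/= addrC mulrC [X in _ + X]mulrC. Qed.

Lemma cexp0 : cexp (0 : R) = 1.
Proof. by rewrite /cexp cos0 sin0. Qed.

Lemma cexp_sum (I : Type) (s : seq I) (f : I -> R) :
  cexp (\sum_(i <- s) f i) = \prod_(i <- s) cexp (f i).
Proof.
elim: s => [|i s IH]; first by rewrite !big_nil cexp0.
by rewrite !big_cons cexpD IH.
Qed.

Lemma cexpMn (x : R) n : cexp (x *+ n) = cexp x ^+ n.
Proof. by elim: n => [|n IH]; rewrite ?mulr0n ?cexp0// mulrS cexpD IH exprS. Qed.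

Lemma cexp2pi : cexp (2 * pi : R) = 1.
Proof. by rewrite mulr_natl /cexp cos2pi sin2pi. Qed.

Lemma cexp_int (z : int) : cexp (2 * pi * z%:~R : R) = 1.
Proof.
have h n : cexp (2 * pi * n%:R : R) = 1 by rewrite mulr_natr cexpMn cexp2pi expr1n.
case: z => n; first exact: h.
have := h n.+1; rewrite NegzE mulrNz mulrN => e.
have := cexpD (2 * pi * n.+1%:R) (- (2 * pi * n.+1%:R)).
by rewrite subrr cexp0 e mul1r => <-.
Qed.

Lemma cexp_period (x : R) (z : int) : cexp (x + 2 * pi * z%:~R) = cexp x.
Proof. by rewrite cexpD cexp_int mulr1. Qed.

Lemma cexp_neq1 (x : R) : 0 < x -> x < 2 * pi -> cexp x != 1.
Proof.
move=> x0 x2; apply/negP; rewrite eq_complex/= => /andP[/eqP c _].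
have s0 : 0 < sin (x / 2) by apply: sin_gt0_pi; apply/andP; split; lra.
have : x = x / 2 + x / 2 by field.
move=> e; move: c; rewrite {1}e cosD.
by have := cos2Dsin2 (x / 2); nra.
Qed.

(** The terms are the powers of an N-th root of unity. It is not 1, because reducing z modulo N
    gives an angle strictly between 0 and 2 pi. *)
Lemma geometric_cexp (N : nat) (z : int) : (0 < N)%N -> ~~ (N%:Z %| z)%Z ->
  \sum_(j < N) cexp (2 * pi * ((j : nat)%:R * z%:~R / N%:R) : R) = 0.
Proof.
move=> N0 Nz; pose w : R[i] := cexp (2 * pi * (z%:~R / N%:R)).
have NR : (N%:R : R) != 0 by rewrite pnatr_eq0 -lt0n.
have wN : w ^+ N = 1.
  rewrite /w -cexpMn.
  have -> : 2 * pi * (z%:~R / N%:R) *+ N = 2 * pi * z%:~R :> R by rewrite -mulr_natr; field.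
  exact: cexp_int.
have w1 : w != 1.
  pose r := (z %% N)%Z.
  have r0 : 0 <= r by apply: modz_ge0; rewrite -lt0n.
  have rN : r < N%:Z by apply: ltz_pmod.
  have rne : r != 0 by apply: contra Nz => /eqP h; apply/dvdz_mod0P.
  have e : z = (z %/ N)%Z * N%:Z + r by exact: divz_eq.
  have -> : w = cexp (2 * pi * (r%:~R / N%:R)).
    rewrite /w {1}e intrD intrM -[(Posz N)%:~R]/(N%:R).
    rewrite -[RHS](cexp_period _ (z %/ N)%Z); congr cexp.
    by move: (_%:~R) (_%:~R) => x y; field.
  have r01 : 0 < r%:~R / N%:R :> R.
    by rewrite divr_gt0 ?ltr0n// ltr0z lt_neqAle eq_sym rne.
  have r11 : r%:~R / N%:R < 1 :> R.
    by rewrite ltr_pdivrMr ?ltr0n// mul1r -[X in _ < X]/((Posz N)%:~R) ltr_int.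
  apply: cexp_neq1.
    by have := @pi_gt0 R; nra.
  by have := @pi_gt0 R; nra.
have : (w - 1) * \sum_(j < N) w ^+ j = 0 by rewrite -subrX1 wN subrr.
move/eqP; rewrite mulf_eq0 subr_eq0 (negbTE w1)/= => /eqP h.
rewrite -[RHS]h; apply: eq_bigr => j _; rewrite /w -cexpMn; congr cexp.
by rewrite -[in RHS]mulr_natr; ring.
Qed.

End complex_exponential.

Section fourier.
Variables (R : realType) (d q : nat).
Local Open Scope complex_scope.
Local Notation N := (2 ^ q)%N.
Local Notation J := (Jq d q).
Local Notation n := (npts d q).

Definition pj (r k : J) : R := phase (rep r) (node R k).

Lemma phase_cls (m : lattice d) (k : J) :
  exists z : int, phase m (node R k) = pj (cls q m) k + 2 * pi * z%:~R.
Proof.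
have NR : (N%:R : R) != 0 by rewrite pnatr_eq0 -lt0n expn_gt0.
have h i : {z : int | m i = rep (cls q m) i + z * N%:Z}.
  have /clsP/(_ i) : cls q m == cls q (rep (cls q m)) by rewrite cls_rep.
  by move=> /dvdzP /cid[z hz]; exists z; rewrite -hz addrC subrK.
exists (\sum_i sval (h i) * (k i : nat)%:Z).
rewrite /pj /phase -mulrDr; congr (_ * _).
rewrite rmorph_sum -big_split/=; apply: eq_bigr => i _.
rewrite [in LHS](svalP (h i)) intrD intrM rmorphM/= /node; field.
by [].
Qed.

Lemma cexp_phase_cls (m : lattice d) (k : J) :
  cexp (phase m (node R k)) = cexp (pj (cls q m) k).
Proof. by have [z ->] := phase_cls m k; rewrite cexp_period. Qed.

Lemma cexp_phaseB_cls (m : lattice d) (k l : J) :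
  cexp (phase m (node R k) - phase m (node R l)) = cexp (pj (cls q m) k - pj (cls q m) l).
Proof.
have [z ->] := phase_cls m k; have [z' ->] := phase_cls m l.
rewrite -[RHS](cexp_period _ (z - z')); congr cexp; rewrite intrB; ring.
Qed.

Lemma cexp_phaseN_cls (m : lattice d) (k : J) :
  cexp (- phase m (node R k)) = cexp (- pj (cls q m) k).
Proof.
have [z ->] := phase_cls m k; rewrite -[RHS](cexp_period _ (- z)); congr cexp.
by rewrite mulrNz; ring.
Qed.

Lemma small_residues_eq (a b M : nat) (z : int) : a%:Z - b%:Z = z * M%:Z ->
  (a < M)%N -> (b < M)%N -> a = b.
Proof. by have [->|z0] := eqVneq z 0; [lia|nia]. Qed.

(** The sum factors over the coordinates, and a coordinate where [k] and [l] differ gives a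
    vanishing geometric sum. *)
Lemma sum_cexp_pj (k l : J) :
  \sum_(r : J) cexp (pj r k - pj r l) = if k == l then ((N ^ d)%:R : R[i]) else 0.
Proof.
have NR : (N%:R : R) != 0 by rewrite pnatr_eq0 -lt0n expn_gt0.
have e r : cexp (pj r k - pj r l) =
    \prod_(i < d) cexp (2 * pi * ((r i : nat)%:R * ((k i : nat)%:Z - (l i : nat)%:Z)%:~R / N%:R)).
  rewrite -cexp_sum; congr cexp; rewrite /pj /phase -mulrBr -mulr_sumr; congr (_ * _).
  rewrite -sumrB; apply: eq_bigr => i _.
  by rewrite /rep /node ffunE intrB; field.
under eq_bigr do rewrite e.
rewrite -(bigA_distr_bigA (fun i (j : 'I_N) =>
   cexp (2 * pi * ((j : nat)%:R * ((k i : nat)%:Z - (l i : nat)%:Z)%:~R / N%:R : R))))/=.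
case: eqVneq => [->|kl].
  rewrite (eq_bigr (fun=> N%:R)).
    by rewrite prodr_const card_ord -natrX.
  move=> i _; rewrite (eq_bigr (fun=> 1)); last first.
    by move=> j _; rewrite subrr mulr0 mul0r mulr0 cexp0.
  by rewrite sumr_const card_ord.
have [i hi] : exists i, k i != l i.
  apply/existsP; rewrite -[X in is_true X]negbK negb_exists; apply: contra kl => /forallP h.
  by apply/eqP/ffunP => i; apply/eqP; have := h i; rewrite negbK.
rewrite (bigD1 i)//= geometric_cexp ?mul0r ?expn_gt0//.
apply/negP => /dvdzP[z hz].
by case/eqP : hi; apply: val_inj; apply: (small_residues_eq hz).
Qed.

Lemma big_npts (V : Type) (idx : V) (op : Monoid.com_law idx) (F : J -> V) :
  \big[op/idx]_j F j = \big[op/idx]_(k < n) F (enum_val k).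
Proof. by rewrite (reindex _ (onW_bij _ (enum_val_bij J))). Qed.

(** The unnormalised discrete Fourier matrix; [Psi] is its conjugate transpose, whence the factors
    [nd]. *)
Definition Phi : 'M[R[i]]_n := \matrix_(k, r) cexp (pj (enum_val r) (enum_val k)).
Definition Psi : 'M[R[i]]_n := \matrix_(r, k) cexp (- pj (enum_val r) (enum_val k)).
Definition nd : R[i] := (N ^ d)%:R.

Lemma nd_neq0 : nd != 0.
Proof. by rewrite /nd pnatr_eq0 -lt0n !expn_gt0. Qed.

Lemma Phi_Psi : Phi *m Psi = nd%:M.
Proof.
apply/matrixP => k l; rewrite !mxE.
under eq_bigr do rewrite !mxE -cexpD.
rewrite -(big_npts _ (fun r => cexp (pj r (enum_val k) - pj r (enum_val l))))/=.
rewrite sum_cexp_pj (inj_eq enum_val_inj) /nd.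
by case: eqP => //= _; rewrite mulr1n.
Qed.

Lemma Psi_Phi : Psi *m Phi = nd%:M.
Proof.
have : Phi *m (nd^-1 *: Psi) = 1%:M.
  by rewrite -scalemxAr Phi_Psi scale_scalar_mx mulVf ?nd_neq0.
move/mulmx1C; rewrite -scalemxAl => h.
rewrite -[LHS]scale1r -(mulfV nd_neq0) -scalerA h scale_scalar_mx mulr1.
by [].
Qed.

Section diagonalized.
Variables (G : 'M[R]_n) (A : J -> R).
Hypothesis A0 : forall r, A r != 0.
Hypothesis GE : forall k l, (G k l)%:C =
  \sum_r (A r)%:C * cexp (pj r (enum_val k) - pj r (enum_val l)).

Let D : 'M[R[i]]_n := diag_mx (\row_r (A (enum_val r))%:C).
Let Di : 'M[R[i]]_n := diag_mx (\row_r ((A (enum_val r))^-1)%:C).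

Let DDi : D *m Di = 1%:M.
Proof.
rewrite mulmx_diag; apply/matrixP => k l; rewrite !mxE.
by rewrite -rmorphM/= mulfV.
Qed.

Lemma Gram_diag : map_mx (fun x => x%:C) G = Phi *m D *m Psi.
Proof.
apply/matrixP => k l; rewrite !mxE GE.
rewrite (big_npts _ (fun r => (A r)%:C * cexp (pj r (enum_val k) - pj r (enum_val l))))/=.
apply: eq_bigr => r _; rewrite mul_mx_diag !mxE cexpD.
by rewrite mulrA [X in X * _]mulrC.
Qed.

Lemma invmx_diag : invmx (map_mx (fun x => x%:C) G) = nd^-2 *: (Phi *m Di *m Psi).
Proof.
set K := map_mx _ _.
have h : K *m (nd^-2 *: (Phi *m Di *m Psi)) = 1%:M.
  rewrite /K Gram_diag -scalemxAr -!mulmxA (mulmxA Psi) Psi_Phi mul_scalar_mx.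
  rewrite -!scalemxAr (mulmxA D) DDi mul1mx Phi_Psi !scale_scalar_mx.
  by congr (_%:M); field; exact: nd_neq0.
have Ku : K \in unitmx by have [] := mulmx1_unit h.
by rewrite -[LHS]mulmx1 -h mulKmx.
Qed.

Lemma det_diag : \det G = \prod_r A r * (N ^ d)%:R ^+ n.
Proof.
apply: (@complexI R); rewrite -det_map_mx Gram_diag !det_mulmx.
(* Within this proof [det_diag] still denotes the library lemma on diagonal matrices. *)
rewrite mulrAC -det_mulmx Phi_Psi det_scalar det_diag.
rewrite mulrC rmorphM/= rmorphXn/= rmorph_nat; congr (_ * _).
rewrite rmorph_prod (big_npts _ (fun r => (A r)%:C))/=.
by apply: eq_bigr => r _; rewrite mxE.
Qed.

(** Data of the form [Phi *m u] meet [Psi *m Phi] twice, which cancels [nd^-2] and leaves the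
    division by the diagonal. *)
Lemma dual_coefficients (U : J -> R) (y : 'cV[R[i]]_n) :
  (forall k, y k 0 = \sum_r (U r)%:C * cexp (pj r (enum_val k))) ->
  forall r : J, \sum_k (invmx (map_mx (fun x => x%:C) G) *m y) k 0 * cexp (- pj r (enum_val k))
    = (U r / A r)%:C.
Proof.
move=> yE r.
pose u : 'cV[R[i]]_n := \col_r (U (enum_val r))%:C.
have -> : y = Phi *m u.
  apply/matrixP => k j; rewrite ord1 yE !mxE.
  rewrite (big_npts _ (fun r => (U r)%:C * cexp (pj r (enum_val k))))/=.
  by apply: eq_bigr => l _; rewrite !mxE mulrC.
rewrite invmx_diag -scalemxAl -!mulmxA (mulmxA Psi) Psi_Phi mul_scalar_mx.
set a := _ *: _.
have -> : \sum_k a k 0 * cexp (- pj r (enum_val k)) = (Psi *m a) (enum_rank r) 0.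
  by rewrite mxE; apply: eq_bigr => k _; rewrite !mxE enum_rankK mulrC.
rewrite /a -!scalemxAr (mulmxA Psi) Psi_Phi mul_scalar_mx !scalerA.
have -> : nd^-2 * nd * nd = 1 by field; exact: nd_neq0.
rewrite scale1r mul_diag_mx !mxE enum_rankK -rmorphM/=.
by rewrite mulrC.
Qed.

End diagonalized.

End fourier.

(** * The two objectives as sums over residue classes *)

Section objectives.
Variables (R : realType) (d : nat).
Local Open Scope complex_scope.
Implicit Types (m : lattice d) (t s : R).

Definition cvg_classes q (F : lattice d -> R) : Prop :=
  forall r : Jq d q, cvgn (fun N => boxsum N (restr (fun m => cls q m == r) F)).

Lemma boxsum_opp (F : lattice d -> R) N : boxsum N (fun m => F (- m)) = boxsum N F.
Proof.
rewrite !boxsumE -(big_map (fun m : lattice d => - m) xpredT F); apply: perm_big.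
apply: uniq_perm; [rewrite map_inj_uniq ?uniq_boxseq//; exact: oppr_inj|exact: uniq_boxseq|].
move=> m; apply/mapP/idP => [[m' h ->]|h]; first by move: h; rewrite !mem_boxseq supnN.
by exists (- m); rewrite ?opprK// mem_boxseq supnN -mem_boxseq.
Qed.

Lemma lamN m : lam R (- m) = lam R m.
Proof. by rewrite /lam; congr (_ * _); apply: eq_bigr => i _; rewrite ffunE mulrNz sqrrN. Qed.

Lemma wtN t m : wt t (- m) = wt t m :> R.
Proof. by rewrite /wt oppr_eq0 lamN. Qed.

Lemma phaseN m (x : pt R d) : phase (- m) x = - phase m x.
Proof.
rewrite /phase -mulrN -sumrN; congr (_ * _); apply: eq_bigr => i _.
by rewrite ffunE mulrNz mulNr.
Qed.

Lemma cos_sin_cexp (x y : R) : cexp x = cexp y -> cos x = cos y /\ sin x = sin y.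
Proof. by move/eqP; rewrite eq_complex/= => /andP[/eqP-> /eqP->]. Qed.

Lemma Gram_classes t q (k l : 'I_(npts d q)) : cvg_classes q (wt t) ->
  (Gram d t q k l)%:C = \sum_r (At t r)%:C * cexp (pj R r (enum_val k) - pj R r (enum_val l)).
Proof.
move=> cw; rewrite mxE.
pose x := node R (enum_val k); pose y := node R (enum_val l).
have e m := cos_sin_cexp (cexp_phaseB_cls R m (enum_val k) (enum_val l)).
have -> : Kt t (gridpt R k) (gridpt R l) =
    latsum (fun m => wt t m * cos (pj R (cls q m) (enum_val k) - pj R (cls q m) (enum_val l))).
  rewrite /Kt; congr latsum; apply/funext => m; rewrite /wt; case: ifP => _; first by rewrite mul0r.
  by rewrite (e m).1.
rewrite (latsum_classes (fun r => cos (pj R r (enum_val k) - pj R r (enum_val l))) cw).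
(* The imaginary part of the Gram entry vanishes: [wt] is even and the sine is odd under negation of
   the frequency, and the boxes are symmetric. *)
have s0 : \sum_r sin (pj R r (enum_val k) - pj R r (enum_val l)) * At t r = 0.
  rewrite -(latsum_classes (fun r => sin (pj R r (enum_val k) - pj R r (enum_val l))) cw).
  rewrite /latsum (_ : (fun N => _) = (fun=> 0)); first exact: lim_cst.
  apply/funext => N.
  set F := (fun m => _).
  have FN m : F (- m) = - F m.
    rewrite /F wtN -(e m).2 -(e (- m)).2 !phaseN.
    by rewrite -opprD sinN mulrN.
  have : boxsum N F = - boxsum N F.
    by rewrite -[LHS]boxsum_opp !boxsumE -sumrN; apply: eq_bigr => m _; rewrite FN.
  by move/eqP; rewrite -addr_eq0 -mulr2n mulrn_eq0/= => /eqP.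
apply/eqP; rewrite eq_complex; apply/andP; split; apply/eqP.
  rewrite [RHS]raddf_sum/=; apply: eq_bigr => r _; rewrite /At /cexp/=; ring.
rewrite [RHS]raddf_sum/= -[LHS]s0; apply: eq_bigr => r _; rewrite /cexp/=; ring.
Qed.

Section level.
Variables (t : R) (q : nat).
Hypotheses (cw : cvg_classes q (wt t)) (A0 : forall r : Jq d q, 0 < At t r).

Lemma lndet_Gram : ln (\det (@Gram R d t q)) =
  \sum_(r : Jq d q) ln (At t r) + ln (((2 ^ q) ^ d)%:R ^+ npts d q).
Proof.
rewrite (det_diag (fun k l => Gram_classes k l cw)).
have p0 : 0 < \prod_(r : Jq d q) At t r :> R by apply: prodr_gt0.
rewrite lnM ?posrE ?exprn_gt0 ?ltr0n ?expn_gt0//; congr (_ + _).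
elim: (index_enum _) => [|r rs IH]; first by rewrite !big_nil ln1.
by rewrite !big_cons lnM ?posrE ?prodr_gt0// IH.
Qed.

Lemma gpr_coef_classes (U : Jq d q -> R) (y : 'cV[R[i]]_(npts d q)) m :
  (forall k, y k 0 = \sum_r (U r)%:C * cexp (pj R r (enum_val k))) ->
  gpr_coef t y m = (wt t m * (U (cls q m) / At t (cls q m)))%:C.
Proof.
move=> yE; rewrite /gpr_coef /wt; case: ifP => m0; first by rewrite mul0r.
have An (r : Jq d q) : At t r != 0 :> R by rewrite gt_eqF.
rewrite rmorphM/=; congr (_ * _).
rewrite -(dual_coefficients An (fun k l => Gram_classes k l cw) yE).
by apply: eq_bigr => k _; rewrite cexp_phaseN_cls.
Qed.

Lemma sob2_real (c : lattice d -> R[i]) (g : Jq d q -> R) :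
  (forall m, c m = (wt t m * g (cls q m))%:C) ->
  sob2 t c = \sum_r g r ^+ 2 * At t r.
Proof.
move=> cE; rewrite -(latsum_classes (fun r => g r ^+ 2) cw) /sob2; congr latsum.
apply/funext => m; rewrite cE/= expr0n addr0 /wt; case: ifP => m0; rewrite ?m0; first by rewrite mul0r.
rewrite powRN exprMn mulrA; congr (_ * _).
have [l0|l0] := eqVneq (lam R m `^ t) 0; first by rewrite l0 mul0r invr0.
by field.
Qed.

End level.

Definition uhat s (x : lattice d -> R) m : R := if m == 0 then 0 else lam R m `^ (- s / 2) * x m.

Definition Uq s x q (r : Jq d q) : R := clsum (uhat s x) r.

Lemma data_classes s x q k : cvg_classes q (uhat s x) ->
  data s x q k 0 = \sum_r (Uq s x r)%:C * cexp (pj R r (enum_val k)).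
Proof.
move=> cu; rewrite mxE /udag.
have e m := cos_sin_cexp (cexp_phase_cls R m (enum_val k)).
have -> : latsum (fun m => if m == 0 then 0 else lam R m `^ (- s / 2) * x m * cos (phase m (gridpt R k)))
   = \sum_r cos (pj R r (enum_val k)) * Uq s x r.
  rewrite -(latsum_classes (fun r => cos (pj R r (enum_val k))) cu); congr latsum.
  apply/funext => m; rewrite /uhat; case: ifP => _; first by rewrite mul0r.
  by rewrite (e m).1.
have -> : latsum (fun m => if m == 0 then 0 else lam R m `^ (- s / 2) * x m * sin (phase m (gridpt R k)))
   = \sum_r sin (pj R r (enum_val k)) * Uq s x r.
  rewrite -(latsum_classes (fun r => sin (pj R r (enum_val k))) cu); congr latsum.
  apply/funext => m; rewrite /uhat; case: ifP => _; first by rewrite mul0r.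
  by rewrite (e m).2.
apply/eqP; rewrite eq_complex; apply/andP; split; apply/eqP.
  rewrite raddf_sum/=; apply: eq_bigr => r _; rewrite /cexp/=; ring.
rewrite raddf_sum/=; apply: eq_bigr => r _; rewrite /cexp/=; ring.
Qed.

Definition den s x t q : R := \sum_(r : Jq d q) Uq s x r ^+ 2 / At t r.

Lemma sob2_gpr s x t q : cvg_classes q (wt t) -> (forall r : Jq d q, 0 < At t r) ->
  cvg_classes q (uhat s x) -> sob2 t (gpr_coef t (data s x q)) = den s x t q.
Proof.
move=> cw A0 cu.
rewrite (sob2_real cw (g := fun r => Uq s x r / At t r)).
  by apply: eq_bigr => r _; rewrite exprMn; field; rewrite gt_eqF.
by move=> m; rewrite (gpr_coef_classes cw A0 _ (fun k => data_classes k cu)).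
Qed.

Lemma EB_objE s x q t : cvg_classes q (wt t) -> (forall r : Jq d q, 0 < At t r) ->
  cvg_classes q (uhat s x) ->
  EB_obj s x q t = den s x t q + \sum_(r : Jq d q) ln (At t r)
    + ln (((2 ^ q) ^ d)%:R ^+ npts d q).
Proof. by move=> cw A0 cu; rewrite /EB_obj sob2_gpr// lndet_Gram// addrA. Qed.

Definition num s x t q : R := \sum_(r : Jq d q.+1)
  (Uq s x r - At t r * (Uq s x (bar r) / At t (bar r))) ^+ 2 / At t r.

Lemma KF_objE s x q t :
  cvg_classes q.+1 (wt t) -> (forall r : Jq d q.+1, 0 < At t r) -> cvg_classes q.+1 (uhat s x) ->
  cvg_classes q (wt t) -> (forall r : Jq d q, 0 < At t r) -> cvg_classes q (uhat s x) ->
  KF_obj s x q.+1 t = num s x t q / den s x t q.+1.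
Proof.
move=> cw A0 cu cw' A0' cu'; rewrite /KF_obj sob2_gpr//; congr (_ / _).
rewrite (sob2_real cw
  (g := fun r => Uq s x r / At t r - Uq s x (bar r) / At t (bar r))).
  apply: eq_bigr => r _.
  by field; rewrite !gt_eqF.
move=> m; rewrite (gpr_coef_classes cw A0 _ (fun k => data_classes k cu)).
rewrite (gpr_coef_classes cw' A0' _ (fun k => data_classes k cu')).
by rewrite -rmorphB/= bar_cls; congr (_%:C); ring.
Qed.

End objectives.

(** * Random Fourier sums *)

Section random_coefficients.
Context {R : realType} {d : nat} {dom : measure_display} {Omega : measurableType dom}
  (P : probability Omega R) (xi : lattice d -> {RV P >-> R}).
Hypothesis d0 : (0 < d)%N.
Hypothesis xi_normal : forall m : lattice d, m != 0 -> forall A : set R, measurable A ->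
     distribution P (xi m) A = normal_prob 0 1 A.
Hypothesis xi_indep : forall (F : seq (lattice d)) (B : lattice d -> set R),
     uniq F -> (forall m, m \in F -> m != 0) -> (forall m, measurable (B m)) ->
     P [set w | forall m, m \in F -> B m (xi m w)]
     = \big[*%E/1%E]_(m <- F) P (xi m @^-1` B m).

Local Notation nonzero := (fun m : lattice d => m != 0).

Definition Tc (c : lattice d -> R) (n : nat) (w : Omega) : R :=
  boxsum n (fun m => c m * xi m w).
Definition Vc (c : lattice d -> R) (w : Omega) : R := latsum (fun m => c m * xi m w).

Lemma measurable_Tc c n : measurable_fun setT (Tc c n).
Proof.
rewrite /Tc; under eq_fun do rewrite boxsumE.
by apply: measurable_sum => m; apply: measurable_funM.
Qed.

Lemma boxsumB_restr (F : lattice d -> R) i j : (i <= j)%N ->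
  boxsum j F - boxsum i F = boxsum j (restr (fun m => (i < supn m)%N) F).
Proof.
move=> ij; rewrite !boxsumE [X in X - _](bigID (fun m => supn m <= i)%N)/=.
have pe : perm_eq [seq m <- boxseq d j | (supn m <= i)%N] (boxseq d i).
  apply: uniq_perm; rewrite ?filter_uniq ?uniq_boxseq// => m.
  rewrite mem_filter !mem_boxseq; case: (leqP (supn m) i) => //= h.
  by rewrite (leq_trans h).
rewrite -[X in X + _ - _]big_filter (perm_big _ pe)/= addrC addKr big_mkcond/=.
by apply: eq_bigr => m _; rewrite /restr ltnNge; case: ifP.
Qed.

Definition xi_var : R := sval (cid (X_second_moment xi_normal)).

Lemma xi_var_gt0 : 0 < xi_var.
Proof. by rewrite /xi_var; case: cid => v []. Qed.

Lemma xi_varP m : m != 0 -> (\int[P]_w ((xi m w) ^+ 2)%:E <= xi_var%:E)%E.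
Proof. by rewrite /xi_var; case: cid => v [v0 H] /=; exact: H. Qed.

(** The law of [xi 0] is unconstrained; a zero coefficient removes it, and products with a zero
    coefficient are treated apart. *)
Lemma second_moment_boxsum c n : c 0 = 0 ->
  (\int[P]_w ((Tc c n w) ^+ 2)%:E <= (xi_var * boxsum n (fun m => c m ^+ 2))%:E)%E.
Proof.
move=> c00.
have c_neq0 m : c m != 0 -> m != 0 by apply: contra => /eqP ->; rewrite c00.
pose Y m w := c m * xi m w.
have YE i j w : Y i w * Y j w = (c i * c j) * (xi i w * xi j w) by rewrite /Y; ring.
have zero i j : (c i == 0) || (c j == 0) -> forall w, (Y i w * Y j w)%:E = 0%E.
  by move=> h w; rewrite YE; case/orP : h => /eqP ->; rewrite ?mul0r ?mulr0 ?mul0r.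
have := @integral_sqr_sum_orthogonal _ _ _ P _ Y (fun m => xi_var * c m ^+ 2) _ _ _
   (boxseq d n) (uniq_boxseq d n).
rewrite -mulr_sumr -boxsumE.
under eq_integral do rewrite -boxsumE.
apply.
- move=> i j; have [z|] := boolP ((c i == 0) || (c j == 0)).
    by rewrite (_ : (fun w => _) = cst 0%E); [exact: integrable0|apply/funext => w; exact: zero].
  rewrite negb_or => /andP[/c_neq0 i0 /c_neq0 j0].
  rewrite (_ : (fun w => _) = (fun w => (c i * c j)%:E * (xi i w * xi j w)%:E)%E); last first.
    by apply/funext => w; rewrite YE EFinM.
  by apply: integrableZl => //; exact: (X_integrable_prod xi_normal).
- move=> i j ij; have [z|] := boolP ((c i == 0) || (c j == 0)).
    by under eq_integral => w _ do rewrite zero//; exact: integral0.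
  rewrite negb_or => /andP[/c_neq0 i0 /c_neq0 j0].
  under eq_integral => w _ do rewrite YE EFinM.
  rewrite integralZl//; last exact: (X_integrable_prod xi_normal).
  by rewrite (X_orthogonal xi_normal xi_indep)// mule0.
- move=> i; have [z|/c_neq0 i0] := eqVneq (c i) 0.
    under eq_integral => w _ do rewrite expr2 zero ?z ?eqxx//.
    by rewrite integral0 z expr0n mulr0.
  rewrite mulrC; under eq_integral => w _ do rewrite /Y exprMn EFinM.
  rewrite ge0_integralZl//; last 3 first.
  + by apply/measurable_EFinP/measurable_funX.
  + by move=> w _; rewrite lee_fin sqr_ge0.
  + by rewrite lee_fin sqr_ge0.
  by rewrite [leRHS]EFinM; apply: lee_wpmul2l; rewrite ?lee_fin ?sqr_ge0//; exact: xi_varP.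
Qed.

Lemma ae_cvg_Tc c (s K : R) : d%:R < 2 * s -> (forall m, `|c m| <= K * pnorm s m) ->
  exists N, [/\ measurable N, P N = 0 & forall w, ~ N w -> cvgn (fun n => Tc c n w)].
Proof.
move=> ds hc.
have dR : 0 < d%:R :> R by rewrite ltr0n.
have c00 : c 0 = 0.
  by apply/normr0_eq0/eqP; rewrite eq_le normr_ge0 andbT (le_trans (hc 0))// /pnorm eqxx mulr0.
(* Half of the surplus 2 s - d is spent on decay: beyond size 2^k, |m|^(-2s) is at most 2^(-kg)
   |m|^(-(2s-g)), and 2 s - g still exceeds d. *)
pose g : R := (2 * s - d%:R) / 2.
have g0 : 0 < g by rewrite divr_gt0// subr_gt0.
have dg : d%:R < 2 * s - g by rewrite /g; lra.
have [Z [Z0 HZ]] := pnorm_sum_bounded d0 dg.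
pose B n := xi_var * boxsum n (fun m => c m ^+ 2).
(* With this choice r^(-8k) = 2^(-kg), the form required by [ae_cvg_orthogonal]. *)
pose r : R := 2 `^ (g / 8).
have r1 : 1 < r.
  have l2 : 0 < ln 2 :> R by rewrite ln_gt0 ?ltr1n.
  by rewrite /r /powR pnatr_eq0/= expR_gt1 mulr_gt0// divr_gt0.
apply: (@ae_cvg_orthogonal _ _ _ P (Tc c) (measurable_Tc c) B (xi_var * (K ^+ 2 * Z)) r) => //.
- move=> i j ij; rewrite /B -mulrBr boxsumB_restr//.
  pose c' := restr (fun m => (i < supn m)%N) c.
  have -> : restr (fun m => (i < supn m)%N) (fun m => c m ^+ 2) = (fun m => c' m ^+ 2).
    by apply/funext => m; rewrite /c' /restr; case: ifP => //; rewrite expr0n.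
  apply: le_trans (second_moment_boxsum (c := c') j _); last by rewrite /c' /restr; case: ifP.
  rewrite le_eqVlt; apply/orP; left; apply/eqP; apply: eq_integral => w _.
  rewrite /Tc boxsumB_restr//; congr ((_ ^+ 2)%:E); congr boxsum.
  by apply/funext => m; rewrite /c' /restr; case: ifP => //; rewrite mul0r.
- move=> k; rewrite /B -mulrBr -mulrA ler_wpM2l ?(ltW xi_var_gt0)//.
  rewrite boxsumB_restr ?leq_exp2l//.
  have -> : r^-1 ^+ (8 * k) = (2 ^ k)%:R `^ (- g).
    rewrite exprVn powRN; congr (_^-1).
    have -> : r ^+ (8 * k) = r `^ (8 * k)%:R by rewrite powR_mulrn// powR_ge0.
    have -> : (2 ^ k)%:R = 2 `^ k%:R :> R by rewrite natrX powR_mulrn.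
    rewrite /r -[LHS]powRrM -[RHS]powRrM; congr (_ `^ _).
    by rewrite natrM; field.
  rewrite -mulrA mulrCA mulrC.
  apply: (@le_trans _ _ (boxsum (2 ^ k.+1) (fun m => (K ^+ 2 * (2 ^ k)%:R `^ (- g)) * pnorm (2 * s - g) m))).
    apply: boxsum_le => m; rewrite /restr; case: ifP => km; last first.
      by rewrite mulr_ge0 ?pnorm_ge0// mulr_ge0 ?sqr_ge0 ?powR_ge0.
    have m0 : m != 0 by rewrite -supn_gt0 (leq_trans _ km).
    have s1 := supR_ge1 R m0; have s0 : 0 < supR R m by apply: lt_le_trans s1.
    apply: (@le_trans _ _ ((K * pnorm s m) ^+ 2)).
      rewrite -[leLHS]real_normK ?num_real// lerXn2r ?nnegrE//.
      by apply: le_trans (hc m).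
    rewrite exprMn -mulrA ler_wpM2l ?sqr_ge0// /pnorm (negbTE m0).
    rewrite expr2 -powRDp//.
    have -> : - s + - s = - g + (- (2 * s - g)) by ring.
    rewrite powRDp// ler_wpM2r ?powR_ge0//; apply: ler_powRN; rewrite ?ltr0n ?expn_gt0//.
      exact: ltW.
    by rewrite /supR ler_nat ltnW.
  rewrite boxsumZ; apply: ler_wpM2l; last exact: HZ.
  by apply: mulr_ge0; [exact: sqr_ge0|exact: powR_ge0].
Qed.

Lemma liminf_Tc c w : cvgn (fun n => Tc c n w) ->
  limn_einf (fun n => ((Tc c n w) ^+ 2)%:E) = ((Vc c w) ^+ 2)%:E.
Proof.
move=> cw; have h : (fun n => (Tc c n w) ^+ 2) @ \oo --> (Vc c w) ^+ 2.
  by rewrite expr2; under eq_fun do rewrite expr2; apply: cvgM.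
have h2 : (fun n => ((Tc c n w) ^+ 2)%:E) @ \oo --> ((Vc c w) ^+ 2)%:E by apply: cvg_EFin => //; apply: nearW.
rewrite is_cvg_limn_einfE; last by apply/cvg_ex; eexists; exact: h2.
exact/cvg_lim.
Qed.

Lemma limsup_Tc c w : cvgn (fun n => Tc c n w) ->
  limn_esup (fun n => (Tc c n w)%:E) = (Vc c w)%:E.
Proof.
move=> cw.
have h2 : (fun n => (Tc c n w)%:E) @ \oo --> (Vc c w)%:E by apply: cvg_EFin => //; apply: nearW.
rewrite is_cvg_limn_esupE; last by apply/cvg_ex; eexists; exact: h2.
exact/cvg_lim.
Qed.

(** The common source of the upper bounds in probability: Markov's inequality for a weighted sum of
    squared random series, outside a null set where some series diverges. *)
Lemma sum_sqr_Vc_le (I : eqType) (rs : seq I) (c : I -> lattice d -> R)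
    (wgt sig : I -> R) (s Kc K E : R) :
  d%:R < 2 * s -> (forall i m, `|c i m| <= Kc * pnorm s m) ->
  (forall i, 0 <= wgt i) ->
  (forall i n, i \in rs -> boxsum n (fun m => c i m ^+ 2) <= sig i) ->
  \sum_(i <- rs) wgt i * sig i <= E -> 0 < K ->
  exists A : set Omega, [/\ measurable A, (P A <= (xi_var * E / K)%:E)%E &
    forall w, ~ A w -> (forall i, i \in rs -> cvgn (fun n => Tc (c i) n w)) /\
      \sum_(i <- rs) wgt i * Vc (c i) w ^+ 2 <= K].
Proof.
move=> ds hc w0 hsig hE K0.
have c00 i : c i 0 = 0.
  by apply/normr0_eq0/eqP; rewrite eq_le normr_ge0 andbT (le_trans (hc i 0))// /pnorm eqxx mulr0.
have [N hN] := choice (fun i => ae_cvg_Tc ds (hc i)).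
(* The liminf is measurable and defined everywhere, and it equals the squared series wherever that
   series converges. *)
pose L i w := limn_einf (fun n => ((Tc (c i) n w) ^+ 2)%:E).
have mL i : measurable_fun setT (L i).
  rewrite /L /limn_einf; apply: measurableT_comp => //.
  apply: measurable_fun_limn_esup => n; apply: measurableT_comp => //.
  by apply/measurable_EFinP/measurable_funX; exact: measurable_Tc.
have L0 i w : (0 <= L i w)%E.
  rewrite /L limn_einf_lim; apply: lime_ge; first exact: is_cvg_einfs.
  by apply: nearW => n; apply: le_ereal_inf_tmp => _ [k _ <-]; rewrite lee_fin sqr_ge0.
have iL i : i \in rs -> (\int[P]_w L i w <= (xi_var * sig i)%:E)%E.
  move=> irs; apply: integral_liminf_sqr; first by move=> n; exact: measurable_Tc.
  move=> n; apply: le_trans (second_moment_boxsum n (c00 i)) _.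
  by rewrite lee_fin ler_wpM2l ?(ltW xi_var_gt0)// hsig.
pose f w := (\sum_(i <- rs) (wgt i)%:E * L i w)%E.
have mwL i : measurable_fun setT (fun w => ((wgt i)%:E * L i w)%E).
  by apply: emeasurable_funM.
have mf : measurable_fun setT f by apply: emeasurable_sum.
have f0 w : (0 <= f w)%E by apply: sume_ge0 => i _; rewrite mule_ge0// lee_fin.
have if_ : (\int[P]_w f w <= (xi_var * E)%:E)%E.
  rewrite ge0_integral_sum//; last by move=> i w _; rewrite mule_ge0// lee_fin.
  apply: (@le_trans _ _ (\sum_(i <- rs) (wgt i * (xi_var * sig i))%:E)%E).
    rewrite big_seq [leRHS]big_seq; apply: lee_sum => i irs.
    rewrite ge0_integralZl// ?lee_fin// EFinM; apply: lee_wpmul2l; rewrite ?lee_fin//.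
    exact: iL.
  rewrite sumEFin lee_fin (eq_bigr (fun i => xi_var * (wgt i * sig i))); last by move=> i _; ring.
  by rewrite -mulr_sumr ler_wpM2l// ltW// xi_var_gt0.
pose A0 := \big[setU/set0]_(i <- rs) N i.
have mA0 : measurable A0 by apply: bigsetU_measurable => i _; have [] := hN i.
have PA0 : P A0 = 0%E.
  rewrite /A0; elim: (rs) => [|i l IH]; first by rewrite big_nil measure0.
  have mN j : measurable (N j) by have [] := hN j.
  rewrite big_cons; apply/eqP; rewrite eq_le measure_ge0 andbT.
  apply: le_trans (measureU2 _ _ _) _ => //; first exact: bigsetU_measurable.
  have [_ PNi _] := hN i.
  apply: (@le_trans _ _ (0 + 0)%E); last by rewrite adde0.
  by apply: leeD; rewrite le_eqVlt; apply/orP; left; exact/eqP.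
pose A1 := [set w | (K%:E <= f w)%E].
have mA1 : measurable A1.
  by rewrite /A1 -[X in measurable X]setTI; exact: emeasurable_fun_c_infty.
exists (A0 `|` A1); split.
- exact: measurableU.
- apply: le_trans (measureU2 _ mA0 mA1) _.
  apply: (@le_trans _ _ (0 + (xi_var * E / K)%:E)%E); last by rewrite add0e.
  by apply: leeD; [rewrite le_eqVlt; apply/orP; left; exact/eqP|exact: markov_ge0].
- move=> w nA; have cvw i : i \in rs -> cvgn (fun n => Tc (c i) n w).
    move=> irs; have [_ _] := hN i; apply => Nw; apply: nA; left.
    by rewrite /A0 (big_rem i irs)/=; left.
  split => //; have : ~ A1 w by move=> h; apply: nA; right.
  rewrite /A1/= => /negP; rewrite -ltNge => /ltW.
  have -> : f w = (\sum_(i <- rs) (wgt i * Vc (c i) w ^+ 2)%:E)%E.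
    rewrite /f big_seq [RHS]big_seq; apply: eq_bigr => i irs.
    by rewrite /L (liminf_Tc (cvw i irs)).
  by rewrite sumEFin lee_fin.
Qed.

End random_coefficients.

Lemma Nq_powR_large (R : realType) (g C : R) : 0 < g ->
  exists k0, forall k, (k0 <= k)%N -> C < Nq R k `^ g.
Proof.
move=> g0; have l2 : 0 < ln 2 :> R by rewrite ln_gt0 ?ltr1n.
have gl : 0 < g * ln 2 by rewrite mulr_gt0.
have [k0 hk0] : exists k0 : nat, C / (g * ln 2) < k0%:R.
  exists (Num.truncn `|C / (g * ln 2)|).+1.
  by apply: le_lt_trans (ler_norm _) _; exact: truncnS_gt.
exists k0 => k k0k.
have -> : Nq R k `^ g = expR (k%:R * (g * ln 2)).
  rewrite /powR gt_eqF ?Nq_gt0// /Nq natrX lnXn ?ltr0n//; congr expR.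
  by rewrite -mulr_natl; ring.
apply: lt_le_trans (expR_ge1Dx _).
rewrite ltr_pdivrMr// in hk0; apply: (lt_le_trans hk0).
apply: (@le_trans _ _ (k%:R * (g * ln 2))); first by rewrite ler_wpM2r ?(ltW gl)// ler_nat.
by rewrite lerDr.
Qed.

(** * Frequencies comparable to the grid resolution *)

Section inner_box.
Variable d : nat.
Hypothesis d0 : (0 < d)%N.

(* For large [l], aliasing modulo [2 ^ (k + l)] is a small perturbation at these
   frequencies. *)
Definition Ibox (k : nat) : seq (lattice d) :=
  [seq [ffun i => (2 ^ k + f i)%N%:Z] | f : {ffun 'I_d -> 'I_(2 ^ k)}].

Lemma uniq_Ibox k : uniq (Ibox k).
Proof.
rewrite map_inj_uniq ?enum_uniq// => f g /ffunP h; apply/ffunP => i; apply: val_inj.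
by have := h i; rewrite !ffunE => -[] /addnI.
Qed.

Lemma size_Ibox k : size (Ibox k) = ((2 ^ k) ^ d)%N.
Proof. by rewrite size_map -cardT card_ffun !card_ord. Qed.

Lemma IboxP k m : m \in Ibox k -> forall i, exists n : nat, [/\ m i = n%:Z, (2 ^ k <= n)%N & (n < 2 ^ k.+1)%N].
Proof.
move=> /mapP[f _ ->] i; exists (2 ^ k + f i)%N; rewrite ffunE leq_addr; split => //.
by rewrite expnS mul2n -addnn ltn_add2l.
Qed.

Lemma Ibox_supn_ge k m : m \in Ibox k -> (2 ^ k <= supn m)%N.
Proof.
move=> /IboxP/(_ (Ordinal d0))[n [e n1 _]]; apply: leq_trans n1 _.
by have := leq_supn m (Ordinal d0); rewrite e absz_nat.
Qed.

Lemma Ibox_supn_lt k m : m \in Ibox k -> (supn m <= 2 ^ k.+1)%N.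
Proof.
move=> hm; apply/supn_leP => i; have [n [-> _ n2]] := IboxP hm i.
by rewrite absz_nat ltnW.
Qed.

Lemma Ibox_neq0 k m : m \in Ibox k -> m != 0.
Proof. by move/Ibox_supn_ge => h; rewrite -supn_gt0 (leq_trans _ h)// expn_gt0. Qed.

Lemma Ibox_cls_inj k l : (1 <= l)%N -> {in Ibox k &, injective (cls (k + l))}.
Proof.
move=> l1 m m' hm hm' /eqP/clsP h; apply/ffunP => i.
have [n [e n1 n2]] := IboxP hm i; have [n' [e' n1' n2']] := IboxP hm' i.
have := h i; rewrite e e' => /dvdzP[z hz].
have kl : (2 ^ k.+1 <= 2 ^ (k + l))%N by rewrite leq_exp2l// -addn1 leq_add2l.
by congr Posz; apply: (small_residues_eq hz); apply: leq_trans kl.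
Qed.

(** With [l >= 2] the coordinates, which lie below 2^(k+1), are at most half of 2^(k+l): each
    frequency of the box is the smallest in its class. *)
Lemma Ibox_cent k l m : (2 <= l)%N -> m \in Ibox k -> cent (cls (k + l) m) = m.
Proof.
move=> l2 hm; apply/ffunP => i; rewrite !ffunE /=.
have [n [-> n1 n2]] := IboxP hm i.
have kl : (2 ^ k.+2 <= 2 ^ (k + l))%N by rewrite leq_exp2l// -addn2 leq_add2l.
have kk : (2 ^ k.+2 = (2 ^ k.+1).*2)%N by rewrite expnS mul2n.
rewrite modz_small ?absz_nat; first by rewrite ifT//; lia.
by apply/andP; split => //; rewrite ltz_nat; lia.
Qed.

Lemma Ibox_small k l m : (2 <= l)%N -> m \in Ibox k -> ((supn m).*2 <= 2 ^ (k + l))%N.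
Proof.
move=> l2 /Ibox_supn_lt h.
have kl : (2 ^ k.+2 <= 2 ^ (k + l))%N by rewrite leq_exp2l// -addn2 leq_add2l.
have kk : (2 ^ k.+2 = (2 ^ k.+1).*2)%N by rewrite expnS mul2n.
by lia.
Qed.

End inner_box.

(** * A positive proportion of good frequencies *)

Section good_points.
Context {R : realType} {d : nat} {dom : measure_display} {Omega : measurableType dom}
  (P : probability Omega R) (xi : lattice d -> {RV P >-> R}).
Hypothesis d0 : (0 < d)%N.
Hypothesis xi_normal : forall m : lattice d, m != 0 -> forall A : set R, measurable A ->
     distribution P (xi m) A = normal_prob 0 1 A.
Hypothesis xi_indep : forall (F : seq (lattice d)) (B : lattice d -> set R),
     uniq F -> (forall m, m \in F -> m != 0) -> (forall m, measurable (B m)) ->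
     P [set w | forall m, m \in F -> B m (xi m w)]
     = \big[*%E/1%E]_(m <- F) P (xi m @^-1` B m).
Variables (a T Z s : R).
Hypotheses (a0 : 0 <= a) (da : d%:R < 2 * a).
Hypothesis HZ : forall N, boxsum N (pnorm (2 * a) : lattice d -> R) <= Z.
Hypotheses (as_ : a <= s) (sT : s <= T).

Local Notation nonzero := (fun m : lattice d => m != 0).
Local Notation Tc := (Tc xi).
Local Notation Vc := (Vc xi).
Local Notation Cup := (Cup T Z).
Local Notation clo := (clo d T).

(** The standard deviation of the Fourier coefficient of frequency [m]. *)
Definition amp (m : lattice d) : R := wt (s / 2) m.

Lemma s_ge0 : 0 <= s. Proof. exact: le_trans as_. Qed.

Lemma d_lt_2s : d%:R < 2 * s.
Proof. by apply: lt_le_trans da _; rewrite ler_wpM2l. Qed.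

Lemma amp_sqr m : amp m ^+ 2 = wt s m.
Proof.
rewrite /amp /wt; case: eqVneq => [_|m0]; first by rewrite expr0n.
have l0 := lam_gt0 R d0 m0.
by rewrite -powR_mulrn ?powR_ge0// -powRrM; congr (_ `^ _); field.
Qed.

Lemma amp_ge0 m : 0 <= amp m. Proof. exact: wt_ge0. Qed.

Lemma amp_gt0 m : m != 0 -> 0 < amp m.
Proof. by move=> m0; rewrite /amp /wt (negbTE m0) powR_gt0// lam_gt0. Qed.

Lemma uhatE x m : uhat s x m = amp m * x m.
Proof. by rewrite /uhat /amp /wt; case: ifP => _; rewrite ?mul0r// mulNr. Qed.

Lemma restr_amp_le D m : `|restr D amp m| <= 1 * pnorm s m.
Proof.
rewrite mul1r /restr; case: ifP => _; last by rewrite normr0 pnorm_ge0.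
rewrite ger0_norm ?amp_ge0//; have -> : s = 2 * (s / 2) by field.
by apply: wt_le_pnorm => //; rewrite divr_ge0// s_ge0.
Qed.

Lemma restr_amp_sqr D : (fun m => restr D amp m ^+ 2) = restr D (wt s).
Proof. by apply/funext => m; rewrite /restr; case: ifP => _; rewrite ?amp_sqr// expr0n. Qed.

Lemma boxsum_restr_amp_sqr D n : boxsum n (fun m => restr D amp m ^+ 2) <= latsum (restr D (wt s)).
Proof.
rewrite restr_amp_sqr; apply: boxsum_le_latsum.
  by apply: restr_ge0 => m; exact: wt_ge0.
exact: (cvg_wt_restr d0 a0 HZ).
Qed.

Lemma restr_uhat D w : restr D (uhat s (fun m => xi m w)) = (fun m => restr D amp m * xi m w).
Proof. by apply/funext => m; rewrite /restr; case: ifP => _; rewrite ?uhatE// mul0r. Qed.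

Lemma Uq_Vc q (r : Jq d q) w :
  Uq s (fun m => xi m w) r = Vc (restr (fun m => cls q m == r) amp) w.
Proof. by rewrite /Uq /clsum restr_uhat. Qed.

Lemma cvg_classes_Tc q w :
  (forall r : Jq d q, cvgn (fun n => Tc (restr (fun m => cls q m == r) amp) n w)) ->
  cvg_classes q (uhat s (fun m => xi m w)).
Proof. by move=> h r; rewrite restr_uhat; exact: h. Qed.

(** The aliasing perturbation: the other frequencies that the grid cannot tell from [m]. *)
Definition restc q (m : lattice d) : lattice d -> R :=
  restr (fun m' => (cls q m' == cls q m) && (m' != m)) amp.

Lemma Uq_split q m w : cvgn (fun n => Tc (restc q m) n w) ->
  cvgn (fun n => Tc (restr (fun m' => cls q m' == cls q m) amp) n w) /\
  Uq s (fun m => xi m w) (cls q m) = amp m * xi m w + Vc (restc q m) w.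
Proof.
move=> cr.
have e n : (supn m <= n)%N -> Tc (restr (fun m' => cls q m' == cls q m) amp) n w =
    amp m * xi m w + Tc (restc q m) n w.
  move=> mn; rewrite /Tc !boxsumE.
  rewrite (bigD1_seq m) ?uniq_boxseq ?mem_boxseq//= {1}/restr eqxx; congr (_ + _).
  have rc0 : restc q m m = 0 by rewrite /restc /restr !eqxx.
  rewrite [RHS](bigD1_seq m) ?uniq_boxseq ?mem_boxseq//= rc0 mul0r add0r.
  by apply: eq_bigr => m' mm'; rewrite /restc /restr mm' andbT.
have h : (fun n => Tc (restr (fun m' => cls q m' == cls q m) amp) n w) @ \oo -->
    amp m * xi m w + Vc (restc q m) w.
  apply: (@cvg_trans _ ((fun n => amp m * xi m w + Tc (restc q m) n w) @ \oo)).
    by apply: near_eq_cvg; exists (supn m) => // n /= mn; rewrite e.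
  by apply: cvgD; [exact: cvg_cst|exact: cr].
split; first by apply/cvg_ex; eexists; exact: h.
by rewrite Uq_Vc /Vc; apply/cvg_lim.
Qed.

Lemma opposite_norm (G : lattice d -> set Omega) m w : opposite xi G m w -> 1 <= `|xi m w|.
Proof.
by rewrite /opposite /= => -[[]|[]]; rewrite /= in_itv/= ?andbT => h _;
  [rewrite (le_trans h)// ler_norm|rewrite -normrN (le_trans _ (ler_norm _))// lerNr].
Qed.

Let tp := @tail_prob R.

(** At least [tp * n / 2] sign events occur, and at most [tp * n / 4] frequencies have an aliasing
    term above half their amplitude. The probability of the second failure decays in [l], that of
    the first in [k]. *)
Lemma good_points_bound (k l : nat) (G : lattice d -> set Omega) : (2 <= l)%N ->
  (forall m, <<s outside nonzero xi (fun m => m \in Ibox d k) >> (G m)) ->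
  exists A : set Omega, [/\ measurable A,
    (P A <= (16 * xi_var xi_normal * Cup * 2 `^ (2 * s) / (clo * tp) * Nq R l `^ (- (2 * s))
       + 4 / tp ^+ 2 * Nq R k `^ (- d%:R))%:E)%E &
    forall w, ~ A w -> exists g : seq (lattice d), [/\ uniq g, {subset g <= Ibox d k},
      tp / 4 * Nq R k `^ d%:R <= (size g)%:R &
      forall m, m \in g -> [/\ opposite xi G m w, cvgn (fun n => Tc (restc (k + l) m) n w) &
         `|Vc (restc (k + l) m) w| <= amp m / 2]]].
Proof.
move=> l2 hG.
have tp0 : 0 < tp by exact: tail_prob_gt0.
have M0 := Nq_gt0 R k.
have c0 : 0 < clo by exact: clo_gt0.
have n0 : (0 < size (Ibox d k))%N by rewrite size_Ibox !expn_gt0.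
have nE : (size (Ibox d k))%:R = Nq R k `^ d%:R by rewrite size_Ibox natrX powR_mulrn// ltW.
have [A1 [mA1 PA1 HA1]] := opposite_count xi_normal xi_indep hG (uniq_Ibox d k) n0
  (fun m => erefl) (@Ibox_neq0 d d0 k).
(* Chosen so that [wgt * (amp m / 2) ^+ 2] is at least 1 on the box: the weighted sum of squares
   then bounds the number of badly aliased frequencies. *)
pose wgt := 4 * (2 * Nq R k) `^ (2 * s) / clo.
have wgt0 : 0 <= wgt by rewrite divr_ge0 ?(ltW c0)// mulr_ge0// powR_ge0.
pose sig := Cup * Nq R (k + l) `^ (- (2 * s)).
pose n := Nq R k `^ d%:R.
have n_gt0 : 0 < n by rewrite powR_gt0.
have hsig m N : m \in Ibox d k -> boxsum N (fun m' => restc (k + l) m m' ^+ 2) <= sig.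
  move=> hm; apply: le_trans (boxsum_restr_amp_sqr _ N) _.
  by apply: (latsum_wt_tail_le d0 a0 HZ) => //; exact: Ibox_small.
have hE : \sum_(m <- Ibox d k) wgt * sig <= n * (wgt * sig).
  by rewrite big_const_seq count_predT iter_addr addr0 -mulr_natl nE.
have hK : 0 < tp * n / 4 by rewrite divr_gt0// mulr_gt0.
have [A2 [mA2 PA2 HA2]] := @sum_sqr_Vc_le _ _ _ _ _ xi d0 xi_normal xi_indep _ (Ibox d k)
  (restc (k + l)) (fun=> wgt) (fun=> sig) s 1 (tp * n / 4) (n * (wgt * sig)) d_lt_2s
  (fun i m => restr_amp_le _ m) (fun=> wgt0) hsig hE hK.
exists (A1 `|` A2); split.
+ exact: measurableU.
+ apply: le_trans (measureU2 _ mA1 mA2) _; apply: (le_trans (leeD PA1 PA2)).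
  rewrite -EFinD lee_fin addrC; apply: lerD.
    rewrite le_eqVlt; apply/orP; left; apply/eqP.
    rewrite /wgt /sig /Nq expnD natrM -!/(Nq R _) !powRM ?(ltW M0) ?(ltW (Nq_gt0 R l))//.
    rewrite !powRN.
    have h1 := gt_eqF n_gt0; have h2 : Nq R k `^ (2 * s) != 0 by rewrite gt_eqF// powR_gt0.
    have h3 : Nq R l `^ (2 * s) != 0 by rewrite gt_eqF// powR_gt0// Nq_gt0.
    by field; rewrite h2 h3 h1 !gt_eqF.
  rewrite nE le_eqVlt; apply/orP; left; apply/eqP; rewrite powRN.
  by rewrite -/tp -/n; field; rewrite !gt_eqF.
+ move=> w nA.
  have {}HA1 := HA1 w (fun h => nA (or_introl h)).
  have [cv HV] := HA2 w (fun h => nA (or_intror h)).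
  pose good m := `[< opposite xi G m w >] && (`|Vc (restc (k + l) m) w| <= amp m / 2).
  exists [seq m <- Ibox d k | good m]; split.
  * by rewrite filter_uniq// uniq_Ibox.
  * by move=> m; rewrite mem_filter => /andP[].
  * have h1 : \sum_(m <- Ibox d k) \1_(opposite xi G m) w <=
        \sum_(m <- Ibox d k) ((good m)%:R + wgt * Vc (restc (k + l) m) w ^+ 2) :> R.
      rewrite big_seq [leRHS]big_seq; apply: ler_sum => m hm.
      rewrite indicE /good; case: (boolP (`|Vc _ w| <= _)) => hV.
        rewrite andbT; have -> : (w \in opposite xi G m) = `[< opposite xi G m w >].
          by apply/idP/asboolP; rewrite inE.
        by rewrite lerDl mulr_ge0// sqr_ge0.
      rewrite andbF add0r; apply: (@le_trans _ _ 1); first by case: (_ \in _).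
      move: hV; rewrite -ltNge => hV.
      have m0 := Ibox_neq0 d0 hm; have am0 := amp_gt0 m0.
      have hw : clo <= (2 * Nq R k) `^ (2 * s) * amp m ^+ 2.
        rewrite amp_sqr; apply: le_trans (ler_wpM2l _ (clo_le_wt d0 a0 as_ sT m0)); last exact: powR_ge0.
        have -> : (2 * Nq R k) `^ (2 * s) * (clo * supR R m `^ (- (2 * s))) =
           clo * ((2 * Nq R k) `^ (2 * s) * supR R m `^ (- (2 * s))) by ring.
        rewrite ler_pMr// powRN ler_pdivlMr ?powR_gt0// ?mul1r; last first.
          by apply: lt_le_trans (supR_ge1 R m0).
        apply: ge0_ler_powR; rewrite ?nnegrE ?mulr_ge0 ?s_ge0 ?(ltW M0)//.
        by rewrite -NqS /supR /Nq ler_nat Ibox_supn_lt.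
      have hV2 : amp m ^+ 2 / 4 <= Vc (restc (k + l) m) w ^+ 2.
        rewrite -[leRHS]real_normK ?num_real//.
        have -> : amp m ^+ 2 / 4 = (amp m / 2) ^+ 2 by field.
        rewrite lerXn2r ?nnegrE ?divr_ge0 ?(ltW am0)//; exact: ltW.
      apply: (@le_trans _ _ (wgt * (amp m ^+ 2 / 4))); last by rewrite ler_wpM2l.
      have -> : wgt * (amp m ^+ 2 / 4) = (2 * Nq R k) `^ (2 * s) * amp m ^+ 2 / clo.
        by rewrite /wgt; field; rewrite gt_eqF.
      by rewrite ler_pdivlMr// mul1r.
    rewrite big_split/= in h1.
    have h2 : \sum_(m <- Ibox d k) (good m)%:R = (size [seq m <- Ibox d k | good m])%:R :> R.
      by rewrite size_filter -sum1_count natr_sum [RHS]big_mkcond/=; apply: eq_bigr => m _; case: (good m).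
    rewrite h2 in h1; rewrite -/n.
    have := le_trans HA1 h1; rewrite nE -/n => h3.
    have := le_trans h3 (lerD (lexx _) HV).
    by rewrite -/tp; lra.
  * move=> m; rewrite mem_filter => /andP[/andP[/asboolP h1 h2] h3]; split => //.
    exact: cv.
Qed.

(** [l] is chosen first, against aliasing, then [k0], against the fluctuation of the signs. [G]
    comes last because for kernel flow it depends on [k] and [l]. *)
Lemma good_points (eta : R) : 0 < eta -> exists l k0, (2 <= l)%N /\ forall k, (k0 <= k)%N ->
  forall G : lattice d -> set Omega,
  (forall m, <<s outside nonzero xi (fun m => m \in Ibox d k) >> (G m)) ->
  exists A : set Omega, [/\ measurable A, (P A <= eta%:E)%E &
    forall w, ~ A w -> exists g : seq (lattice d), [/\ uniq g, {subset g <= Ibox d k},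
      tp / 4 * Nq R k `^ d%:R <= (size g)%:R &
      forall m, m \in g -> [/\ opposite xi G m w, cvgn (fun n => Tc (restc (k + l) m) n w) &
         `|Vc (restc (k + l) m) w| <= amp m / 2]]].
Proof.
move=> eta0.
have small (C g : R) : 0 <= C -> 0 < g -> exists k0, forall k, (k0 <= k)%N ->
    C * Nq R k `^ (- g) <= eta / 2.
  move=> C0 g0; have [k0 hk] := Nq_powR_large (C / (eta / 2)) g0; exists k0 => k /hk h.
  rewrite powRN ler_pdivrMr ?powR_gt0 ?Nq_gt0// mulrC -ler_pdivrMr ?divr_gt0//.
  exact: ltW.
have tp0 : 0 < tp by exact: tail_prob_gt0.
have dR : 0 < d%:R :> R by rewrite ltr0n.
have s2 : 0 < 2 * s by apply: lt_trans d_lt_2s.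
have [l hl] := small (16 * xi_var xi_normal * Cup * 2 `^ (2 * s) / (clo * tp)) (2 * s)
  ltac:(rewrite divr_ge0 ?mulr_ge0 ?(ltW tp0) ?(ltW (clo_gt0 R d0 _)) ?(ltW (xi_var_gt0 _)) ?powR_ge0// (le_trans ler01)// (Cup_ge1 _ HZ)//) s2.
have [k0 hk0] := small (4 / tp ^+ 2) d%:R ltac:(rewrite divr_ge0// exprn_ge0// ltW//) dR.
exists (maxn 2 l), k0; rewrite leq_maxl; split => // k kk G hG.
have [A [mA PA HA]] := good_points_bound (leq_maxl 2 l) hG.
exists A; split => //; apply: le_trans PA _; rewrite lee_fin.
by have := hl _ (leq_maxr 2 l); have := hk0 _ kk; lra.
Qed.

End good_points.

(** * Empirical Bayes *)

Lemma EB_diff_arith (R : realType) (D1 D2 S1 S2 X c lC n kap : R) :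
  D2 <= kap * n -> n * - lC + X <= S1 - S2 -> D1 + S1 + c <= D2 + S2 + c ->
  D1 + X <= (kap + lC) * n.
Proof. by lra. Qed.

Lemma ln_diff_arith (R : realType) (A1 A2 H c1 c2 s t : R) :
  c1 - 2 * t * H <= A1 -> A2 <= c2 - 2 * s * H ->
  - (c2 - c1) + 2 * (s - t) * H <= A1 - A2.
Proof. by lra. Qed.

Lemma sum_image_le (R : realType) (I : eqType) (J : finType) (h : I -> J) (g : seq I)
    (f : J -> R) : uniq g -> {in g &, injective h} -> (forall r, 0 <= f r) ->
  \sum_(m <- g) f (h m) <= \sum_r f r.
Proof.
move=> ug inj f0; apply: (@sum_inj_le _ _ _ _ _ h) => //; first exact: index_enum_uniq.
by move=> m m' hm hm' _ _; exact: inj.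
Qed.

Section deterministic_bounds.
Variables (R : realType) (d : nat).
Hypothesis d0 : (0 < d)%N.
Variables (a T Z : R).
Hypotheses (a0 : 0 <= a).
Hypothesis HZ : forall N, boxsum N (pnorm (2 * a) : lattice d -> R) <= Z.
Local Notation Cup := (Cup T Z).
Local Notation clo := (clo d T).

Lemma Cup_gt0 : 0 < Cup.
Proof. by apply: lt_le_trans (Cup_ge1 T HZ). Qed.

Definition logC : R := ln Cup - ln clo.

Lemma logC_ge0 : 0 <= T -> 0 <= logC.
Proof.
move=> T0; rewrite subr_ge0 ler_ln ?posrE ?Cup_gt0 ?clo_gt0//.
apply: le_trans (Cup_ge1 T HZ); rewrite /clo -[leRHS](powRr0 (lamC R d)).
by apply: ler_powR; rewrite ?lamC_ge1// oppr_le0.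
Qed.

(** Up to constants independent of [r], [ln (At t r)] is - 2 t times the logarithm of [Hq R r]. *)
Lemma ln_At_diff t s q (r : Jq d q) : a <= t -> t <= T -> a <= s -> s <= T ->
  - logC + 2 * (s - t) * ln (Hq R r) <= ln (At t r) - ln (At s r).
Proof.
move=> at_ tT as_ sT.
have H0 := Hq_gt0 R r.
have pw t' : 0 < Hq R r `^ (- (2 * t')) by rewrite powR_gt0.
have h1 : ln clo - 2 * t * ln (Hq R r) <= ln (At t r).
  have -> : ln clo - 2 * t * ln (Hq R r) = ln (clo * Hq R r `^ (- (2 * t))).
    by rewrite lnM ?posrE ?clo_gt0// ln_powR mulNr.
  by rewrite ler_ln ?posrE ?mulr_gt0 ?clo_gt0 ?(At_gt0 d0 a0 HZ _ at_ tT)//; exact: (At_lower d0 a0 HZ).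
have h2 : ln (At s r) <= ln Cup - 2 * s * ln (Hq R r).
  have -> : ln Cup - 2 * s * ln (Hq R r) = ln (Cup * Hq R r `^ (- (2 * s))).
    by rewrite lnM ?posrE ?Cup_gt0// ln_powR mulNr.
  by rewrite ler_ln ?posrE ?mulr_gt0 ?Cup_gt0 ?(At_gt0 d0 a0 HZ _ as_ sT)//; exact: (At_upper d0 a0 HZ).
exact: ln_diff_arith h1 h2.
Qed.

Definition nq q : R := Nq R q `^ d%:R.

Lemma nqE q : nq q = #|{: Jq d q}|%:R.
Proof. by rewrite /nq /Nq card_ffun !card_ord powR_mulrn// -natrX. Qed.

Lemma sum_const_Jq q (c : R) : \sum_(r : Jq d q) c = nq q * c.
Proof. by rewrite sumr_const nqE mulr_natl. Qed.

Lemma nqD k l : nq (k + l) = nq k * nq l.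
Proof. by rewrite /nq /Nq expnD natrM powRM. Qed.

Lemma den_ge0 s (x : lattice d -> R) t q : a <= t -> t <= T -> 0 <= den s x t q.
Proof.
move=> at_ tT; apply: sumr_ge0 => r _.
by rewrite divr_ge0 ?sqr_ge0// ltW// (At_gt0 d0 a0 HZ _ at_ tT).
Qed.

Section empirical_bayes.
Variables (s : R) (x : lattice d -> R) (k l : nat) (g : seq (lattice d)) (tp kap : R).
Hypotheses (as_ : a <= s) (sT : s <= T) (l2 : (2 <= l)%N) (tp0 : 0 < tp).
Let q := (k + l)%N.
Hypothesis cu : cvg_classes q (uhat s x).
Hypothesis Hden : den s x s q <= kap * nq q.
Hypotheses (ug : uniq g) (gI : {subset g <= Ibox d k}) (gn : tp / 4 * nq k <= (size g)%:R).
Hypothesis gU : forall m, m \in g -> amp s m / 2 <= `|Uq s x (cls q m)|.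

Let cw t (at_ : a <= t) : cvg_classes q (wt t : lattice d -> R).
Proof. by move=> r; exact: (cvg_wt_restr d0 a0 HZ). Qed.

(** The determinant of the Fourier matrices is the same at [t] and [s] and cancels, and the data
    term at [s] is at most [kap * nq q]. *)
Lemma EB_diff t : a <= t -> t <= T -> EB_obj s x q t <= EB_obj s x q s ->
  den s x t q + \sum_(r : Jq d q) (2 * (s - t) * ln (Hq R r)) <= (kap + logC) * nq q.
Proof.
move=> at_ tT.
rewrite (EB_objE (cw at_) (fun r => At_gt0 d0 a0 HZ r at_ tT) cu).
rewrite (EB_objE (cw as_) (fun r => At_gt0 d0 a0 HZ r as_ sT) cu).
have h : \sum_(r : Jq d q) (- logC + 2 * (s - t) * ln (Hq R r)) <=
    \sum_(r : Jq d q) (ln (At t r) - ln (At s r)).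
  by apply: ler_sum => r _; exact: ln_At_diff.
move: h; rewrite sumrB big_split/= sum_const_Jq => h1 h2.
exact: (EB_diff_arith Hden h1 h2).
Qed.

(** At a good frequency m the squared class sum is at least of order |m|^(-2s), while the eigenvalue
    is at most of order |m|^(-2t). *)
Lemma den_good_ge t : s <= t -> t <= T ->
  tp * clo / (16 * Cup) * nq k * Nq R k `^ (2 * (t - s)) <= den s x t q.
Proof.
move=> st tT; have at_ : a <= t by exact: le_trans st.
have At0 (r : Jq d q) : 0 < At t r by exact: (At_gt0 d0 a0 HZ).
apply: le_trans (@sum_image_le _ _ _ (cls q) g (fun r => Uq s x r ^+ 2 / At t r) ug _ _); last 2 first.
- by move=> m m' /gI hm /gI hm'; apply: Ibox_cls_inj => //; exact: ltnW.
- by move=> r; rewrite divr_ge0 ?sqr_ge0 ?ltW.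
apply: (@le_trans _ _ (\sum_(m <- g) clo / (4 * Cup) * Nq R k `^ (2 * (t - s)))).
  rewrite big_const_seq count_predT iter_addr addr0 -[_ *+ size g]mulr_natr.
  have C0 := Cup_gt0; have c0 := clo_gt0 d0 T.
  have p0 : 0 <= Nq R k `^ (2 * (t - s)) by exact: powR_ge0.
  have -> : tp * clo / (16 * Cup) * nq k * Nq R k `^ (2 * (t - s)) =
    (clo / (4 * Cup) * Nq R k `^ (2 * (t - s))) * (tp / 4 * nq k) by field; rewrite gt_eqF.
  by rewrite ler_wpM2l// mulr_ge0// divr_ge0 ?(ltW c0)// mulr_ge0// ltW.
rewrite big_seq [leRHS]big_seq; apply: ler_sum => m hm.
have hI := gI hm; have m0 := Ibox_neq0 d0 hI.
have s1 := supR_ge1 R m0; have s0 : 0 < supR R m by apply: lt_le_trans s1.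
have MS : Nq R k <= supR R m by rewrite /Nq /supR ler_nat Ibox_supn_ge.
have hH : Hq R (cls q m) = supR R m by rewrite /Hq Ibox_cent// (negbTE m0).
have hA : At t (cls q m) <= Cup * supR R m `^ (- (2 * t)).
  by rewrite -hH; exact: (At_upper d0 a0 HZ).
have hU : clo * supR R m `^ (- (2 * s)) / 4 <= Uq s x (cls q m) ^+ 2.
  apply: (@le_trans _ _ ((amp s m / 2) ^+ 2)).
    have -> : (amp s m / 2) ^+ 2 = amp s m ^+ 2 / 4 by field.
    by rewrite ler_pM2r ?invr_gt0// (amp_sqr d0 s); exact: (clo_le_wt d0 a0).
  rewrite -[leRHS]real_normK ?num_real// lerXn2r ?nnegrE ?gU// divr_ge0//; exact: wt_ge0.
rewrite ler_pdivlMr//; apply: le_trans hU.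
apply: (@le_trans _ _ (clo / (4 * Cup) * supR R m `^ (2 * (t - s)) * (Cup * supR R m `^ (- (2 * t))))).
  apply: ler_pM => //; rewrite ?mulr_ge0 ?powR_ge0 ?invr_ge0 ?(ltW (clo_gt0 d0 T)) ?mulr_ge0 ?(ltW Cup_gt0)//.
  - exact: ltW.
  rewrite ler_wpM2l ?divr_ge0 ?(ltW (clo_gt0 d0 T)) ?mulr_ge0 ?(ltW Cup_gt0)//.
  by apply: ge0_ler_powR; rewrite ?nnegrE ?(ltW (Nq_gt0 R k)) ?(ltW s0)// mulr_ge0// subr_ge0.
rewrite le_eqVlt; apply/orP; left; apply/eqP.
have -> : - (2 * s) = 2 * (t - s) + - (2 * t) by ring.
by rewrite powRDp//; field; rewrite gt_eqF// Cup_gt0.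
Qed.

(** Only the classes of the inner box are kept; the other logarithms are nonnegative. *)
Lemma sum_ln_Hq_ge : nq k * ln (Nq R k) <= \sum_(r : Jq d q) ln (Hq R r).
Proof.
apply: le_trans (@sum_image_le _ _ _ (cls q) (Ibox d k) (fun r => ln (Hq R r)) (uniq_Ibox d k) _ _); last 2 first.
- by apply: Ibox_cls_inj; exact: ltnW.
- by move=> r; rewrite ln_ge0// Hq_ge1.
have -> : nq k * ln (Nq R k) = \sum_(m <- Ibox d k) ln (Nq R k).
  rewrite big_const_seq count_predT iter_addr addr0 -mulr_natl size_Ibox.
  by rewrite /nq powR_mulrn ?ler0n// natrX.
rewrite big_seq [leRHS]big_seq; apply: ler_sum => m hm.
have m0 := Ibox_neq0 d0 hm.
have -> : Hq R (cls q m) = supR R m by rewrite /Hq Ibox_cent// (negbTE m0).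
rewrite ler_ln ?posrE ?Nq_gt0//; last by apply: lt_le_trans (supR_ge1 R m0).
by rewrite /Nq /supR ler_nat Ibox_supn_ge.
Qed.

Lemma EB_not_above (t eps : R) : 0 < eps -> s + eps < t -> t <= T -> 0 <= kap ->
  nq l * (kap + logC + 2 * T * ln (Nq R l) + 2 * T / eps) / (tp * clo / (16 * Cup)) < Nq R k `^ eps ->
  EB_obj s x q t <= EB_obj s x q s -> False.
Proof.
move=> e0 st tT kap0 Hk /EB_diff; have s_t : s <= t by lra.
have at_ : a <= t by exact: le_trans s_t.
move=> /(_ at_ tT) h.
have s0 : 0 <= s by exact: le_trans as_.
have T0 : 0 <= T by apply: le_trans sT.
have M1 := Nq_ge1 R k; have M0 := Nq_gt0 R k.
have L0 := Nq_gt0 R l.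
have hq : Nq R q = Nq R k * Nq R l by rewrite /q /Nq expnD natrM.
have lnM0 : 0 <= ln (Nq R k) by rewrite ln_ge0.
have lnL0 : 0 <= ln (Nq R l) by rewrite ln_ge0 ?Nq_ge1.
have h2 : - (2 * T * (ln (Nq R k) + ln (Nq R l)) * nq q) <=
    \sum_(r : Jq d q) (2 * (s - t) * ln (Hq R r)).
  rewrite -mulNr mulrC -sum_const_Jq; apply: ler_sum => r _.
  have lH : ln (Hq R r) <= ln (Nq R k) + ln (Nq R l).
    by rewrite -lnM ?posrE// -hq ler_ln ?posrE ?Hq_gt0 ?Nq_gt0// Hq_le.
  have lH0 : 0 <= ln (Hq R r) by rewrite ln_ge0// Hq_ge1.
  have : (t - s) * ln (Hq R r) <= T * (ln (Nq R k) + ln (Nq R l)).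
    by apply: ler_pM => //; lra.
  by nra.
have h3 := den_good_ge s_t tT.
set c2 := tp * clo / (16 * Cup) in h3 Hk.
have c20 : 0 < c2 by rewrite /c2 divr_gt0 ?mulr_gt0 ?clo_gt0 ?Cup_gt0.
(* The data term grows at least like M^2, whereas ln N_k <= M / eps makes the gain of the
   determinant at most linear in M. *)
set M := Nq R k `^ eps in Hk.
have ME1 : 1 <= M by rewrite /M -[leLHS](powRr0 (Nq R k)); apply: ler_powR => //; exact: ltW.
have h4 : M * M <= Nq R k `^ (2 * (t - s)).
  by rewrite /M -powRDp//; apply: ler_powR => //; lra.
have h5 : ln (Nq R k) <= M / eps.
  rewrite ler_pdivlMr//; have -> : M = expR (eps * ln (Nq R k)) by rewrite /M /powR gt_eqF.
  by apply: le_trans (expR_ge1Dx _); lra.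
have nk0 : 0 < nq k by rewrite powR_gt0.
have nl0 : 0 < nq l by rewrite powR_gt0.
rewrite ltr_pdivrMr// in Hk.
have h6 : c2 * nq k * (M * M) <= (kap + logC + 2 * T * (ln (Nq R k) + ln (Nq R l))) * nq q.
  have : c2 * nq k * (M * M) <= c2 * nq k * Nq R k `^ (2 * (t - s)).
    by rewrite ler_wpM2l// ltW// mulr_gt0.
  by move: h h2 h3; lra.
have h7 : c2 * (M * M) <= (kap + logC + 2 * T * (ln (Nq R k) + ln (Nq R l))) * nq l.
  rewrite -(ler_pM2r nk0); move: h6; rewrite /q nqD.
  set X := kap + logC + _; have -> : c2 * (M * M) * nq k = c2 * nq k * (M * M) by ring.
  by have -> : X * nq l * nq k = X * (nq k * nq l) by ring.
have lC := logC_ge0 T0.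
set B := kap + logC + 2 * T * ln (Nq R l).
have B0 : 0 <= B by rewrite /B; apply: addr_ge0; [exact: addr_ge0|rewrite mulr_ge0// mulr_ge0].
have h8 : kap + logC + 2 * T * (ln (Nq R k) + ln (Nq R l)) <= (B + 2 * T / eps) * M.
  have b1 : B <= B * M by rewrite ler_peMr.
  have b2 : 2 * T * ln (Nq R k) <= 2 * T / eps * M.
    have -> : 2 * T / eps * M = 2 * T * (M / eps) by field; rewrite gt_eqF.
    by rewrite ler_wpM2l// mulr_ge0.
  by rewrite /B in b1 *; lra.
have h9 : c2 * (M * M) <= (B + 2 * T / eps) * M * nq l.
  by apply: (le_trans h7); rewrite ler_wpM2r// ltW.
have : nq l * (B + 2 * T / eps) * M < c2 * (M * M).
  have -> : c2 * (M * M) = M * c2 * M by ring.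
  by rewrite ltr_pM2r//; exact: lt_le_trans ME1.
by move=> h10; have := lt_le_trans h10 h9; rewrite -mulrA mulrC ltxx.
Qed.

(** The data term at [t] is only used to be nonnegative: the loss of the determinant alone exceeds
    the bound of [EB_diff], by a logarithm. *)
Lemma EB_not_below (t eps : R) : 0 < eps -> a <= t -> t < s - eps -> 0 <= kap ->
  expR (nq l * (kap + logC) / (2 * eps)) < Nq R k ->
  EB_obj s x q t <= EB_obj s x q s -> False.
Proof.
move=> e0 at_ ts kap0 Hk /EB_diff; have tT : t <= T.
  by apply: le_trans sT; apply/ltW/(lt_trans ts); rewrite ltrBlDr ltrDl.
move=> /(_ at_ tT); have d_ge0 := den_ge0 s x q at_ tT => h.
have M0 := Nq_gt0 R k.
have hl : nq l * (kap + logC) / (2 * eps) < ln (Nq R k) by rewrite -ltr_expR lnK.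
have h1 : 2 * eps * (nq k * ln (Nq R k)) <= \sum_(r : Jq d q) (2 * (s - t) * ln (Hq R r)).
  rewrite -mulr_sumr; apply: ler_pM; rewrite ?sum_ln_Hq_ge//.
  - by rewrite mulr_ge0// ltW.
  - by rewrite mulr_ge0 ?powR_ge0// ln_ge0 ?Nq_ge1.
  - by lra.
have nk0 : 0 < nq k by rewrite powR_gt0.
move: hl; rewrite ltr_pdivrMr ?mulr_gt0// => hl.
have h2 : nq k * (nq l * (kap + logC)) < nq k * (ln (Nq R k) * (2 * eps)) by rewrite ltr_pM2l.
move: h; rewrite /q nqD -/q => h.
have e1 : nq k * (nq l * (kap + logC)) = (kap + logC) * (nq k * nq l) by ring.
have e2 : nq k * (ln (Nq R k) * (2 * eps)) = 2 * eps * (nq k * ln (Nq R k)) by ring.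
by rewrite e1 e2 in h2; lra.
Qed.

End empirical_bayes.

End deterministic_bounds.

(** * Convergence of the empirical Bayes estimate *)

Section consistency.
Context {R : realType} {d : nat} {dom : measure_display} {Omega : measurableType dom}
  (P : probability Omega R) (xi : lattice d -> {RV P >-> R}).
Hypothesis d0 : (0 < d)%N.
Hypothesis xi_normal : forall m : lattice d, m != 0 -> forall A : set R, measurable A ->
     distribution P (xi m) A = normal_prob 0 1 A.
Hypothesis xi_indep : forall (F : seq (lattice d)) (B : lattice d -> set R),
     uniq F -> (forall m, m \in F -> m != 0) -> (forall m, measurable (B m)) ->
     P [set w | forall m, m \in F -> B m (xi m w)]
     = \big[*%E/1%E]_(m <- F) P (xi m @^-1` B m).
Variables (a T Z s : R).
Hypotheses (a0 : 0 <= a) (da : d%:R < 2 * a).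
Hypothesis HZ : forall N, boxsum N (pnorm (2 * a) : lattice d -> R) <= Z.
Hypotheses (as_ : a <= s) (sT : s <= T).

Lemma good_Uq_ge (G : lattice d -> set Omega) q m w : opposite xi G m w ->
  cvgn (fun n => Tc xi (restc s q m) n w) -> `|Vc xi (restc s q m) w| <= amp s m / 2 ->
  amp s m / 2 <= `|Uq s (fun m => xi m w) (cls q m)|.
Proof.
move=> /opposite_norm x1 cv hV; have [_ ->] := Uq_split cv.
have h1 : amp s m <= `|amp s m * xi m w|.
  by rewrite normrM ger0_norm ?amp_ge0// ler_peMr// amp_ge0.
have h2 : `|amp s m * xi m w| <= `|amp s m * xi m w + Vc xi (restc s q m) w| + `|Vc xi (restc s q m) w|.
  have := ler_normB (amp s m * xi m w + Vc xi (restc s q m) w) (Vc xi (restc s q m) w).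
  by rewrite addrK.
by lra.
Qed.

(** At [t = s] the weight of a class is the inverse of its variance, so each class contributes at
    most [xi_var] in expectation. *)
Lemma den_bounded q (kap : R) : 0 < kap -> exists A : set Omega,
  [/\ measurable A, (P A <= (xi_var xi_normal / kap)%:E)%E &
  forall w, ~ A w -> cvg_classes q (uhat s (fun m => xi m w)) /\
    den s (fun m => xi m w) s q <= kap * nq R d q].
Proof.
move=> kap0; have n0 : 0 < nq R d q by rewrite powR_gt0 ?Nq_gt0.
have At0 (r : Jq d q) : 0 < At s r by exact: (At_gt0 d0 a0 HZ).
have hE : \sum_(r : Jq d q) (At s r)^-1 * At s r <= nq R d q.
  by rewrite (eq_bigr (fun=> 1)) ?sum_const_Jq ?mulr1// => r _; rewrite mulVf// gt_eqF.
have w0 (r : Jq d q) : 0 <= (At s r)^-1 by rewrite invr_ge0 ltW.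
have hsig (r : Jq d q) n : r \in index_enum _ ->
    boxsum n (fun m => restr (fun m => cls q m == r) (amp s) m ^+ 2) <= At s r.
  by move=> _; exact: (boxsum_restr_amp_sqr d0 a0 HZ as_).
have K0 : 0 < kap * nq R d q by rewrite mulr_gt0.
have [A [mA PA HA]] := sum_sqr_Vc_le d0 xi_normal xi_indep (d_lt_2s da as_)
  (fun r : Jq d q => restr_amp_le d0 a0 as_ (fun m => cls q m == r)) w0 hsig hE K0.
exists A; split => //.
  apply: le_trans PA _; rewrite lee_fin le_eqVlt; apply/orP; left; apply/eqP.
  by field; rewrite !gt_eqF.
move=> w /HA[cv hV]; split; first by apply: cvg_classes_Tc => r; apply: cv; rewrite mem_index_enum.
apply: le_trans hV; rewrite /den le_eqVlt; apply/orP; left; apply/eqP.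
by apply: eq_bigr => r _; rewrite Uq_Vc mulrC.
Qed.

Lemma EB_consistent : argmin_cvg_in_prob P (fun q w => EB_obj s (fun m => xi m w) q) a T s.
Proof.
move=> eps eta e0 eta0.
have eta3 : 0 < eta / 3 by rewrite divr_gt0.
have [l [k0 [l2 hgood]]] := good_points d0 xi_normal xi_indep a0 da HZ as_ sT eta3.
(* The threshold for which Markov's inequality gives probability [eta / 3]. *)
pose kap := xi_var xi_normal / (eta / 3).
have kap0 : 0 < kap by rewrite divr_gt0// xi_var_gt0.
have [k1 hk1] := Nq_powR_large (nq R d l * (kap + logC d T Z + 2 * T * ln (Nq R l) + 2 * T / eps)
   / (@tail_prob R * clo d T / (16 * Cup T Z))) e0.
have [k2 hk2] := Nq_powR_large (expR (nq R d l * (kap + logC d T Z) / (2 * eps))) (@ltr01 R).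
exists (l + maxn k0 (maxn k1 k2))%N => q hq.
pose k := (q - l)%N; have kl : q = (k + l)%N by rewrite /k; lia.
have hk : (maxn k0 (maxn k1 k2) <= k)%N by rewrite /k leq_subRL ?(leq_trans (leq_addr _ _) hq).
move: hk; rewrite !geq_max => /and3P[hk0 /hk1{}hk1 /hk2{}hk2].
rewrite powRr1 ?(ltW (Nq_gt0 R k))// in hk2.
(* With [G] empty, [opposite] reduces to [1 <= xi m w]: the data term only calls for large
   coefficients. *)
have hG0 (m : lattice d) : <<s outside (fun m => m != 0) xi (fun m => m \in Ibox d k) >> set0.
  exact: sigma_algebra0.
have [A1 [mA1 PA1 HA1]] := hgood k hk0 (fun=> set0) hG0.
have [A2 [mA2 PA2 HA2]] := den_bounded q kap0.
exists (A1 `|` A2); split; first exact: measurableU.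
split.
  apply: le_lt_trans (measureU2 _ mA1 mA2) _; apply: le_lt_trans (leeD PA1 PA2) _.
  rewrite -EFinD lte_fin (_ : xi_var xi_normal / kap = eta / 3); first by lra.
  by rewrite /kap; field; rewrite !gt_eqF// xi_var_gt0.
move=> w nA t [/andP[at_ tT] tmin].
have [g [ug gI gn gm]] := HA1 w (fun h => nA (or_introl h)).
have [cu Hden] := HA2 w (fun h => nA (or_intror h)).
have {}tmin := tmin s; rewrite as_ sT/= in tmin; have {}tmin := tmin isT.
have gU m : m \in g -> amp s m / 2 <= `|Uq s (fun m => xi m w) (cls (k + l) m)|.
  by move=> /gm[h1 h2 h3]; exact: good_Uq_ge h1 h2 h3.
rewrite kl in cu Hden tmin.
rewrite real_ler_norml ?num_real//; apply/andP; split; rewrite leNgt; apply/negP => h.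
  have {}h : t < s - eps by rewrite addrC -ltrBlDr.
  exact: (EB_not_below d0 a0 HZ as_ sT l2 cu Hden e0 at_ h (ltW kap0) hk2 tmin).
have {}h : s + eps < t by rewrite addrC -ltrBrDr.
exact: (EB_not_above d0 a0 HZ as_ sT l2 (@tail_prob_gt0 R) cu Hden ug gI gn gU e0 h tT (ltW kap0) hk1 tmin).
Qed.

End consistency.

(** * Kernel flow *)

(** With opposite signs the cross term can only increase the square, so the coarse prediction alone
    bounds it from below. *)
Lemma opposite_square_le (R : realType) (U A B Ab : R) : 0 < A -> 0 < Ab -> U * B <= 0 ->
  A * (B ^+ 2 / Ab ^+ 2) <= (U - A * (B / Ab)) ^+ 2 / A.
Proof.
move=> A0 Ab0 UB; rewrite ler_pdivlMr//.
have -> : A * (B ^+ 2 / Ab ^+ 2) * A = (A * (B / Ab)) ^+ 2 by field; rewrite gt_eqF.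
have h : U * (A * (B / Ab)) <= 0.
  have -> : U * (A * (B / Ab)) = U * B * (A / Ab) by field; rewrite gt_eqF.
  by rewrite mulr_le0_ge0// divr_ge0 ?ltW.
by rewrite sqrrB lerDr subr_ge0 mulr2n; have := sqr_ge0 U; lra.
Qed.

(** [U] is at most half of the coarse prediction [A * (B / Ab)], so at least half of the prediction
    survives. *)
Lemma small_square_le (R : realType) (U A B Ab u0 C : R) : 0 < A -> 0 < Ab -> Ab <= C ->
  0 <= u0 -> u0 <= `|B| -> 2 * `|U| <= A * (u0 / C) ->
  A * (u0 / (2 * C)) ^+ 2 <= (U - A * (B / Ab)) ^+ 2 / A.
Proof.
move=> A0 Ab0 AbC u00 uB hU; have C0 : 0 < C by exact: lt_le_trans AbC.
rewrite ler_pdivlMr//.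
have -> : A * (u0 / (2 * C)) ^+ 2 * A = (A * (u0 / (2 * C))) ^+ 2 by ring.
rewrite -[leRHS]real_normK ?num_real// lerXn2r ?nnegrE//.
  by rewrite mulr_ge0 ?divr_ge0 ?mulr_ge0// ltW.
have h1 : u0 / C <= `|B / Ab|.
  rewrite normrM normfV (ger0_norm (ltW Ab0)); apply: ler_pM => //.
    by rewrite invr_ge0 ltW.
  by rewrite lef_pV2 ?posrE.
have h2 : A * (u0 / C) <= `|A * (B / Ab)| by rewrite normrM (ger0_norm (ltW A0)) ler_wpM2l// ltW.
have h3 := lerB_dist (A * (B / Ab)) U; rewrite distrC in h3.
apply: le_trans h3; have -> : A * (u0 / (2 * C)) = A * (u0 / C) / 2 by field; rewrite gt_eqF.
by lra.
Qed.

(** * Deterministic bounds on the kernel flow ratio *)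

Section kernel_flow_bounds.
Variables (R : realType) (d : nat).
Hypothesis d0 : (0 < d)%N.
Variables (a T Z : R).
Hypotheses (a0 : 0 <= a).
Hypothesis HZ : forall N, boxsum N (pnorm (2 * a) : lattice d -> R) <= Z.
Local Notation Cup := (Cup T Z).
Local Notation clo := (clo d T).
Variables (s : R) (x : lattice d -> R) (q : nat).
Local Notation N := (Nq R q).
Local Notation U := (Uq s x).
Local Notation e1 := (unitv d0 1).

Let At0 t p (r : Jq d p) : a <= t -> t <= T -> 0 < At t r.
Proof. exact: (At_gt0 d0 a0 HZ). Qed.

(** The second factor replaces the fine grid size 2 N by N, uniformly in [t <= T]. *)
Definition cnext : R := clo * 2 `^ (- (2 * T)).

Lemma cnext_gt0 : 0 < cnext.
Proof. by rewrite mulr_gt0 ?clo_gt0 ?powR_gt0. Qed.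

Lemma At_next_lower t (r : Jq d q.+1) : a <= t -> t <= T -> cnext * N `^ (- (2 * t)) <= At t r.
Proof.
move=> at_ tT; apply: le_trans (At_lower d0 a0 HZ r at_ tT).
rewrite /cnext -mulrA ler_wpM2l ?(ltW (clo_gt0 d0 T))//.
apply: (@le_trans _ _ (Nq R q.+1 `^ (- (2 * t)))); last first.
  by apply: ler_powRN; rewrite ?Hq_gt0 ?Hq_le// mulr_ge0// (le_trans a0).
rewrite NqS powRM ?(ltW (Nq_gt0 R q))//; apply: ler_wpM2r; first exact: powR_ge0.
by apply: ler_powR; rewrite ?ler1n// lerN2 ler_wpM2l.
Qed.

Lemma At_le_Cup t p (r : Jq d p) : a <= t -> t <= T -> At t r <= Cup.
Proof.
move=> at_ tT; apply: le_trans (At_upper d0 a0 HZ r at_ tT) _.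
rewrite ler_piMr ?(le_trans ler01 (Cup_ge1 T HZ))// -[leRHS](powRr0 (Hq R r)).
by apply: ler_powR; rewrite ?Hq_ge1// oppr_le0 mulr_ge0// (le_trans a0).
Qed.

Lemma num_term_le t (r : Jq d q.+1) : a <= t -> t <= T ->
  (U r - At t r * (U (bar r) / At t (bar r))) ^+ 2 / At t r <= num s x t q.
Proof.
move=> at_ tT; rewrite /num (bigD1 r)//= lerDl; apply: sumr_ge0 => r' _.
by rewrite divr_ge0 ?sqr_ge0// ltW// At0.
Qed.

Lemma den_term_le t (r : Jq d q.+1) (u0 : R) : a <= t -> t <= T -> 0 <= u0 -> u0 <= `|U r| ->
  u0 ^+ 2 / Cup <= den s x t q.+1.
Proof.
move=> at_ tT u00 uU; rewrite /den (bigD1 r)//=.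
apply: (@le_trans _ _ (U r ^+ 2 / At t r)); last first.
  by rewrite lerDl; apply: sumr_ge0 => r' _; rewrite divr_ge0 ?sqr_ge0// ltW// At0.
apply: ler_pM; rewrite ?sqr_ge0 ?invr_ge0 ?(le_trans ler01 (Cup_ge1 T HZ))//.
  by rewrite -[leRHS]real_normK ?num_real// lerXn2r ?nnegrE.
by rewrite lef_pV2 ?posrE ?At0 ?At_le_Cup// (lt_le_trans ltr01 (Cup_ge1 T HZ)).
Qed.

(** The weighted sum in the hypothesis is free of [t], so a single event serves all [t]; the missing
    power of [Hq] is at most [y], and is bounded by its value at the grid size. *)
Lemma den_le_powR (t e K3 y : R) : a <= t -> t <= T ->
  \sum_(r : Jq d q.+1) Hq R r `^ (2 * s - d%:R - e) * U r ^+ 2 <= K3 ->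
  0 <= y -> 2 * t - (2 * s - d%:R - e) <= y ->
  den s x t q.+1 <= K3 / clo * (2 `^ y * N `^ y).
Proof.
move=> at_ tT hK y0 hy; have c0 := clo_gt0 d0 T.
rewrite -powRM ?(ltW (Nq_gt0 R q))// -NqS.
have -> : K3 / clo * Nq R q.+1 `^ y = Nq R q.+1 `^ y / clo * K3 by ring.
have n0 : 0 <= Nq R q.+1 `^ y / clo by rewrite divr_ge0 ?powR_ge0// ltW.
apply: le_trans (ler_wpM2l n0 hK); rewrite mulr_sumr; apply: ler_sum => r _.
have H0 := Hq_gt0 R r.
have hA : (At t r)^-1 <= Hq R r `^ (2 * t) / clo.
  have -> : Hq R r `^ (2 * t) / clo = (clo * Hq R r `^ (- (2 * t)))^-1.
    by rewrite powRN invfM invrK mulrC.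
  by rewrite lef_pV2 ?posrE ?At0 ?(mulr_gt0 c0) ?powR_gt0//; exact: (At_lower d0 a0 HZ).
rewrite mulrC; apply: (@le_trans _ _ (Hq R r `^ (2 * t) / clo * U r ^+ 2)).
  by apply: ler_wpM2r; rewrite ?sqr_ge0.
rewrite [leRHS]mulrA; apply: ler_wpM2r; first exact: sqr_ge0.
have -> : 2 * t = (2 * t - (2 * s - d%:R - e)) + (2 * s - d%:R - e) by ring.
rewrite powRDp//; have -> : forall u v w : R, u * v / w = u / w * v by move=> u v w; ring.
rewrite ler_wpM2r ?powR_ge0// ler_wpM2r ?invr_ge0 ?(ltW c0)//.
apply: (@le_trans _ _ (Hq R r `^ y)); first by apply: ler_powR => //; exact: Hq_ge1.
by apply: ge0_ler_powR; rewrite ?nnegrE ?(ltW H0) ?(ltW (Nq_gt0 R _)) ?Hq_le.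
Qed.

Lemma cls_shift m : cls q (m + unitv d0 (2 ^ q)%:Z) = cls q m.
Proof.
apply/eqP/clsP => i; rewrite !ffunE addrAC subrr add0r.
by case: ifP => _; rewrite ?dvdzz ?dvdz0.
Qed.

(** The shifted frequency is aliased to [e1] on the coarse grid. The coarse estimate thus predicts
    there an amplitude of order [At t r], which the small true sum cannot compensate. *)
Lemma num_ge_shift (t u0 : R) : a <= t -> t <= T -> 0 <= u0 -> u0 <= `|U (cls q e1)| ->
  2 * `|U (cls q.+1 (e1 + unitv d0 (2 ^ q)%:Z))| <= cnext * N `^ (- (2 * t)) * (u0 / Cup) ->
  cnext * (u0 / (2 * Cup)) ^+ 2 * N `^ (- (2 * t)) <= num s x t q.
Proof.
move=> at_ tT u00 hu hU; set r := cls q.+1 _ in hU.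
have br : bar r = cls q e1 by rewrite /r bar_cls cls_shift.
have hA := At_next_lower r at_ tT.
have C0 : 0 < Cup by exact: lt_le_trans (Cup_ge1 T HZ).
apply: le_trans (num_term_le r at_ tT).
apply: le_trans (small_square_le (C := Cup) (At0 r at_ tT) (At0 (bar r) at_ tT) (At_le_Cup _ at_ tT) u00 _ _).
- by rewrite mulrAC; apply: ler_wpM2r => //; exact: sqr_ge0.
- by rewrite br.
- by apply: le_trans hU _; apply: ler_wpM2r => //; rewrite divr_ge0// ltW.
Qed.

Section good_set.
Variables (k l : nat) (g : seq (lattice d)) (tp : R).
Hypotheses (as_ : a <= s) (sT : s <= T) (l2 : (2 <= l)%N) (tp0 : 0 < tp) (qkl : q = (k + l)%N).
Hypotheses (ug : uniq g) (gI : {subset g <= Ibox d k}) (gn : tp / 4 * nq R d k <= (size g)%:R).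
Hypothesis gU : forall m, m \in g -> amp s m / 2 <= `|U (cls q m)|.
Hypothesis gopp : forall m, m \in g ->
  U (cls q.+1 (m + unitv d0 (2 ^ q)%:Z)) * U (cls q m) <= 0.

(** The first factor counts the good frequencies relative to N^d; the second bounds the contribution
    of one of them. *)
Definition cgood : R :=
  tp / 4 / nq R d l * (cnext * (clo / 4 / (Cup * Nq R l `^ (2 * T)) ^+ 2)).

Lemma cgood_gt0 : 0 < cgood.
Proof.
have C0 : 0 < Cup by exact: lt_le_trans (Cup_ge1 T HZ).
by rewrite /cgood; repeat first [exact: cnext_gt0|exact: clo_gt0|exact: powR_gt0|apply: divr_gt0
  |apply: mulr_gt0|apply: exprn_gt0]; rewrite ?powR_gt0 ?Nq_gt0.
Qed.

(** A good frequency contributes the fine eigenvalue, of order N^(-2t), times the squared coarse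
    ratio, of order N^(-2s) / N^(-4t), and there are order N^d of them. *)
Lemma num_ge_good (t : R) : a <= t -> t <= T -> cgood * N `^ (2 * t - (2 * s - d%:R)) <= num s x t q.
Proof.
move=> at_ tT; have t0 : 0 <= t by exact: le_trans at_.
have s0 : 0 <= s by exact: le_trans as_.
have C0 : 0 < Cup by exact: lt_le_trans (Cup_ge1 T HZ).
have c0 := clo_gt0 d0 T; have N0 := Nq_gt0 R q; have L0 := Nq_gt0 R l; have M0 := Nq_gt0 R k.
have NE : N = Nq R k * Nq R l by rewrite qkl /Nq expnD natrM.
pose f (r : Jq d q.+1) := (U r - At t r * (U (bar r) / At t (bar r))) ^+ 2 / At t r.
have f0 r : 0 <= f r by rewrite divr_ge0 ?sqr_ge0// ltW// At0.
(* A fine class aliased to [m] on the coarse grid only; [bar] recovers the coarse class, whence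
   injectivity. *)
pose h m := cls q.+1 (m + unitv d0 (2 ^ q)%:Z).
have bh m : bar (h m) = cls q m by rewrite /h bar_cls cls_shift.
have hinj : {in g &, injective h}.
  move=> m m' hm hm' e; apply: (Ibox_cls_inj (ltnW l2) (gI hm) (gI hm')).
  by rewrite -qkl -!bh e.
apply: le_trans (sum_image_le ug hinj f0).
pose v := clo / 4 / (Cup * Nq R l `^ (2 * T)) ^+ 2.
pose b := cnext * v * N `^ (2 * t - 2 * s).
have v0 : 0 < v by rewrite /v !(divr_gt0, exprn_gt0, mulr_gt0)// powR_gt0.
have b0 : 0 <= b by rewrite /b mulr_ge0 ?powR_ge0// mulr_ge0 ?(ltW v0)// ltW// cnext_gt0.
apply: (@le_trans _ _ (\sum_(m <- g) b)).
  rewrite big_const_seq count_predT iter_addr addr0 -[b *+ _]mulr_natl.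
  apply: le_trans (ler_wpM2r b0 gn).
  have -> : nq R d k = N `^ d%:R / nq R d l.
    by rewrite /nq NE powRM ?(ltW L0) ?(ltW M0)// mulfK// gt_eqF// powR_gt0.
  have -> : 2 * t - (2 * s - d%:R) = d%:R + (2 * t - 2 * s) by ring.
  by rewrite powRDp// /cgood /b -/v le_eqVlt; apply/orP; left; apply/eqP; ring.
rewrite big_seq [leRHS]big_seq; apply: ler_sum => m hm.
have hI := gI hm; have m0 := Ibox_neq0 d0 hI.
have s1 := supR_ge1 R m0; have sp0 : 0 < supR R m by apply: lt_le_trans s1.
have spN : supR R m <= N.
  by rewrite /supR /Nq ler_nat qkl; apply: leq_trans (Ibox_small d0 l2 hI); rewrite -addnn leq_addr.
have Msp : Nq R k <= supR R m by rewrite /Nq /supR ler_nat Ibox_supn_ge.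
have hH : Hq R (cls q m) = supR R m by rewrite /Hq qkl Ibox_cent// (negbTE m0).
have Ab : At t (bar (h m)) <= Cup * Nq R l `^ (2 * T) * N `^ (- (2 * t)).
  rewrite bh; apply: le_trans (At_upper d0 a0 HZ _ at_ tT) _.
  rewrite hH -mulrA ler_wpM2l ?(ltW C0)//.
  apply: (@le_trans _ _ (Nq R k `^ (- (2 * t)))); first by apply: ler_powRN; rewrite ?mulr_ge0.
  have -> : Nq R k `^ (- (2 * t)) = Nq R l `^ (2 * t) * N `^ (- (2 * t)).
    rewrite NE powRM ?(ltW L0) ?(ltW M0)// mulrCA -powRDp// subrr powRr0 mulr1//.
  apply: ler_wpM2r; first exact: powR_ge0.
  by apply: ler_powR; [exact: Nq_ge1|rewrite ler_wpM2l].
have hB : clo / 4 * N `^ (- (2 * s)) <= U (cls q m) ^+ 2.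
  apply: (@le_trans _ _ ((amp s m / 2) ^+ 2)); last first.
    by rewrite -[leRHS]real_normK ?num_real// lerXn2r ?nnegrE ?gU// divr_ge0//; exact: wt_ge0.
  have -> : (amp s m / 2) ^+ 2 = amp s m ^+ 2 / 4 by field.
  rewrite mulrAC ler_pM2r ?invr_gt0// (amp_sqr d0 s).
  apply: le_trans (clo_le_wt d0 a0 as_ sT m0); rewrite ler_wpM2l ?(ltW c0)//.
  by apply: ler_powRN; rewrite ?mulr_ge0.
have Hp := At0 (h m) at_ tT; have Hb := At0 (bar (h m)) at_ tT.
have UB : U (h m) * U (bar (h m)) <= 0 by rewrite bh; exact: gopp.
apply: le_trans (opposite_square_le Hp Hb UB).
have -> : b = cnext * N `^ (- (2 * t)) *
    (clo / 4 * N `^ (- (2 * s)) / (Cup * Nq R l `^ (2 * T) * N `^ (- (2 * t))) ^+ 2).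
  rewrite /b /v.
  rewrite powRDp// (powRN N (2 * t)).
  have p1 : N `^ (2 * t) != 0 by rewrite gt_eqF// powR_gt0.
  have p2 : Nq R l `^ (2 * T) != 0 by rewrite gt_eqF// powR_gt0.
  have p3 := gt_eqF C0.
  by field; rewrite p1 p2 p3.
have g0 : 0 < cnext * N `^ (- (2 * t)) by rewrite mulr_gt0 ?cnext_gt0 ?powR_gt0.
apply: ler_pM.
- exact: ltW.
- by rewrite divr_ge0 ?sqr_ge0// mulr_ge0 ?powR_ge0// divr_ge0// ltW.
- exact: At_next_lower.
apply: ler_pM.
- by rewrite mulr_ge0 ?powR_ge0// divr_ge0// ltW.
- by rewrite invr_ge0 sqr_ge0.
- by rewrite bh.
rewrite lef_pV2 ?posrE ?exprn_gt0//; last by rewrite !mulr_gt0 ?powR_gt0.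
by rewrite lerXn2r ?nnegrE ?(ltW Hb)// !mulr_ge0 ?powR_ge0// ltW.
Qed.

End good_set.

End kernel_flow_bounds.

Lemma latsum_le (R : realType) d (F G : lattice d -> R) : (forall m, F m <= G m) ->
  (forall m, 0 <= G m) -> cvgn (fun N => boxsum N F) -> cvgn (fun N => boxsum N G) ->
  latsum F <= latsum G.
Proof.
move=> FG G0 cF cG; apply: latsum_le_bound => // N.
by apply: le_trans (boxsum_le_latsum N G0 cG); apply: boxsum_le.
Qed.

(** A fine class is determined by its coarse class and the half of the range in which each
    coordinate lies, so a coarse class has at most 2^d of them. *)
Lemma sum_bar_le (R : realType) d q (f : Jq d q -> R) : (forall r, 0 <= f r) ->
  \sum_(r : Jq d q.+1) f (bar r) <= 2 ^+ d * \sum_r f r.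
Proof.
move=> f0.
pose h (r : Jq d q.+1) : Jq d q * {ffun 'I_d -> bool} := (bar r, [ffun i => (2 ^ q <= r i)%N]).
have hinj : injective h.
  move=> r r' [/eqP/clsP e /ffunP b]; apply/ffunP => i; apply: ord_inj.
  have := b i; have := e i; rewrite !ffunE => /dvdzP[z hz] bi.
  have := ltn_ord (r i); have := ltn_ord (r' i).
  move: (nat_of_ord (r i)) (nat_of_ord (r' i)) hz bi => n n' hz; rewrite expnS => bi.
  move: bi; case: (leqP (2 ^ q) n) => hn; case: (leqP (2 ^ q) n') => // hn' _ b1 b2.
    have : (n - 2 ^ q)%N = (n' - 2 ^ q)%N; last by lia.
    by apply: (@small_residues_eq _ _ (2 ^ q)%N z); clear -hz hn hn' b1 b2; lia.
  exact: small_residues_eq hz _ _.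
have hin : {in index_enum (Jq d q.+1) &, injective h} by move=> r r' _ _; exact: hinj.
apply: le_trans (sum_image_le (f := fun p => f p.1) (index_enum_uniq _) hin (fun p => f0 p.1)) _.
rewrite -(pair_bigA _ (fun r (_ : {ffun 'I_d -> bool}) => f r))/= mulr_sumr.
apply: ler_sum => r _; rewrite sumr_const card_ffun card_bool card_ord.
by rewrite -[f r *+ _]mulr_natl natrX.
Qed.

(** If the ratio at [t] does not exceed the one at the target, cross-multiplying bounds a power of
    [N] by constants; a large [N] then gives the contradiction. *)
Lemma ratio_bound (R : realType) (N nt dt n1 d1 c x C1 C2 p y u e : R) : 1 <= N ->
  0 < c -> c * N `^ x <= nt -> 0 < dt -> dt <= C2 * N `^ y -> n1 <= C1 * N `^ p -> 0 <= C1 ->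
  0 < u -> u <= d1 -> nt / dt <= n1 / d1 -> e <= x - p - y -> c * u * N `^ e <= C1 * C2.
Proof.
move=> N1 c0 hnt dt0 hdt hn1 C10 u0 hu hr he.
have N0 : 0 < N by apply: lt_le_trans N1.
have d10 : 0 < d1 by apply: lt_le_trans hu.
have px := powR_gt0 x N0.
have h1 : nt * d1 <= n1 * dt by move: hr; rewrite ler_pdivrMr// mulrAC ler_pdivlMr.
have h2 : c * N `^ x * u <= C1 * N `^ p * (C2 * N `^ y).
  apply: (@le_trans _ _ (nt * d1)).
    by apply: ler_pM => //; [rewrite mulr_ge0 ?(ltW c0)// ltW|exact: ltW].
  apply: (le_trans h1); apply: (@le_trans _ _ (C1 * N `^ p * dt)).
    by apply: ler_wpM2r => //; exact: ltW.
  by apply: ler_wpM2l => //; rewrite mulr_ge0 ?powR_ge0.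
have hxe : N `^ e * (N `^ p * N `^ y) <= N `^ x.
  by rewrite -!powRDp//; apply: ler_powR => //; lra.
have pp : 0 < N `^ p * N `^ y by rewrite mulr_gt0 ?powR_gt0.
rewrite -(ler_pM2r pp).
apply: (@le_trans _ _ (c * u * N `^ x)).
  by rewrite -[leLHS]mulrA; apply: ler_wpM2l => //; rewrite mulr_ge0 ?(ltW c0) ?(ltW u0).
have -> : c * u * N `^ x = c * N `^ x * u by ring.
by apply: (le_trans h2); rewrite le_eqVlt; apply/orP; left; apply/eqP; ring.
Qed.

(** * Variance of the kernel flow numerator at the target *)

Section residual_variance.
Variables (R : realType) (d : nat).
Hypothesis d0 : (0 < d)%N.
Variables (a T Z tau s : R).
Hypotheses (a0 : 0 <= a).
Hypothesis HZ : forall N, boxsum N (pnorm (2 * a) : lattice d -> R) <= Z.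
Hypotheses (atau : a <= tau) (tauT : tau <= T) (as_ : a <= s) (sT : s <= T).
Hypothesis s_tau : 2 * s = 4 * tau + d%:R.
Variable q : nat.
Local Notation Cup := (Cup T Z).
Local Notation clo := (clo d T).
Local Notation N := (Nq R q).

Definition ratio (r : Jq d q.+1) : R := At tau r / At tau (bar r).

(** The coefficients on the [xi m] of the difference between the fine sum and its coarse prediction,
    whose variance is thus controlled by a sum of squares. *)
Definition residual (r : Jq d q.+1) (m : lattice d) : R :=
  restr (fun m => cls q.+1 m == r) (amp s) m - ratio r * restr (fun m => cls q m == bar r) (amp s) m.

Let cv t D : a <= t -> cvgn (fun N => boxsum N (restr D (wt t : lattice d -> R))).
Proof. exact: (cvg_wt_restr d0 a0 HZ). Qed.

Let restr_wt_ge0 t D m : 0 <= restr D (wt t : lattice d -> R) m.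
Proof. by apply: restr_ge0 => m'; exact: wt_ge0. Qed.

Let cls_bar (r : Jq d q.+1) m : cls q.+1 m == r -> cls q m == bar r.
Proof. by move/eqP <-; rewrite bar_cls. Qed.

Lemma ratio_itv r : 0 <= ratio r <= 1.
Proof.
have Ab : 0 < At tau (bar r) by exact: (At_gt0 d0 a0 HZ _ atau tauT).
have A : 0 < At tau r by exact: (At_gt0 d0 a0 HZ _ atau tauT).
rewrite /ratio divr_ge0 ?(ltW A) ?(ltW Ab)//= ler_pdivrMr// mul1r.
apply: latsum_le; [|exact: restr_wt_ge0|exact: cv|exact: cv].
move=> m; rewrite {1}/restr; case: ifP => [/cls_bar h|_]; last exact: restr_wt_ge0.
by rewrite /restr h.
Qed.

Lemma residual_le r m : `|residual r m| <= 1 * pnorm s m.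
Proof.
have /andP[r0 r1] := ratio_itv r.
have am := amp_ge0 s m.
have ap : amp s m <= pnorm s m.
  by have := restr_amp_le d0 a0 as_ xpredT m; rewrite mul1r /restr ger0_norm.
rewrite mul1r; apply: le_trans ap; rewrite /residual /restr.
case: ifP => [/cls_bar ->|_]; last first.
  case: ifP => _; last by rewrite mulr0 subr0 normr0.
  by rewrite sub0r normrN normrM (ger0_norm r0) (ger0_norm am) ler_piMl.
rewrite -[X in X - _]mul1r -mulrBl normrM (ger0_norm am) ler_piMl// ger0_norm ?subr_ge0//.
by rewrite lerBlDr lerDl.
Qed.

Let tail (r : Jq d q.+1) : (lattice d -> R) -> lattice d -> R := restr (fun m => (cls q m == cls q (cent (bar r))) && (m != cent (bar r))).

Let tail_le (r : Jq d q.+1) t : a <= t -> t <= T -> latsum (tail r (wt t)) <= Cup * N `^ (- (2 * t)).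
Proof. by move=> at_ tT; apply: (latsum_wt_tail_le d0 a0 HZ) => //; exact: supn_cent. Qed.

(* [theta] is [1 - ratio r] when the fine class [r] contains the smallest
   frequency of the coarse class [bar r], and [ratio r] otherwise. *)
Lemma residual_sqr_le r : exists theta, [/\ 0 <= theta,
  theta * At tau (bar r) <= Cup * N `^ (- (2 * tau)) &
  forall m, residual r m ^+ 2 <=
    theta ^+ 2 * restr (fun m => cls q m == bar r) (wt s) m + tail r (wt s) m].
Proof.
have /andP[r0 r1] := ratio_itv r.
have Ab : 0 < At tau (bar r) by exact: (At_gt0 d0 a0 HZ _ atau tauT).
have sq_le1 (y : R) (m : lattice d) : 0 <= y <= 1 -> y ^+ 2 * wt s m <= wt s m.
  by move=> /andP[y0 y1]; rewrite ler_piMl ?wt_ge0// exprn_ile1.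
have r1' : 0 <= 1 - ratio r <= 1 by rewrite subr_ge0 r1 lerBlDr lerDl.
have rs (y : R) (m : lattice d) : 0 <= y ^+ 2 * wt s m by rewrite mulr_ge0 ?sqr_ge0 ?wt_ge0.
have in_r m : cls q.+1 m == r -> residual r m ^+ 2 = (1 - ratio r) ^+ 2 * wt s m.
  move=> h; rewrite /residual /restr h (cls_bar h) -(amp_sqr d0) -exprMn.
  by congr (_ ^+ 2); ring.
have notin_r m : (cls q.+1 m == r) = false -> cls q m == bar r ->
    residual r m ^+ 2 = ratio r ^+ 2 * wt s m.
  by move=> h h'; rewrite /residual /restr h h' -(amp_sqr d0) -exprMn sub0r sqrrN.
have out m : (cls q m == bar r) = false -> residual r m ^+ 2 = 0.
  move=> h; have h' : (cls q.+1 m == r) = false by apply: contraFF h; exact: cls_bar.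
  by rewrite /residual /restr h h' mulr0 subr0 expr0n.
(* In both cases [theta * At tau (bar r)] is a sum of weights over frequencies that leave out the
   dominant one, hence at most a tail. *)
case: (boolP ((cls q.+1 (cent (bar r)) == r) && (cent (bar r) != 0))) => [/andP[hr h0]|hn].
  exists (1 - ratio r); split; first by case/andP: r1'.
    apply: le_trans (tail_le r atau tauT).
    rewrite mulrBl mul1r /ratio divfK ?gt_eqF// lerBlDr addrC.
    apply: latsum_le_bound; first exact: cv.
    move=> n; apply: (@le_trans _ _ (boxsum n (fun m =>
       restr (fun m => cls q.+1 m == r) (wt tau) m + tail r (wt tau) m))).
      apply: boxsum_le => m; rewrite {1}/restr; case: ifP => [h|_]; last first.
        by apply: addr_ge0; exact: restr_wt_ge0.
      have [->|mm] := eqVneq m (cent (bar r)).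
        by rewrite /restr hr lerDl; exact: restr_wt_ge0.
      by rewrite /tail {2}/restr mm cls_cent h lerDr; exact: restr_wt_ge0.
    by rewrite boxsumD; apply: lerD; apply: boxsum_le_latsum; try exact: cv; exact: restr_wt_ge0.
  move=> m; case: (boolP (cls q m == bar r)) => [hb|/negbTE hb]; last first.
    by rewrite out// addr_ge0 ?restr_wt_ge0// mulr_ge0 ?sqr_ge0 ?restr_wt_ge0.
  rewrite {1}/restr hb; case: (boolP (cls q.+1 m == r)) => [h|/negbTE h].
    by rewrite in_r// lerDl; exact: restr_wt_ge0.
  rewrite notin_r// /tail /restr cls_cent hb.
  have -> : m != cent (bar r) by apply: contraFN h => /eqP ->.
  by apply: (le_trans (sq_le1 _ m (ratio_itv r))); rewrite lerDr.
(* If the smallest member does lie in [r], it is 0 here and has no weight. *)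
have small m : cls q.+1 m == r -> m = cent (bar r) -> forall t, wt t m = 0 :> R.
  move=> h e t; move: hn; rewrite -e h/= negbK => /eqP ->.
  by rewrite /wt eqxx.
exists (ratio r); split => //.
  apply: le_trans (tail_le r atau tauT); rewrite /ratio divfK ?gt_eqF//.
  apply: latsum_le; [|exact: restr_wt_ge0|exact: cv|exact: cv] => m.
  rewrite {1}/restr; case: ifP => [h|_]; last exact: restr_wt_ge0.
  have [e|mm] := eqVneq m (cent (bar r)).
    by rewrite small//; exact: restr_wt_ge0.
  by rewrite /tail /restr mm cls_cent (cls_bar h).
move=> m; case: (boolP (cls q m == bar r)) => [hb|/negbTE hb]; last first.
  by rewrite out// addr_ge0 ?restr_wt_ge0// mulr_ge0 ?sqr_ge0 ?restr_wt_ge0.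
rewrite {1}/restr hb; case: (boolP (cls q.+1 m == r)) => [h|/negbTE h].
  rewrite in_r//; have [e|mm] := eqVneq m (cent (bar r)).
    by rewrite small// !mulr0 add0r; exact: restr_wt_ge0.
  by rewrite /tail /restr mm cls_cent hb; apply: (le_trans (sq_le1 _ m r1')); rewrite lerDr.
by rewrite notin_r// lerDl; exact: restr_wt_ge0.
Qed.

Definition Cres : R := Cup ^+ 3 / clo ^+ 2 + Cup.

(** [theta] is at most of order (H/N)^(2 tau) and the coarse variance of order H^(-2s); since 2 s =
    4 tau + d, this leaves N^(-4 tau) H^(-d). The tail N^(-2s) is no larger, as H <= N. *)
Lemma boxsum_residual_sqr_le r n : boxsum n (fun m => residual r m ^+ 2) <=
  Cres * N `^ (- (4 * tau)) * Hq R (bar r) `^ (- d%:R).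
Proof.
have [th [th0 thA hr]] := residual_sqr_le r.
have H0 := Hq_gt0 R (bar r); have N0 := Nq_gt0 R q.
have C0 : 0 < Cup by exact: lt_le_trans (Cup_ge1 T HZ).
have c0 := clo_gt0 d0 T.
have Ab : 0 < At tau (bar r) by exact: (At_gt0 d0 a0 HZ _ atau tauT).
apply: (@le_trans _ _ (th ^+ 2 * At s (bar r) + Cup * N `^ (- (2 * s)))).
  apply: (le_trans (boxsum_le n hr)); rewrite boxsumD boxsumZ; apply: lerD.
    apply: ler_wpM2l; first exact: sqr_ge0.
    by apply: boxsum_le_latsum; [exact: restr_wt_ge0|exact: cv].
  apply: le_trans (tail_le r as_ sT); apply: boxsum_le_latsum; last exact: cv.
  exact: restr_wt_ge0.
have -> : Cres * N `^ (- (4 * tau)) * Hq R (bar r) `^ (- d%:R) =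
   Cup ^+ 3 / clo ^+ 2 * (N `^ (- (4 * tau)) * Hq R (bar r) `^ (- d%:R)) +
   Cup * (N `^ (- (4 * tau)) * Hq R (bar r) `^ (- d%:R)).
  by rewrite /Cres; ring.
apply: lerD; last first.
  have -> : - (2 * s) = - (4 * tau) + - d%:R by rewrite s_tau; ring.
  rewrite powRDp// ler_wpM2l ?(ltW C0)// ler_wpM2l ?powR_ge0//.
  by apply: ler_powRN => //; exact: Hq_le.
have hth : th <= Cup / clo * (N `^ (- (2 * tau)) * Hq R (bar r) `^ (2 * tau)).
  rewrite -ler_pdivlMr// in thA; apply: (le_trans thA).
  have -> : Cup / clo * (N `^ (- (2 * tau)) * Hq R (bar r) `^ (2 * tau)) =
      Cup * N `^ (- (2 * tau)) * (Hq R (bar r) `^ (2 * tau) / clo) by ring.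
  rewrite ler_wpM2l ?mulr_ge0 ?powR_ge0 ?(ltW C0)//.
  have -> : Hq R (bar r) `^ (2 * tau) / clo = (clo * Hq R (bar r) `^ (- (2 * tau)))^-1.
    by rewrite powRN invfM invrK mulrC.
  rewrite lef_pV2 ?posrE ?(mulr_gt0 c0) ?powR_gt0//.
  exact: (At_lower d0 a0 HZ).
have hA := At_upper d0 a0 HZ (bar r) as_ sT.
apply: (@le_trans _ _ ((Cup / clo * (N `^ (- (2 * tau)) * Hq R (bar r) `^ (2 * tau))) ^+ 2 *
    (Cup * Hq R (bar r) `^ (- (2 * s))))).
  have As : 0 <= At s (bar r) by apply/ltW; exact: (At_gt0 d0 a0 HZ _ as_ sT).
  apply: ler_pM; [exact: sqr_ge0|exact: As| |exact: hA].
  by rewrite lerXn2r ?nnegrE// !mulr_ge0 ?powR_ge0 ?invr_ge0 ?(ltW C0) ?(ltW c0).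
have -> : - (2 * s) = - (4 * tau) + - d%:R by rewrite s_tau; ring.
have e1 : - (4 * tau) = - (2 * tau) + - (2 * tau) by ring.
rewrite powRDp// e1 !powRDp// !(powRN (Hq R (bar r)) (2 * tau)).
have p1 : Hq R (bar r) `^ (2 * tau) != 0 by rewrite gt_eqF// powR_gt0.
rewrite le_eqVlt; apply/orP; left; apply/eqP.
by field; rewrite p1 gt_eqF.
Qed.

(** The sum of the H^(-d) would diverge logarithmically; paying N^e turns the exponent into d + e,
    for which it is bounded. *)
Lemma sum_residual_le (e Ze : R) : 0 < e ->
  (forall n, boxsum n (pnorm (d%:R + e) : lattice d -> R) <= Ze) ->
  \sum_(r : Jq d q.+1) (At tau r)^-1 * (Cres * N `^ (- (4 * tau)) * Hq R (bar r) `^ (- d%:R)) <=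
  Cres / cnext d T * (2 ^+ d * (Ze + 1)) * N `^ (- (2 * tau) + e).
Proof.
move=> e0 HZe; have N0 := Nq_gt0 R q.
have C0 : 0 < Cup by exact: lt_le_trans (Cup_ge1 T HZ).
have c0 := clo_gt0 d0 T; have cn := cnext_gt0 d0 T.
have Cr : 0 <= Cres by rewrite addr_ge0 ?(ltW C0)// divr_ge0 ?exprn_ge0// ltW.
pose f (r : Jq d q) := Hq R r `^ (- (d%:R + e)).
have de : 0 <= d%:R + e by rewrite addr_ge0// ltW.
have hs : \sum_(r : Jq d q.+1) f (bar r) <= 2 ^+ d * (Ze + 1).
  apply: le_trans (sum_bar_le (fun r => powR_ge0 _ _)) _.
  by apply: ler_wpM2l; [exact: exprn_ge0|exact: (sum_Hq_le d0 _ de HZe)].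
have -> : Cres / cnext d T * (2 ^+ d * (Ze + 1)) * N `^ (- (2 * tau) + e) =
    Cres / cnext d T * N `^ (- (2 * tau) + e) * (2 ^+ d * (Ze + 1)) by ring.
have k0 : 0 <= Cres / cnext d T * N `^ (- (2 * tau) + e).
  by rewrite mulr_ge0 ?powR_ge0// divr_ge0// ltW.
apply: le_trans (ler_wpM2l k0 hs); rewrite mulr_sumr; apply: ler_sum => r _.
have H0 := Hq_gt0 R (bar r).
have hA : (At tau r)^-1 <= N `^ (2 * tau) / cnext d T.
  have -> : N `^ (2 * tau) / cnext d T = (cnext d T * N `^ (- (2 * tau)))^-1.
    by rewrite (powRN N) [in RHS]invfM invrK mulrC.
  rewrite lef_pV2 ?posrE ?(mulr_gt0 cn) ?powR_gt0//; last exact: (At_gt0 d0 a0 HZ _ atau tauT).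
  exact: (At_next_lower d0 a0 HZ r atau tauT).
have hH : Hq R (bar r) `^ (- d%:R) <= N `^ e * f (bar r).
  have -> : - d%:R = e + - (d%:R + e) by ring.
  rewrite powRDp// ler_wpM2r ?powR_ge0//.
  by apply: ge0_ler_powR; rewrite ?nnegrE ?(ltW e0) ?(ltW H0) ?(ltW N0) ?Hq_le.
apply: (@le_trans _ _ (N `^ (2 * tau) / cnext d T * (Cres * N `^ (- (4 * tau)) * (N `^ e * f (bar r))))).
  apply: ler_pM => //; rewrite ?invr_ge0 ?mulr_ge0 ?powR_ge0//.
    by rewrite ltW// (At_gt0 d0 a0 HZ _ atau tauT).
  by rewrite ler_wpM2l// mulr_ge0 ?powR_ge0.
rewrite le_eqVlt; apply/orP; left; apply/eqP.
have -> : - (2 * tau) + e = 2 * tau + (- (4 * tau) + e) by ring.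
by rewrite !powRDp//; ring.
Qed.

End residual_variance.

Lemma den_exponent_above_le (R : realType) (t T tau e : R) : t <= T -> 0 < e -> 2 * e <= tau ->
  2 * t - (4 * tau - e) <= 2 * T.
Proof. by lra. Qed.

(** When the maximum is 0 the margin comes from [t - tau], otherwise from [tau] itself: hence the
    two constraints on [e]. *)
Lemma num_exponent_above_ge (R : realType) (t tau e eps : R) : 0 < e -> 2 * e <= tau -> 2 * e <= eps ->
  eps < t - tau ->
  e <= 2 * t - 4 * tau - (- (2 * tau) + e) - Num.max 0 (2 * t - (4 * tau - e)).
Proof. by move=> e0 et ee h; case: (leP 0 (2 * t - (4 * tau - e))) => hm; lra. Qed.

Lemma shift_exponent_le (R : realType) (t tau e eps D : R) : 0 <= D -> 0 < e -> 2 * e <= eps ->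
  eps < tau - t -> e - (4 * tau + D) <= - (4 * t).
Proof. by lra. Qed.

Lemma den_exponent_below_le0 (R : realType) (t tau e : R) : t <= tau -> 0 < e -> 2 * e <= tau ->
  2 * t - (4 * tau - e) <= 0.
Proof. by lra. Qed.

Lemma num_exponent_below_ge (R : realType) (t tau e eps : R) : 0 < e -> 2 * e <= eps ->
  eps < tau - t -> e <= - (2 * t) - (- (2 * tau) + e) - 0.
Proof. by lra. Qed.

Lemma le_sub_half (R : realType) (u v X : R) : v <= u -> 2 * u <= X -> u <= X - v.
Proof. by lra. Qed.

Lemma eight_tenths_lt (R : realType) (h eta : R) : h = eta / 10 -> 0 < eta ->
  h + (h + (h + (h + (h + (h + (h + h)))))) < eta.
Proof. by move=> ->; lra. Qed.

(** * Convergence of the kernel flow estimate *)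

Section kernel_flow_consistency.
Context {R : realType} {d : nat} {dom : measure_display} {Omega : measurableType dom}
  (P : probability Omega R) (xi : lattice d -> {RV P >-> R}).
Hypothesis d0 : (0 < d)%N.
Hypothesis xi_normal : forall m : lattice d, m != 0 -> forall A : set R, measurable A ->
     distribution P (xi m) A = normal_prob 0 1 A.
Hypothesis xi_indep : forall (F : seq (lattice d)) (B : lattice d -> set R),
     uniq F -> (forall m, m \in F -> m != 0) -> (forall m, measurable (B m)) ->
     P [set w | forall m, m \in F -> B m (xi m w)]
     = \big[*%E/1%E]_(m <- F) P (xi m @^-1` B m).
Variables (a T Z tau s : R).
Hypotheses (a0 : 0 <= a) (da : d%:R < 2 * a).
Hypothesis HZ : forall N, boxsum N (pnorm (2 * a) : lattice d -> R) <= Z.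
Hypotheses (atau : a <= tau) (tauT : tau <= T) (as_ : a <= s) (sT : s <= T).
Hypothesis s_tau : 2 * s = 4 * tau + d%:R.

Local Notation Cup := (Cup T Z).
Local Notation clo := (clo d T).
Local Notation e1 := (unitv d0 1).
Local Notation half q := (unitv d0 (2 ^ q)%:Z).
Local Notation U w := (Uq s (fun m => xi m w)).
Local Notation var := (xi_var xi_normal).

Let C0 : 0 < Cup. Proof. by exact: lt_le_trans (Cup_ge1 T HZ). Qed.

Lemma cls_half_neq q m : (cls q.+1 m == cls q.+1 (m + half q)) = false.
Proof.
apply/negbTE/negP => /clsP/(_ (i0 d0)); rewrite !ffunE eqxx opprD addNKr ?addrA ?subrr ?sub0r.
rewrite dvdzE abszN !absz_nat expnS => /dvdn_leq; rewrite expn_gt0/= => /(_ isT).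
by rewrite leqNgt ltn_Pmull// expn_gt0.
Qed.

Lemma cls_coarsen q (m m' : lattice d) : cls q.+1 m == cls q.+1 m' -> cls q m == cls q m'.
Proof. by move/eqP => h; rewrite -(bar_cls q m) h bar_cls. Qed.

Lemma Vc_residual q (r : Jq d q.+1) w :
  cvgn (fun n => Tc xi (restr (fun m => cls q.+1 m == r) (amp s)) n w) ->
  cvgn (fun n => Tc xi (restr (fun m => cls q m == bar r) (amp s)) n w) ->
  Vc xi (residual tau s r) w = U w r - ratio tau r * U w (bar r).
Proof.
move=> c1 c2; rewrite !Uq_Vc /Vc; apply/cvg_lim => //.
have -> : (fun n => boxsum n (fun m => residual tau s r m * xi m w)) =
  (fun n => Tc xi (restr (fun m => cls q.+1 m == r) (amp s)) n w -
     ratio tau r * Tc xi (restr (fun m => cls q m == bar r) (amp s)) n w).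
  apply/funext => n; rewrite /Tc -boxsumZ !boxsumE -sumrB; apply: eq_bigr => m _.
  by rewrite /residual; ring.
by apply: cvgB; [exact: c1|apply: cvgM; [exact: cvg_cst|exact: c2]].
Qed.

Lemma num_bounded q (e kap Ze : R) : 0 < e -> 0 < kap ->
  (forall n, boxsum n (pnorm (d%:R + e) : lattice d -> R) <= Ze) ->
  exists A : set Omega, [/\ measurable A,
  (P A <= (var * (Cres d T Z / cnext d T * (2 ^+ d * (Ze + 1))) / kap)%:E)%E &
  forall w, ~ A w ->
    cvg_classes q.+1 (uhat s (fun m => xi m w)) -> cvg_classes q (uhat s (fun m => xi m w)) ->
    num s (fun m => xi m w) tau q <= kap * Nq R q `^ (- (2 * tau) + e)].
Proof.
move=> e0 kap0 HZe; have N0 := Nq_gt0 R q.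
have Np : 0 < Nq R q `^ (- (2 * tau) + e) by rewrite powR_gt0.
have At0 (r : Jq d q.+1) : 0 < At tau r by exact: (At_gt0 d0 a0 HZ).
have w0 (r : Jq d q.+1) : 0 <= (At tau r)^-1 by rewrite invr_ge0 ltW.
have hsig (r : Jq d q.+1) n : r \in index_enum _ ->
    boxsum n (fun m => residual tau s r m ^+ 2) <=
    Cres d T Z * Nq R q `^ (- (4 * tau)) * Hq R (bar r) `^ (- d%:R).
  by move=> _; exact: (boxsum_residual_sqr_le d0 a0 HZ atau tauT as_ sT s_tau).
have hE := sum_residual_le d0 a0 HZ atau tauT q e0 HZe.
have K0 : 0 < kap * Nq R q `^ (- (2 * tau) + e) by rewrite mulr_gt0.
have [A [mA PA HA]] := sum_sqr_Vc_le d0 xi_normal xi_indep (d_lt_2s da as_)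
  (fun r : Jq d q.+1 => residual_le d0 a0 HZ atau tauT as_ r) w0 hsig hE K0.
exists A; split => //.
  apply: le_trans PA _; rewrite lee_fin le_eqVlt; apply/orP; left; apply/eqP.
  set c := Cres d T Z / _ * _; set n := Nq R q `^ _ in Np *.
  by field; rewrite !gt_eqF.
move=> w /HA[cv hV] cu cu'.
apply: le_trans hV; rewrite /num le_eqVlt; apply/orP; left; apply/eqP.
apply: eq_bigr => r _; rewrite Vc_residual.
- by rewrite mulrC /ratio; congr (_ * _ ^+ 2); congr (_ - _); rewrite mulrA mulrAC.
- by have := cu r; rewrite restr_uhat.
- by have := cu' (bar r); rewrite restr_uhat.
Qed.

(** Multiplied by the variance H^(-2s), the weight leaves H^(-(d+e)), whose sum is bounded in
    [q]. *)
Lemma weighted_bounded q (e kap Ze : R) : 0 < e -> 0 < kap ->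
  (forall n, boxsum n (pnorm (d%:R + e) : lattice d -> R) <= Ze) ->
  exists A : set Omega, [/\ measurable A, (P A <= (var * (Cup * (Ze + 1)) / kap)%:E)%E &
  forall w, ~ A w -> cvg_classes q (uhat s (fun m => xi m w)) /\
    \sum_(r : Jq d q) Hq R r `^ (2 * s - d%:R - e) * U w r ^+ 2 <= kap].
Proof.
move=> e0 kap0 HZe.
have w0 (r : Jq d q) : 0 <= Hq R r `^ (2 * s - d%:R - e) by exact: powR_ge0.
have hsig (r : Jq d q) n : r \in index_enum _ ->
    boxsum n (fun m => restr (fun m => cls q m == r) (amp s) m ^+ 2) <= At s r.
  by move=> _; exact: (boxsum_restr_amp_sqr d0 a0 HZ as_).
have hE : \sum_(r : Jq d q) Hq R r `^ (2 * s - d%:R - e) * At s r <= Cup * (Ze + 1).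
  have de : 0 <= d%:R + e by rewrite addr_ge0// ltW.
  apply: le_trans (ler_wpM2l (ltW C0) (sum_Hq_le d0 q de HZe)).
  rewrite mulr_sumr; apply: ler_sum => r _.
  apply: le_trans (ler_wpM2l (w0 r) (At_upper d0 a0 HZ r as_ sT)) _.
  rewrite mulrCA -powRDp ?Hq_gt0//.
  by have -> : 2 * s - d%:R - e + - (2 * s) = - (d%:R + e) by ring.
have [A [mA PA HA]] := sum_sqr_Vc_le d0 xi_normal xi_indep (d_lt_2s da as_)
  (fun r : Jq d q => restr_amp_le d0 a0 as_ (fun m => cls q m == r)) w0 hsig hE kap0.
exists A; split => // w /HA[cv hV]; split.
  by apply: cvg_classes_Tc => r; apply: cv; rewrite mem_index_enum.
apply: le_trans hV; rewrite le_eqVlt; apply/orP; left; apply/eqP.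
by apply: eq_bigr => r _; rewrite Uq_Vc.
Qed.

Lemma tail_bounded q (D : pred (lattice d)) m0 (kap : R) : ((supn m0).*2 <= 2 ^ q)%N -> 0 < kap ->
  (forall m, D m -> (cls q m == cls q m0) && (m != m0)) ->
  exists A : set Omega, [/\ measurable A, (P A <= (var * Cup / kap)%:E)%E &
  forall w, ~ A w -> cvgn (fun n => Tc xi (restr D (amp s)) n w) /\
    Vc xi (restr D (amp s)) w ^+ 2 <= kap * Nq R q `^ (- (2 * s))].
Proof.
move=> hm0 kap0 hD; have N0 := Nq_gt0 R q.
have Np : 0 < Nq R q `^ (- (2 * s)) by rewrite powR_gt0.
have K0 : 0 < kap * Nq R q `^ (- (2 * s)) by rewrite mulr_gt0.
(* A single series, hence the index type [unit]. *)
have hsig (i : unit) n : i \in [:: tt] ->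
    boxsum n (fun m => restr D (amp s) m ^+ 2) <= Cup * Nq R q `^ (- (2 * s)).
  move=> _; apply: le_trans (boxsum_restr_amp_sqr d0 a0 HZ as_ D n) _.
  apply: le_trans (latsum_wt_tail_le d0 a0 HZ as_ sT hm0).
  apply: latsum_le; try exact: (cvg_wt_restr d0 a0 HZ).
    move=> m; rewrite {1}/restr; case: ifP => [/hD h|_]; first by rewrite /restr h.
    by apply: restr_ge0 => m'; exact: wt_ge0.
  by apply: restr_ge0 => m'; exact: wt_ge0.
have hE : \sum_(i <- [:: tt]) 1 * (Cup * Nq R q `^ (- (2 * s))) <= Cup * Nq R q `^ (- (2 * s)).
  by rewrite big_seq1 mul1r.
have [A [mA PA HA]] := sum_sqr_Vc_le d0 xi_normal xi_indep (d_lt_2s da as_)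
  (fun _ : unit => restr_amp_le d0 a0 as_ D) (fun=> ler01) hsig hE K0.
exists A; split => //.
  apply: le_trans PA _; rewrite lee_fin le_eqVlt; apply/orP; left; apply/eqP.
  set n := Nq R q `^ _ in Np *.
  by field; rewrite !gt_eqF.
move=> w /HA[cv hV]; split; first by apply: (cv tt); rewrite inE.
by move: hV; rewrite big_seq1 mul1r.
Qed.

Lemma xi_not_small m (k : R) : m != 0 -> 0 < k -> exists A : set Omega,
  [/\ measurable A, (P A <= k%:E)%E & forall w, ~ A w -> k <= `|xi m w|].
Proof.
move=> m0 k0; exists (xi m @^-1` `[- k, k]%classic); split.
- by rewrite -[_ @^-1` _]setTI; exact: measurable_funPT.
- by apply: le_trans (normal01_small_ball k0); rewrite -(xi_normal m0)//.
- move=> w /= h; rewrite leNgt; apply/negP => hk; apply: h.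
  by rewrite /= in_itv/= -ler_norml ltW.
Qed.

(* Stated with a limsup so as to lie in the sigma-algebra of the [xi m'], [m'] outside
   [Ibox d k], rather than only almost surely. *)
Definition next_nonneg k q m : set Omega :=
  if m \in Ibox d k then [set w | (0 <= limn_esup (fun n =>
     (Tc xi (restr (fun m' => cls q.+1 m' == cls q.+1 (m + half q)) (amp s)) n w)%:E))%E]
  else set0.

(** A frequency of the box in the shifted fine class would have the coarse class of [m], hence be
    [m], which lies in another fine class. *)
Lemma next_nonneg_outside k l m : (1 <= l)%N ->
  <<s outside (fun m : lattice d => m != 0) xi (fun m => m \in Ibox d k) >> (next_nonneg k (k + l) m).
Proof.
move=> l1; rewrite /next_nonneg; case: ifP => hm; last exact: sigma_algebra0.
have -> : Tc xi = (fun c n w => \sum_(m <- boxseq d n) c m * xi m w).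
  by apply/funext => c; apply/funext => n; apply/funext => w; rewrite /Tc boxsumE.
apply: limsup_ge0_outside => m' c'; apply/andP; split.
  by apply: contra c' => /eqP ->; rewrite /restr /amp /wt eqxx if_same.
apply: contra c' => hm'; rewrite /restr; case: ifP => // h.
have e : cls (k + l) m' = cls (k + l) m.
  by rewrite -bar_cls (eqP h) bar_cls cls_shift.
by move: h; rewrite (Ibox_cls_inj l1 hm' hm e) cls_half_neq.
Qed.

(** Aliasing is at most half of the amplitude, so the coarse sum has the sign of [xi m], which
    [opposite] sets against that of the fine sum. *)
Lemma opposite_next k l m w : m \in Ibox d k ->
  cvg_classes (k + l).+1 (uhat s (fun m => xi m w)) ->
  opposite xi (next_nonneg k (k + l)) m w ->
  cvgn (fun n => Tc xi (restc s (k + l) m) n w) -> `|Vc xi (restc s (k + l) m) w| <= amp s m / 2 ->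
  U w (cls (k + l).+1 (m + half (k + l))) * U w (cls (k + l) m) <= 0.
Proof.
move=> hm cu hopp cv hV; have [_ ->] := Uq_split cv.
have := cu (cls (k + l).+1 (m + half (k + l))); rewrite restr_uhat => cn.
have GE : next_nonneg k (k + l) m w <-> 0 <= U w (cls (k + l).+1 (m + half (k + l))).
  by rewrite /next_nonneg hm/= (limsup_Tc cn) lee_fin Uq_Vc.
have am := amp_ge0 s m.
move: hV; rewrite ler_norml => /andP[V1 V2].
case: hopp => -[]; rewrite /= in_itv/= ?andbT => hx hG.
  apply: mulr_le0_ge0; first by rewrite leNgt; apply/negP => /ltW/GE.
  by have := ler_wpM2l am hx; lra.
apply: mulr_ge0_le0; first exact/GE.
by have := ler_wpM2l am hx; lra.
Qed.

Definition cmin (l : nat) (u0 : R) : R :=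
  Num.min (cgood d T Z l (@tail_prob R)) (cnext d T * (u0 / (2 * Cup)) ^+ 2).

Lemma cmin_gt0 l u0 : 0 < u0 -> 0 < cmin l u0.
Proof.
move=> u00; rewrite lt_min (cgood_gt0 d0 T HZ l (@tail_prob_gt0 R))/=.
by rewrite mulr_gt0 ?cnext_gt0// exprn_gt0// divr_gt0// mulr_gt0.
Qed.

Section one_level.
Variables (k l : nat) (w : Omega) (u0 C1 C2 C3 e eps : R) (g : seq (lattice d)).
Let q := (k + l)%N.
Local Notation N := (Nq R q).
Local Notation x := (fun m => xi m w).
Hypothesis l2 : (2 <= l)%N.
Hypotheses (cu : cvg_classes q.+1 (uhat s x)) (cu' : cvg_classes q (uhat s x)).
Hypotheses (u00 : 0 < u0) (hu1 : u0 <= `|U w (cls q.+1 e1)|) (hu0 : u0 <= `|U w (cls q e1)|).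
Hypothesis hu2 : U w (cls q.+1 (e1 + half q)) ^+ 2 <= C3 * N `^ (- (2 * s)).
Hypotheses (C10 : 0 <= C1) (hnum : num s x tau q <= C1 * N `^ (- (2 * tau) + e)).
Hypothesis hden : \sum_(r : Jq d q.+1) Hq R r `^ (2 * s - d%:R - e) * U w r ^+ 2 <= C2.
Hypotheses (ug : uniq g) (gI : {subset g <= Ibox d k}) (gn : @tail_prob R / 4 * nq R d k <= (size g)%:R).
Hypothesis gU : forall m, m \in g -> amp s m / 2 <= `|U w (cls q m)|.
Hypothesis gopp : forall m, m \in g -> U w (cls q.+1 (m + half q)) * U w (cls q m) <= 0.
Hypotheses (e0 : 0 < e) (e_eps : 2 * e <= eps) (e_tau : 2 * e <= tau).

Hypothesis N_large : Num.max (4 * C3 / (cnext d T * (u0 / Cup)) ^+ 2)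
  (C1 * (C2 / clo * 2 `^ (2 * T)) / (cmin l u0 * (u0 ^+ 2 / Cup))) < N `^ e.

(** The first bound in [N_large] makes the shifted class of [e1] negligible, for [t] below the
    target; the second contradicts [ratio_bound] on either side. *)
Lemma KF_obj_lt t : a <= t -> t <= T -> eps < `|t - tau| -> KF_obj s x q.+1 tau < KF_obj s x q.+1 t.
Proof.
move=> at_ tT ht; have N1 := Nq_ge1 R q; have N0 := Nq_gt0 R q.
have cw t' p : a <= t' -> cvg_classes p (wt t' : lattice d -> R).
  by move=> at' r; exact: (cvg_wt_restr d0 a0 HZ).
have A0 t' p (r : Jq d p) : a <= t' -> t' <= T -> 0 < At t' r by exact: (At_gt0 d0 a0 HZ).
rewrite (KF_objE (cw _ _ atau) (fun r => A0 _ _ r atau tauT) cu (cw _ _ atau) (fun r => A0 _ _ r atau tauT) cu').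
rewrite (KF_objE (cw _ _ at_) (fun r => A0 _ _ r at_ tT) cu (cw _ _ at_) (fun r => A0 _ _ r at_ tT) cu').
have hd t' : a <= t' -> t' <= T -> u0 ^+ 2 / Cup <= den s x t' q.+1.
  by move=> at' tT'; exact: (den_term_le d0 a0 HZ at' tT' (ltW u00) hu1).
have uC : 0 < u0 ^+ 2 / Cup by rewrite divr_gt0// exprn_gt0.
have dt0 : 0 < den s x t q.+1 by apply: lt_le_trans (hd _ at_ tT).
have cm := cmin_gt0 l u00; have cn := cnext_gt0 d0 T; have c0 := clo_gt0 d0 T.
have sd : 2 * s - d%:R = 4 * tau by rewrite s_tau addrK.
move: N_large; rewrite gt_max => /andP[large1 large2].
have C20 : 0 <= C2.
  by apply: le_trans hden; apply: sumr_ge0 => r _; rewrite mulr_ge0 ?powR_ge0 ?sqr_ge0.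
(* [z] and [y] are the exponents of the numerator from below and of the denominator from above. *)
suff [z [y [hz hy0 hyT hy he]]] : exists z y, [/\ cmin l u0 * N `^ z <= num s x t q,
    0 <= y, y <= 2 * T, 2 * t - (2 * s - d%:R - e) <= y & e <= z - (- (2 * tau) + e) - y].
  rewrite ltNge; apply/negP => hle.
  have hD : den s x t q.+1 <= C2 / clo * 2 `^ (2 * T) * N `^ y.
    apply: le_trans (den_le_powR d0 a0 HZ at_ tT hden hy0 hy) _.
    rewrite mulrA ler_wpM2r ?powR_ge0// ler_wpM2l ?divr_ge0 ?(ltW c0)//.
    by apply: ler_powR => //; rewrite ler1n.
  have := ratio_bound N1 cm hz dt0 hD hnum C10 uC (hd _ atau tauT) hle he.
  rewrite [cmin _ _ * _ * _]mulrC -ler_pdivlMr ?(mulr_gt0 cm uC)// => h.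
  by have := lt_le_trans large2 h; rewrite ltxx.
have [tt|tt] := ltP tau t.
  have ht' : eps < t - tau by rewrite gtr0_norm ?subr_gt0 in ht.
  exists (2 * t - (2 * s - d%:R)), (Num.max 0 (2 * t - (2 * s - d%:R - e))); split.
  - have hn := num_ge_good a0 HZ as_ sT l2 (erefl : q = (k + l)%N) ug gI gn gU gopp at_ tT.
    apply: le_trans hn.
    by rewrite ler_wpM2r ?powR_ge0// /cmin ge_min lexx.
  - by rewrite le_max lexx.
  - have T0 : 0 <= T by exact: le_trans a0 (le_trans at_ tT).
    rewrite ge_max mulr_ge0//= sd.
    exact: den_exponent_above_le.
  - by rewrite le_max lexx orbT.
  - by rewrite sd; exact: num_exponent_above_ge ht'.
have ht' : eps < tau - t by rewrite distrC ger0_norm ?subr_ge0 in ht.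
exists (- (2 * t)), 0; split => //.
- apply: le_trans (num_ge_shift a0 HZ at_ tT (ltW u00) hu0 _).
    by rewrite ler_wpM2r ?powR_ge0// /cmin ge_min lexx orbT.
  have K0 : 0 < cnext d T * (u0 / Cup) by rewrite mulr_gt0// divr_gt0.
  have r0 : 0 <= cnext d T * N `^ (- (2 * t)) * (u0 / Cup).
    by rewrite mulr_ge0 ?divr_ge0 ?mulr_ge0 ?powR_ge0 ?(ltW cn) ?(ltW u00) ?(ltW C0).
  rewrite -(@ler_pXn2r _ 2%N)// ?nnegrE ?mulr_ge0// exprMn real_normK ?num_real//.
  have -> : (cnext d T * N `^ (- (2 * t)) * (u0 / Cup)) ^+ 2 =
      (cnext d T * (u0 / Cup)) ^+ 2 * N `^ (- (4 * t)).
    have -> : - (4 * t) = - (2 * t) + - (2 * t) by ring.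
    by rewrite powRDp//; ring.
  rewrite ltr_pdivrMr ?exprn_gt0// in large1.
  apply: (@le_trans _ _ (2 ^+ 2 * (C3 * N `^ (- (2 * s))))).
    by rewrite ler_wpM2l.
  have -> : 2 ^+ 2 * (C3 * N `^ (- (2 * s))) = 4 * C3 * N `^ (- (2 * s)) by ring.
  apply: (@le_trans _ _ (N `^ e * (cnext d T * (u0 / Cup)) ^+ 2 * N `^ (- (2 * s)))).
    by rewrite ler_wpM2r ?powR_ge0// ltW.
  rewrite mulrAC mulrC ler_wpM2l ?sqr_ge0// -powRDp//; apply: ler_powR => //.
  by rewrite s_tau; exact: (shift_exponent_le (ler0n _ _) e0 e_eps ht').
- by rewrite mulr_ge0// (le_trans a0)// (le_trans atau).
- by rewrite sd; exact: den_exponent_below_le0.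
- exact: num_exponent_below_ge ht'.
Qed.

End one_level.

Lemma KF_consistent b : 0 < tau -> b <= T -> tau <= b ->
  argmin_cvg_in_prob P (fun q w => KF_obj s (fun m => xi m w) q) a b tau.
Proof.
move=> tau0 bT taub eps eta eps0 eta0.
pose e := Num.min eps tau / 2.
have e0 : 0 < e by rewrite divr_gt0// lt_min eps0.
have e_eps : 2 * e <= eps by rewrite /e mulrC divfK// ge_min lexx.
have e_tau : 2 * e <= tau by rewrite /e mulrC divfK// ge_min lexx orbT.
(* Eight exceptional events of probability at most [h] will be joined. *)
pose h := eta / 10; have h0 : 0 < h by rewrite divr_gt0.
have de : d%:R < d%:R + e by rewrite ltrDl.
have [Ze [Ze0 HZe]] := pnorm_sum_bounded d0 de.
have v0 : 0 < var by exact: xi_var_gt0.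
have Ze1 : 0 < Ze + 1 by rewrite addr_gt0.
have cn := cnext_gt0 d0 T; have c0 := clo_gt0 d0 T.
have Cr0 : 0 < Cres d T Z by rewrite addr_gt0// divr_gt0 ?exprn_gt0.
have m1 : e1 != 0 by rewrite -supn_gt0 supn_unitv.
pose X1 := Cres d T Z / cnext d T * (2 ^+ d * (Ze + 1)).
pose X2 := Cup * (Ze + 1).
(* The thresholds at which Markov's inequality gives probability [h]. *)
pose C1 := var * X1 / h; pose C2 := var * X2 / h; pose C3 := var * Cup / h; pose C4 := var / h.
have X10 : 0 < X1 by rewrite mulr_gt0 ?divr_gt0// mulr_gt0// exprn_gt0.
have X20 : 0 < X2 by rewrite mulr_gt0.
have C10 : 0 < C1 by rewrite divr_gt0// mulr_gt0.
have C20 : 0 < C2 by rewrite divr_gt0// mulr_gt0.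
have C30 : 0 < C3 by rewrite divr_gt0// mulr_gt0.
have C40 : 0 < C4 by rewrite divr_gt0.
have Xh (y : R) : 0 < y -> y / (y / h) = h by move=> y0; field; rewrite !gt_eqF.
(* Outside an event of probability [h] the coefficient at [e1] is at least [2 * u0], and aliasing
   takes away at most [u0]. *)
pose u0 := amp s e1 * h / 2.
have am : 0 < amp s e1 by exact: amp_gt0.
have u00 : 0 < u0 by rewrite divr_gt0// mulr_gt0.
have [l [k0 [l2 hgood]]] := good_points d0 xi_normal xi_indep a0 da HZ as_ sT h0.
have [k1 hk1] := Nq_powR_large (Num.max (4 * C3 / (cnext d T * (u0 / Cup)) ^+ 2)
  (C1 * (C2 / clo * 2 `^ (2 * T)) / (cmin l u0 * (u0 ^+ 2 / Cup)))) e0.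
have s2 : 0 < 2 * s by apply: le_lt_trans (d_lt_2s da as_).
have [k2 hk2] := Nq_powR_large (C3 / u0 ^+ 2) s2.
(* The successor excludes level 0, where the predecessor [q.-1] in [KF_obj] would be the same
   grid. *)
exists (l + maxn k0 (maxn k1 k2)).+1%N => -[//|q]; rewrite ltnS => hq.
pose k := (q - l)%N; have kl : q = (k + l)%N by rewrite subnK// (leq_trans (leq_addr _ _) hq).
have hk : (maxn k0 (maxn k1 k2) <= k)%N by rewrite /k leq_subRL ?(leq_trans (leq_addr _ _) hq).
have hq2 : (maxn k0 (maxn k1 k2) <= q)%N by rewrite kl (leq_trans hk)// leq_addr.
move: hk hq2; rewrite !geq_max => /and3P[hk0 _ _] /and3P[_ /hk1{}hk1 /hk2{}hk2].
have q1 : (1 <= q)%N by rewrite kl (leq_trans _ (leq_addl _ _))// ltnW.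
rewrite kl in hk1 hk2 q1 *.
have e1q : ((supn e1).*2 <= 2 ^ (k + l))%N by rewrite supn_unitv -[X in (X <= _)%N](expn1 2) leq_exp2l.
clearbody k.
have hG m : <<s outside (fun m : lattice d => m != 0) xi (fun m => m \in Ibox d k) >>
    (next_nonneg k (k + l) m) by apply: next_nonneg_outside; exact: ltnW.
have [A1 [mA1 PA1 HA1]] := hgood k hk0 (next_nonneg k (k + l)) hG.
have [A2 [mA2 PA2 HA2]] := num_bounded (k + l) e0 C10 HZe.
have [A3 [mA3 PA3 HA3]] := weighted_bounded (k + l).+1 e0 C20 HZe.
have [A4 [mA4 PA4 HA4]] := den_bounded d0 xi_normal xi_indep a0 da HZ as_ (k + l) C40.
have [A5 [mA5 PA5 HA5]] := @tail_bounded (k + l)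
  (fun m => (cls (k + l) m == cls (k + l) e1) && (m != e1)) e1 C3 e1q C30 (fun m hm => hm).
have D6 m : (cls (k + l).+1 m == cls (k + l).+1 e1) && (m != e1) ->
    (cls (k + l) m == cls (k + l) e1) && (m != e1).
  by case/andP => /cls_coarsen -> ->.
have [A6 [mA6 PA6 HA6]] := tail_bounded e1q C30 D6.
have D7 m : cls (k + l).+1 m == cls (k + l).+1 (e1 + half (k + l)) ->
    (cls (k + l) m == cls (k + l) e1) && (m != e1).
  move=> hm; have := cls_coarsen hm; rewrite cls_shift => -> /=.
  by apply: contraTneq hm => ->; rewrite cls_half_neq.
have [A7 [mA7 PA7 HA7]] := tail_bounded e1q C30 D7.
have [A8 [mA8 PA8 HA8]] := xi_not_small m1 h0.
rewrite (Xh _ (mulr_gt0 v0 X10)) in PA2; rewrite (Xh _ (mulr_gt0 v0 X20)) in PA3.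
rewrite (Xh _ v0) in PA4; rewrite (Xh _ (mulr_gt0 v0 C0)) in PA5 PA6 PA7.
have PU (B C : set Omega) (p p' : R) : measurable B /\ (P B <= p%:E)%E ->
    measurable C /\ (P C <= p'%:E)%E -> measurable (B `|` C) /\ (P (B `|` C) <= (p + p')%:E)%E.
  move=> [mB PB] [mC PC]; split; first exact: measurableU.
  by apply: le_trans (measureU2 _ mB mC) _; rewrite EFinD; exact: leeD.
have [mU PleU] := PU _ _ _ _ (conj mA1 PA1) (PU _ _ _ _ (conj mA2 PA2) (PU _ _ _ _ (conj mA3 PA3)
  (PU _ _ _ _ (conj mA4 PA4) (PU _ _ _ _ (conj mA5 PA5) (PU _ _ _ _ (conj mA6 PA6)
  (PU _ _ _ _ (conj mA7 PA7) (conj mA8 PA8))))))).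
exists (A1 `|` (A2 `|` (A3 `|` (A4 `|` (A5 `|` (A6 `|` (A7 `|` A8))))))).
split => //; split.
  by apply: le_lt_trans PleU _; rewrite lte_fin; exact: eight_tenths_lt.
move=> w nA t [/andP[at_ tb] tmin].
have [g [ug gI gn gm]] := HA1 w (fun z => nA (or_introl z)).
have {}HA2 := HA2 w (fun z => nA (or_intror (or_introl z))).
have [cu hden] := HA3 w (fun z => nA (or_intror (or_intror (or_introl z)))).
have [cu' _] := HA4 w (fun z => nA (or_intror (or_intror (or_intror (or_introl z))))).
have [cv5 hV5] := HA5 w (fun z => nA (or_intror (or_intror (or_intror (or_intror (or_introl z)))))).
have [cv6 hV6] := HA6 w (fun z => nA (or_intror (or_intror (or_intror (or_intror (or_intror (or_introl z))))))).
have [_ hV7] := HA7 w (fun z => nA (or_intror (or_intror (or_intror (or_intror (or_intror (or_intror (or_introl z)))))))).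
have hx := HA8 w (fun z => nA (or_intror (or_intror (or_intror (or_intror (or_intror (or_intror (or_intror z)))))))).
have small V : V ^+ 2 <= C3 * Nq R (k + l) `^ (- (2 * s)) -> u0 <= `|amp s e1 * xi e1 w + V|.
  move=> hV; have V1 : `|V| <= u0.
    rewrite -(@ler_pXn2r _ 2%N)// ?nnegrE ?(ltW u00)// real_normK ?num_real//.
    apply: (le_trans hV); rewrite powRN ler_pdivrMr ?powR_gt0 ?Nq_gt0//.
    by rewrite mulrC -ler_pdivrMr ?exprn_gt0// ltW.
  have h1 : 2 * u0 <= `|amp s e1 * xi e1 w|.
    by rewrite normrM (gtr0_norm am) /u0 mulrC divfK// ler_pM2l.
  have h2 := lerB_normD (amp s e1 * xi e1 w) V.
  by apply: le_trans h2; exact: le_sub_half.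
have hu0 : u0 <= `|U w (cls (k + l) e1)| by have [_ ->] := Uq_split cv5; exact: small.
have hu1 : u0 <= `|U w (cls (k + l).+1 e1)| by have [_ ->] := Uq_split cv6; exact: small.
have hu2 : U w (cls (k + l).+1 (e1 + half (k + l))) ^+ 2 <= C3 * Nq R (k + l) `^ (- (2 * s)).
  by rewrite Uq_Vc.
have gU m : m \in g -> amp s m / 2 <= `|U w (cls (k + l) m)|.
  by move=> /gm[h1 h2 h3]; exact: good_Uq_ge h1 h2 h3.
have gopp m : m \in g -> U w (cls (k + l).+1 (m + half (k + l))) * U w (cls (k + l) m) <= 0.
  by move=> hm; have [h1 h2 h3] := gm _ hm; exact: opposite_next (gI _ hm) cu h1 h2 h3.
rewrite leNgt; apply/negP => ht.
have hlt := KF_obj_lt l2 cu cu' u00 hu1 hu0 hu2 (ltW C10) (HA2 cu cu') hden ug gI gn gU gopp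
  e0 e_eps e_tau hk1 at_ (le_trans tb bT) ht.
have htau : a <= tau <= b by rewrite atau taub.
by have := le_lt_trans (tmin tau htau) hlt; rewrite ltxx.
Qed.

End kernel_flow_consistency.

Theorem theorem2p1 (R : realType) (d : nat) (delta s : R)
  (dom : measure_display) (Omega : measurableType dom) (P : probability Omega R)
  (xi : lattice d -> {RV P >-> R}) :
  (0 < d)%N -> 0 < delta ->
  (* each xi_m, m <> 0, is standard normal *)
  (forall m : lattice d, m != 0 -> forall A : set R, measurable A ->
     distribution P (xi m) A = normal_prob 0 1 A) ->
  (* the xi_m, m <> 0, are mutually independent *)
  (forall (F : seq (lattice d)) (B : lattice d -> set R),
     uniq F -> (forall m, m \in F -> m != 0) -> (forall m, measurable (B m)) ->
     P [set w | forall m, m \in F -> B m (xi m w)]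
     = \big[*%E/1%E]_(m <- F) P (xi m @^-1` B m)) ->
  let a := (d%:R / 2 + delta) in
  let b := delta^-1 in
  (a <= s <= b ->
     argmin_cvg_in_prob P (fun q w => EB_obj s (fun m => xi m w) q) a b s) /\
  (a <= (s - d%:R / 2) / 2 <= b ->
     argmin_cvg_in_prob P (fun q w => KF_obj s (fun m => xi m w) q) a b ((s - d%:R / 2) / 2)).
Proof.
move=> d0 delta0 xi_normal xi_indep a b.
have dR : 0 <= d%:R :> R by [].
have a0 : 0 < a by rewrite ltr_wpDl// divr_ge0.
have da : d%:R < 2 * a by rewrite /a mulrDr mulrC divfK// ltrDl mulr_gt0.
have [Z [_ HZ]] := pnorm_sum_bounded d0 da.
split => /andP[at_ tb].
  exact: (EB_consistent d0 xi_normal xi_indep (ltW a0) da HZ at_ tb).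
set tau := (s - d%:R / 2) / 2 in at_ tb *.
have sE : s = 2 * tau + d%:R / 2 by rewrite /tau; field.
have s_tau : 2 * s = 4 * tau + d%:R by rewrite /tau; field.
have tau0 : 0 < tau by exact: lt_le_trans at_.
have tau_s : tau <= s by rewrite sE mulr_natl mulr2n -addrA lerDl addr_ge0 ?(ltW tau0)// divr_ge0.
have b0 : 0 <= b by rewrite ltW// invr_gt0.
have s0 : 0 <= s by exact: le_trans (ltW tau0) tau_s.
(* The upper limit is taken as [b + s] because [s] may exceed [b], while the bounds on [At] are
   applied at [s] as well. *)
have bT : b <= b + s by rewrite lerDl.
have sT : s <= b + s by rewrite lerDr.
exact: (KF_consistent d0 xi_normal xi_indep (ltW a0) da HZ at_ (le_trans tb bT)
  (le_trans at_ tau_s) sT s_tau tau0 bT tb).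
Qed.
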